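(* Let $\Omega$, $\mathcal T_h$, $\mathbf V_h$, $a_h(\cdot,\cdot)$ and $\|\cdot\|_h$ be as in the context. There exist constants $\eta_1^*,\eta_2^*>0$ and $c>0$, depending only on the shape regularity of the meshes (and not on the mesh sizes or the polynomial degrees), such that whenever $\eta_1>\eta_1^*$ and $\eta_2>\eta_2^*$, $$a_h(\mathbf v,\mathbf v)\ \ge\ c\,\|\mathbf v\|_h^2\qquad\text{for all }\mathbf v\in\mathbf V_h .$$
   Context: $\Omega\subset\mathbb R^d$ ($d=2,3$) is a bounded simply-connected Lipschitz polygon/polyhedron; in $d=2$ the operator $\mathrm{curl}$ and the tangential trace $\times\mathbf n$ have their standard two-dimensional meanings. $\mathcal T_h$ is a shape-regular affine partition of $\Omega$ into triangles ($d=2$) or tetrahedra ($d=3$), possibly with hanging nodes; each $K\in\mathcal T_h$ has diameter $h_K$ and a polynomial degree $p_K\ge 2$. The DG space is $\mathbf V_h=\{\mathbf v\in\mathbf L^2(\Omega):\mathbf v|_K\in (P_{p_K}(K))^d\ \forall K\}$, $P_k$ being polynomials of total degree $\le k$. $\mathcal E_h$ is the set of faces (edges if $d=2$), interior ones $\mathcal E_h^0$ and boundary ones $\mathcal E_h^\partial$. For an interior face $f$ shared by $K^\pm$ with outward unit normals $\mathbf n^\pm$, set $h_f=\max(h_{K^+},h_{K^-})$, $p_f=\min(p_{K^+},p_{K^-})$, $\llbracket\mathbf v\rrbracket=\mathbf v^+\times\mathbf n^++\mathbf v^-\times\mathbf n^-$, $\llbracket\mathrm{curl}\,\mathbf v\rrbracket=\mathrm{curl}\,\mathbf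 v^+\times\mathbf n^++\mathrm{curl}\,\mathbf v^-\times\mathbf n^-$, $\{\mathrm{curl}^k\mathbf v\}=(\mathrm{curl}^k\mathbf v^++\mathrm{curl}^k\mathbf v^-)/2$ ($k=2,3$), where $\mathbf v^\pm$ are traces from $K^\pm$. On a boundary face $f\subset\partial K$ (normal $\mathbf n$): $h_f=h_K$, $p_f=p_K$, $\llbracket\mathbf v\rrbracket=\mathbf v\times\mathbf n$, $\llbracket\mathrm{curl}\,\mathbf v\rrbracket=\mathrm{curl}\,\mathbf v\times\mathbf n$, $\{\mathrm{curl}^k\mathbf v\}=\mathrm{curl}^k\mathbf v$. With elementwise (broken) curls $\mathrm{curl}_h$ and penalty parameters $\eta_1,\eta_2>0$, $$a_h(\mathbf w,\mathbf v)=\sum_K\int_K(\mathrm{curl}^2\mathbf w\cdot\mathrm{curl}^2\mathbf v+\mathbf w\cdot\mathbf v)+\sum_{f\in\mathcal E_h}\int_f\Big(\{\mathrm{curl}^3\mathbf w\}\cdot\llbracket\mathbf v\rrbracket+\{\mathrm{curl}^2\mathbf w\}\cdot\llbracket\mathrm{curl}\,\mathbf v\rrbracket+\{\mathrm{curl}^3\mathbf v\}\cdot\llbracket\mathbf w\rrbracket+\{\mathrm{curl}^2\mathbf v\}\cdot\llbracket\mathrm{curl}\,\mathbf w\rrbracket+\tfrac{\eta_1p_f^2}{h_f}\llbracket\mathrm{curl}\,\mathbf v\rrbracket\cdot\llbracket\mathrm{curl}\,\mathbf w\rrbracket+\tfrac{\eta_2p_f^6}{h_f^3}\llbracket\mathbf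 v\rrbracket\cdot\llbracket\mathbf w\rrbracket\Big)ds.$$ The DG norm is $\|\mathbf v\|_h^2=\sum_K(\|\mathrm{curl}^2\mathbf v\|_{0,K}^2+\|\mathbf v\|_{0,K}^2)+\sum_{f\in\mathcal E_h}\big(h_f^{-3}p_f^6\|\llbracket\mathbf v\rrbracket\|_{0,f}^2+h_f^3p_f^{-6}\|\{\mathrm{curl}^3\mathbf v\}\|_{0,f}^2+h_fp_f^{-2}\|\{\mathrm{curl}^2\mathbf v\}\|_{0,f}^2+h_f^{-1}p_f^2\|\llbracket\mathrm{curl}\,\mathbf v\rrbracket\|_{0,f}^2\big)$.
   Formalization: Adds bounded ratios of element diameters and of polynomial degrees across each interior face, and the constants depend on these bounds too; with hanging nodes or unbounded degree jumps the claim fails for bubble functions, since h_f is a maximum and p_f a minimum. *)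

(* Defs.v *)
(*  - a point of R^d is a function  nat -> R  (only coordinates 0..d-1 used); *)
(*  - every vector field takes values in R^3 (nat -> R, components 0,1,2);   *)
(*    for d = 2 the plane is embedded as {x_3 = 0} and fields have a zero    *)
(*    third component, so the 3-d curl / cross product reproduce the         *)
(*    standard 2-d scalar/vector curls and tangential traces;                *)
(*  - a DG function is given elementwise by its polynomial pieces.           *)
From Stdlib Require Import Reals Lra List Arith.
From Coquelicot Require Import Coquelicot.
Import ListNotations.
Open Scope R_scope.

Definition pt := nat -> R.
Definition vec := nat -> R.
Definition field := pt -> vec.

Fixpoint sumR (n : nat) (f : nat -> R) : R :=
  match n with O => 0 | S n' => sumR n' f + f n' end.
Fixpoint sumN (n : nat) (f : nat -> nat) : nat :=
  match n with O => O | S n' => (sumN n' f + f n')%nat end.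
Fixpoint prodR (n : nat) (f : nat -> R) : R :=
  match n with O => 1 | S n' => prodR n' f * f n' end.
Fixpoint maxR (n : nat) (f : nat -> R) : R :=
  match n with O => 0 | S n' => Rmax (maxR n' f) (f n') end.
Definition sum_list (l : list R) : R := fold_right Rplus 0 l.

Definition dot3 (u v : vec) : R := sumR 3 (fun i => u i * v i).
Definition vadd (u v : vec) : vec := fun i => u i + v i.
Definition vscal (a : R) (u : vec) : vec := fun i => a * u i.
Definition vopp (u : vec) : vec := fun i => - u i.
Definition cross (u v : vec) : vec := fun i =>
  match i with
  | 0%nat => u 1%nat * v 2%nat - u 2%nat * v 1%nat
  | 1%nat => u 2%nat * v 0%nat - u 0%nat * v 2%nat
  | 2%nat => u 0%nat * v 1%nat - u 1%nat * v 0%nat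
  | _ => 0
  end.

Definition dotd (d : nat) (x y : pt) : R := sumR d (fun j => x j * y j).
Definition distd (d : nat) (x y : pt) : R :=
  sqrt (sumR d (fun j => (x j - y j) ^ 2)).

Fixpoint det (n : nat) (M : nat -> nat -> R) : R :=
  match n with
  | O => 1
  | S n' => sumR n (fun j => (-1) ^ j * M 0%nat j *
              det n' (fun r c => M (S r) (if (c <? j)%nat then c else S c)))
  end.

(* An m-simplex in R^d is given by its vertices a 0, ..., a m.           *)
Definition in_simplex (strict : bool) (d m : nat) (a : nat -> pt) (x : pt) : Prop :=
  exists lam : nat -> R,
    (forall i, (i <= m)%nat -> if strict then 0 < lam i else 0 <= lam i) /\
    sumR (S m) lam = 1 /\
    forall j, (j < d)%nat -> x j = sumR (S m) (fun i => lam i * a i j).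

(* m! * (m-dimensional volume) = sqrt of the Gram determinant of the edges *)
Definition jac (d m : nat) (a : nat -> pt) : R :=
  sqrt (det m (fun i j => sumR d (fun l => (a (S i) l - a 0%nat l) *
                                            (a (S j) l - a 0%nat l)))).

Definition diam (d m : nat) (a : nat -> pt) : R :=
  maxR (S m) (fun i => maxR (S m) (fun j => distd d (a i) (a j))).

(* Integration over simplices: affine pull-back to the reference simplex   *)
(* {t_i >= 0, sum t_i <= 1}, integrated by iterated (Riemann) integrals.   *)
Definition cons_pt (t : R) (y : pt) : pt :=
  fun i => match i with O => t | S i' => y i' end.
Fixpoint refint (m : nat) (s : R) (g : pt -> R) : R :=
  match m with
  | O => g (fun _ => 0)
  | S m' => RInt (fun t => refint m' (s - t) (fun y => g (cons_pt t y))) 0 s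
  end.
Definition affine (m : nat) (a : nat -> pt) (t : pt) : pt :=
  fun j => a 0%nat j + sumR m (fun i => t i * (a (S i) j - a 0%nat j)).
Definition int_simplex (d m : nat) (a : nat -> pt) (g : pt -> R) : R :=
  jac d m a * refint m 1 (fun t => g (affine m a t)).

Definition is_poly (d k : nat) (f : pt -> R) : Prop :=
  exists l : list (R * (nat -> nat))%type,
    List.Forall (fun ca : (R * (nat -> nat))%type => (sumN d (snd ca) <= k)%nat) l /\
    forall x, f x = sum_list (map (fun ca => fst ca * prodR d (fun i => x i ^ (snd ca i))) l).

Definition upd (x : pt) (i : nat) (t : R) : pt :=
  fun j => if (j =? i)%nat then t else x j.
Definition pd (i : nat) (f : pt -> R) (x : pt) : R :=
  Derive (fun t => f (upd x i t)) (x i).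
Definition comp (F : field) (c : nat) : pt -> R := fun x => F x c.
Definition curl (F : field) : field := fun x i =>
  match i with
  | 0%nat => pd 1 (comp F 2) x - pd 2 (comp F 1) x
  | 1%nat => pd 2 (comp F 0) x - pd 0 (comp F 2) x
  | 2%nat => pd 0 (comp F 1) x - pd 1 (comp F 0) x
  | _ => 0
  end.
Definition curlk (k : nat) (F : field) : field := Nat.iter k curl F.

Record element := mkElement { everts : nat -> pt ; edeg : nat }.
Definition elem0 : element := mkElement (fun _ _ => 0) 0.
(* A face piece: a (d-1)-simplex (vertices 0..d-1), the index of the element
   K^+ it bounds, the index of K^- (None for a boundary face) and the unit
   normal n^+ outward to K^+ (n^- = - n^+). *)
Record face := mkFace { fverts : nat -> pt ; fplus : nat ; fminus : option nat ;
                        fnormal : vec }.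

Definition elt (Th : list element) (k : nat) : element := nth k Th elem0.
Definition hK (d : nat) (K : element) : R := diam d d (everts K).
Definition facet (a : nat -> pt) (j : nat) : nat -> pt :=
  fun i => if (i <? j)%nat then a i else a (S i).
Definition barycenter (d : nat) (f : face) : pt :=
  fun j => sumR d (fun i => fverts f i j) / INR d.
Definition adjacent (f : face) (k : nat) : Prop :=
  fplus f = k \/ fminus f = Some k.

(* Admissible (affine simplicial, possibly non-conforming) mesh of
   Omega = interior of the union of the elements, with E_h a decomposition
   of the element boundaries into (d-1)-simplicial face pieces. *)
Definition mesh_ok (d : nat) (Th : list element) (Eh : list face) : Prop :=
  (forall k, (k < length Th)%nat -> 0 < jac d d (everts (elt Th k))) /\
  (forall k k', (k < length Th)%nat -> (k' < length Th)%nat -> k <> k' ->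
     ~ exists x, in_simplex true d d (everts (elt Th k)) x /\
                 in_simplex true d d (everts (elt Th k')) x) /\
  (forall f, In f Eh ->
     0 < jac d (d - 1) (fverts f) /\
     (fplus f < length Th)%nat /\
     (forall m, fminus f = Some m -> (m < length Th)%nat /\ m <> fplus f) /\
     (forall k, adjacent f k -> exists j, (j <= d)%nat /\
        forall i, (i < d)%nat ->
          in_simplex false d (d - 1) (facet (everts (elt Th k)) j) (fverts f i)) /\
     (* the neighbours of f are exactly the elements whose closure meets its
        relative interior *)
     (forall k, (k < length Th)%nat ->
        (in_simplex false d d (everts (elt Th k)) (barycenter d f) <-> adjacent f k)) /\
     dot3 (fnormal f) (fnormal f) = 1 /\
     (forall j, (d <= j)%nat -> fnormal f j = 0) /\
     (forall i, (1 <= i < d)%nat ->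
        dotd d (fnormal f) (fun j => fverts f i j - fverts f 0%nat j) = 0) /\
     (forall i, (i <= d)%nat ->
        dotd d (fnormal f) (fun j => everts (elt Th (fplus f)) i j - fverts f 0%nat j) <= 0)) /\
  (forall i i', (i < length Eh)%nat -> (i' < length Eh)%nat -> i <> i' ->
     ~ exists x, in_simplex true d (d - 1) (fverts (nth i Eh (mkFace (fun _ _ => 0) 0 None (fun _ => 0)))) x /\
                 in_simplex true d (d - 1) (fverts (nth i' Eh (mkFace (fun _ _ => 0) 0 None (fun _ => 0)))) x) /\
  (forall k x, (k < length Th)%nat ->
     in_simplex false d d (everts (elt Th k)) x ->
     ~ in_simplex true d d (everts (elt Th k)) x ->
     exists f, In f Eh /\ adjacent f k /\ in_simplex false d (d - 1) (fverts f) x).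

(* Shape regularity with constant sigma (h_K^d <= sigma d! |K|), together
   with the local quasi-uniformity of sizes and degrees across faces. *)
Definition mesh_regular (d : nat) (sigma : R) (Th : list element) (Eh : list face) : Prop :=
  (forall k, (k < length Th)%nat ->
     hK d (elt Th k) ^ d <= sigma * jac d d (everts (elt Th k))) /\
  (forall f m, In f Eh -> fminus f = Some m ->
     hK d (elt Th (fplus f)) <= sigma * hK d (elt Th m) /\
     hK d (elt Th m) <= sigma * hK d (elt Th (fplus f)) /\
     INR (edeg (elt Th (fplus f))) <= sigma * INR (edeg (elt Th m)) /\
     INR (edeg (elt Th m)) <= sigma * INR (edeg (elt Th (fplus f)))).

Definition dgfun := nat -> field.
Definition in_Vh (d : nat) (Th : list element) (v : dgfun) : Prop :=
  forall k, (k < length Th)%nat ->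
    (forall c, (c < d)%nat -> is_poly d (edeg (elt Th k)) (comp (v k) c)) /\
    (forall c x, (d <= c)%nat -> v k x c = 0).

Definition h_f (d : nat) (Th : list element) (f : face) : R :=
  match fminus f with
  | None => hK d (elt Th (fplus f))
  | Some m => Rmax (hK d (elt Th (fplus f))) (hK d (elt Th m))
  end.
Definition p_f (Th : list element) (f : face) : R :=
  match fminus f with
  | None => INR (edeg (elt Th (fplus f)))
  | Some m => INR (Nat.min (edeg (elt Th (fplus f))) (edeg (elt Th m)))
  end.
Definition jump (F : nat -> field) (f : face) : field := fun x =>
  match fminus f with
  | None => cross (F (fplus f) x) (fnormal f)
  | Some m => vadd (cross (F (fplus f) x) (fnormal f)) (cross (F m x) (vopp (fnormal f)))
  end.
Definition avg (F : nat -> field) (f : face) : field := fun x =>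
  match fminus f with
  | None => F (fplus f) x
  | Some m => vscal (1 / 2) (vadd (F (fplus f) x) (F m x))
  end.
Definition curlh (k : nat) (v : dgfun) : nat -> field := fun i => curlk k (v i).

Definition int_K (d : nat) (Th : list element) (k : nat) (g : pt -> R) : R :=
  int_simplex d d (everts (elt Th k)) g.
Definition int_f (d : nat) (f : face) (g : pt -> R) : R :=
  int_simplex d (d - 1) (fverts f) g.

Definition a_h (d : nat) (Th : list element) (Eh : list face) (eta1 eta2 : R)
    (w v : dgfun) : R :=
  sum_list (map (fun k => int_K d Th k (fun x =>
      dot3 (curlk 2 (w k) x) (curlk 2 (v k) x) + dot3 (w k x) (v k x)))
    (seq 0 (length Th)))
  + sum_list (map (fun f => int_f d f (fun x =>
      dot3 (avg (curlh 3 w) f x) (jump v f x)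
    + dot3 (avg (curlh 2 w) f x) (jump (curlh 1 v) f x)
    + dot3 (avg (curlh 3 v) f x) (jump w f x)
    + dot3 (avg (curlh 2 v) f x) (jump (curlh 1 w) f x)
    + eta1 * p_f Th f ^ 2 / h_f d Th f * dot3 (jump (curlh 1 v) f x) (jump (curlh 1 w) f x)
    + eta2 * p_f Th f ^ 6 / h_f d Th f ^ 3 * dot3 (jump v f x) (jump w f x)))
    Eh).

Definition dgnorm2 (d : nat) (Th : list element) (Eh : list face) (v : dgfun) : R :=
  sum_list (map (fun k => int_K d Th k (fun x =>
      dot3 (curlk 2 (v k) x) (curlk 2 (v k) x) + dot3 (v k x) (v k x)))
    (seq 0 (length Th)))
  + sum_list (map (fun f =>
      p_f Th f ^ 6 / h_f d Th f ^ 3 * int_f d f (fun x => dot3 (jump v f x) (jump v f x))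
    + h_f d Th f ^ 3 / p_f Th f ^ 6 *
        int_f d f (fun x => dot3 (avg (curlh 3 v) f x) (avg (curlh 3 v) f x))
    + h_f d Th f / p_f Th f ^ 2 *
        int_f d f (fun x => dot3 (avg (curlh 2 v) f x) (avg (curlh 2 v) f x))
    + p_f Th f ^ 2 / h_f d Th f *
        int_f d f (fun x => dot3 (jump (curlh 1 v) f x) (jump (curlh 1 v) f x)))
    Eh).

(* Main.v *)
(* The Nitsche terms are absorbed by Young's inequality once the averages of curl^2 v and curl^3 v
   on the faces are controlled by ||curl^2 v|| on the elements with the right powers of h and p.

   That control rests on two polynomial inequalities on an interval of length l, for degree < n:
   l r(0)^2 <= (n+1)^2 ||r||^2 and l^2 ||r'||^2 <= 4 (n+1)^4 ||r||^2.  Both follow by induction on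
   the degree along the Legendre basis, using only the orthogonality of L_n and integration by
   parts.  On a simplex they are applied on the segments parallel to an edge (i,j), whose relative
   length is lam_i + lam_j.  For the trace on the facet opposite to i this produces the weight
   lam_j, and these weights sum to one on the facet; for the gradient it produces the weight
   (lam_i + lam_j)^2, and at each point some lam_k is bounded below, so that the derivatives along
   the edges at k, which span, are controlled.  All edges reduce to one by the symmetry of the
   Dirichlet integrals in the barycentric coordinates.

   With hanging nodes the facet of an element is only filled by non-overlapping face pieces, in
   uncontrolled number, so one also needs that the integrals over the pieces add up to at most the
   integral over the facet; for triangles this is reduced to disjoint intervals by slicing. *)
From Stdlib Require Import Reals List Arith Lra Lia Psatz FunctionalExtensionality.
From Coquelicot Require Import Coquelicot.
Require Import Defs.
Import ListNotations.
Open Scope R_scope.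

(* Coquelicot states equations at [R] seen as a normed module, which [ring] does not recognise. *)
Ltac rring := match goal with |- @eq _ ?a ?b => change (@eq R a b) end; ring.

(** The weights leave no slack in the degree: [h_f ^ 3 / p_f ^ 6] is exactly a trace factor
    [h / p ^ 2] times an inverse factor [h ^ 2 / p ^ 4] for one further curl. Equivalence of norms
    on a finite-dimensional space, with its uncontrolled dependence on the degree, is therefore
    excluded, and every power of the degree comes from explicit one-variable constants. In these,
    the constant of the new Legendre polynomial and that of the remainder simply add up. Integrals
    over simplices are iterated, with one distinguished innermost direction. Exchanging vertices
    would call for a change of variables in several dimensions; instead a closed formula for the
    integrals of monomials in the barycentric coordinates is used, on which an exchange only
    permutes exponents. The face weights involve the sizes of the elements and not of the pieces, so
    the pieces of one facet carry comparable weights and can be added before the trace inequality is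
    used once for the whole facet. *)

Lemma sumR_ext n f g : (forall i, (i < n)%nat -> f i = g i) -> sumR n f = sumR n g.
Proof.
  induction n as [|n IH]; intros H; simpl; [reflexivity|].
  rewrite IH, (H n); auto.
Qed.

Lemma sumR_plus n f g : sumR n (fun i => f i + g i) = sumR n f + sumR n g.
Proof. induction n as [|n IH]; simpl; [|rewrite IH]; ring. Qed.

Lemma sumR_scal n a f : sumR n (fun i => a * f i) = a * sumR n f.
Proof. induction n as [|n IH]; simpl; [|rewrite IH]; ring. Qed.

Lemma sumR_zero n f : (forall i, (i < n)%nat -> f i = 0) -> sumR n f = 0.
Proof.
  induction n as [|n IH]; intros H; simpl; [reflexivity|].
  rewrite IH, (H n); auto; ring.
Qed.

(** * Univariate polynomials on an interval *)

(* Polynomials of degree [< n], so that [n = 0] is the zero space. *)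
Definition PL (n : nat) (f : R -> R) : Prop :=
  exists c : nat -> R, forall x, f x = sumR n (fun i => c i * x ^ i).

Lemma PL_ext n f g : (forall x, f x = g x) -> PL n f -> PL n g.
Proof. intros H [c Hc]; exists c; intros x; rewrite <- H; apply Hc. Qed.

Lemma PL_zero n : PL n (fun _ => 0).
Proof.
  exists (fun _ => 0); intros x; symmetry; apply sumR_zero; intros; ring.
Qed.

Lemma PL_plus n f g : PL n f -> PL n g -> PL n (fun x => f x + g x).
Proof.
  intros [c Hc] [e He]; exists (fun i => c i + e i); intros x.
  rewrite Hc, He, <- sumR_plus; apply sumR_ext; intros; ring.
Qed.

Lemma PL_scal n a f : PL n f -> PL n (fun x => a * f x).
Proof.
  intros [c Hc]; exists (fun i => a * c i); intros x.
  rewrite Hc, <- sumR_scal; apply sumR_ext; intros; ring.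
Qed.

Lemma PL_S n f : PL (S n) f <-> exists a q, PL n q /\ forall x, f x = a * x ^ n + q x.
Proof.
  split.
  - intros [c Hc]; exists (c n), (fun x => sumR n (fun i => c i * x ^ i)); split.
    + exists c; reflexivity.
    + intros x; rewrite Hc; simpl; ring.
  - intros (a & q & [c Hc] & H).
    exists (fun i => if (i =? n)%nat then a else c i); intros x.
    rewrite H, Hc; simpl; rewrite Nat.eqb_refl, Rplus_comm; f_equal.
    apply sumR_ext; intros i Hi.
    destruct (Nat.eqb_spec i n); [lia|reflexivity].
Qed.

Lemma PL_incr n f : PL n f -> PL (S n) f.
Proof.
  intros H; apply PL_S; exists 0, f; split; [exact H|]; intros; ring.
Qed.

Lemma PL_le n m f : (n <= m)%nat -> PL n f -> PL m f.
Proof. induction 1; auto using PL_incr. Qed.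

Lemma PL_monom n i : (i < n)%nat -> PL n (fun x => x ^ i).
Proof.
  intros H; apply PL_le with (S i); [lia|]; apply PL_S.
  exists 1, (fun _ => 0); split; [apply PL_zero|]; intros; ring.
Qed.

Lemma PL_mulX n f : PL n f -> PL (S n) (fun x => x * f x).
Proof.
  revert f; induction n as [|n IH]; intros f H.
  - destruct H as [c Hc]; apply (PL_ext _ (fun _ => 0)); [|apply PL_zero].
    intros x; rewrite Hc; simpl; ring.
  - apply PL_S in H; destruct H as (a & q & Hq & H).
    apply PL_S; exists a, (fun x => x * q x); split; [auto|].
    intros x; rewrite H; simpl; ring.
Qed.

Lemma PL_mulXn n m f : PL n f -> PL (m + n) (fun x => x ^ m * f x).
Proof.
  intros H; induction m as [|m IH]; simpl.
  - apply (PL_ext _ f); [intros; ring|exact H].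
  - apply (PL_ext _ (fun x => x * (x ^ m * f x))); [intros; ring|apply PL_mulX, IH].
Qed.

Lemma PL_mult k l f g : PL (S k) f -> PL (S l) g -> PL (S (k + l)) (fun x => f x * g x).
Proof.
  intros Hf Hg; revert f Hf; induction k as [|k IH]; intros f Hf;
    apply PL_S in Hf; destruct Hf as (a & q & Hq & Hf).
  - destruct Hq as [c Hc]; apply (PL_ext _ (fun x => a * g x)); [|apply PL_scal; exact Hg].
    intros x; rewrite Hf, Hc; simpl; ring.
  - apply (PL_ext _ (fun x => a * (x ^ S k * g x) + q x * g x)).
    { intros x; rewrite Hf; ring. }
    apply PL_plus.
    + apply PL_scal; replace (S (S k + l)) with (S k + S l)%nat by lia; apply PL_mulXn, Hg.
    + apply PL_le with (S (k + l)); [lia|auto].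
Qed.

(** The last conclusion says that the Euler operator [x d/dx] preserves the degree; it is what makes
    [x L' - n L] of lower degree for a monic [L]. *)
Lemma PL_derive n f : PL n f -> exists df, (forall x, is_derive f x (df x)) /\
  PL n df /\ PL n (fun x => x * df x).
Proof.
  revert f; induction n as [|n IH]; intros f H.
  - exists (fun _ => 0); split; [|split].
    + destruct H as [c Hc]; intros x; apply (is_derive_ext (fun _ => 0)).
      * intros t; rewrite Hc; reflexivity.
      * apply (is_derive_const (0 : R)).
    + apply PL_zero.
    + apply (PL_ext _ (fun _ => 0)); [intros; ring|apply PL_zero].
  - apply PL_S in H; destruct H as (a & q & Hq & H).
    destruct (IH q Hq) as (dq & D & P1 & P2).
    exists (fun x => a * (INR n * x ^ pred n) + dq x); split; [|split].
    + intros x; apply (is_derive_ext (fun t => a * t ^ n + q t)).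
      { intros t; rewrite H; reflexivity. }
      apply (is_derive_plus (fun t => a * t ^ n) q); [|apply D].
      auto_derive; [exact I|ring].
    + apply PL_plus; [|apply PL_incr, P1]; do 2 apply PL_scal.
      apply PL_monom; lia.
    + apply (PL_ext _ (fun x => a * (INR n * x ^ n) + x * dq x)).
      { intros x; destruct n as [|n]; simpl pred; [simpl|rewrite <- (tech_pow_Rmult x n)]; ring. }
      apply PL_plus; [|apply PL_incr, P2]; do 2 apply PL_scal.
      apply PL_monom; lia.
Qed.

Lemma PL_continuous n f x : PL n f -> continuous f x.
Proof.
  intros H; destruct (PL_derive n f H) as (df & D & _).
  apply (ex_derive_continuous (V := R_NormedModule)); exists (df x); apply D.
Qed.

Lemma ex_RInt_cont (f : R -> R) a b : (forall x, continuous f x) -> ex_RInt f a b.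
Proof. intros H; apply (ex_RInt_continuous (V := R_CompleteNormedModule)); auto. Qed.

Lemma RInt_lincomb (f g : R -> R) a b u v :
  (forall x, continuous f x) -> (forall x, continuous g x) ->
  RInt (fun x => u * f x + v * g x) a b = u * RInt f a b + v * RInt g a b.
Proof.
  intros Hf Hg.
  rewrite (RInt_plus (V := R_CompleteNormedModule) (fun x => u * f x) (fun x => v * g x)).
  - rewrite (RInt_scal (V := R_CompleteNormedModule) f),
      (RInt_scal (V := R_CompleteNormedModule) g); [reflexivity| |]; apply ex_RInt_cont; auto.
  - apply (ex_RInt_scal (V := R_NormedModule) f); apply ex_RInt_cont; auto.
  - apply (ex_RInt_scal (V := R_NormedModule) g); apply ex_RInt_cont; auto.
Qed.

Lemma continuous_Rmult (f g : R -> R) : (forall x, continuous f x) ->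
  (forall x, continuous g x) -> forall x, continuous (fun y => f y * g y) x.
Proof. intros Hf Hg x; apply (continuous_mult f g x); auto. Qed.

Lemma continuous_Rplus (f g : R -> R) : (forall x, continuous f x) ->
  (forall x, continuous g x) -> forall x, continuous (fun y => f y + g y) x.
Proof. intros Hf Hg x; apply (continuous_plus f g x); auto. Qed.

Lemma Rdiv_mult_cancel_r (a b : R) : b <> 0 -> a / b * b = a.
Proof. intros; field; assumption. Qed.

Section Interval.
Variable l : R.
Hypothesis l_ge0 : 0 <= l.

Let N f := RInt (fun x => f x * f x) 0 l.

Lemma sqnorm_ge0 f : (forall x, continuous f x) -> 0 <= N f.
Proof.
  intros H; apply RInt_ge_0; [exact l_ge0| |].
  - apply ex_RInt_cont, continuous_Rmult; auto.
  - intros; apply Rle_0_sqr.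
Qed.

(* With this, projecting onto [L] below needs no proof that [N L <> 0]. *)
Lemma null_orthogonal f g : (forall x, continuous f x) -> (forall x, continuous g x) ->
  N g = 0 -> RInt (fun x => f x * g x) 0 l = 0.
Proof.
  intros Hf Hg Hz; set (B := RInt (fun x => f x * g x) 0 l).
  assert (P : forall t, 0 <= N f + 2 * t * B).
  { intros t.
    assert (E : N (fun x => f x + t * g x) =
                1 * N f + 1 * (2 * t * B + t * t * N g)).
    { unfold N, B; rewrite <- (RInt_lincomb (fun x => f x * g x) (fun x => g x * g x)),
        <- RInt_lincomb; auto using continuous_Rmult.
      - apply RInt_ext; intros; rring.
      - intros x; apply (continuous_plus (fun x => 2 * t * (f x * g x)) (fun x => t * t * (g x * g x)));
        apply (continuous_scal_r (V := R_NormedModule)); apply continuous_Rmult; auto. }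
    rewrite Hz in E; enough (0 <= N (fun x => f x + t * g x)) by lra.
    apply sqnorm_ge0; intros x; apply (continuous_plus f (fun x => t * g x)); [auto|].
    apply (continuous_scal_r (V := R_NormedModule)); auto. }
  destruct (Req_dec B 0) as [|HB]; [assumption|exfalso].
  generalize (P (- (N f + 1) / (2 * B))).
  replace (N f + 2 * (- (N f + 1) / (2 * B)) * B) with (-1) by (field; auto); lra.
Qed.

(** Gram-Schmidt on the monomials: the residual [L] of [x ^ n] is the next basis vector, and [q0] is
    corrected by the component of the residual of [f] along [L]. *)
Lemma PL_projection n f : (forall x, continuous f x) -> exists q, PL n q /\
  forall g, PL n g -> RInt (fun x => (f x - q x) * g x) 0 l = 0.
Proof.
  revert f; induction n as [|n IH]; intros f Hf.
  - exists (fun _ => 0); split; [apply PL_zero|].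
    intros g [c Hc]; rewrite (RInt_ext _ (fun _ => 0)).
    + rewrite RInt_const; unfold scal; simpl; unfold mult; simpl; ring.
    + intros x _; rewrite Hc; simpl; rring.
  - destruct (IH f Hf) as (q0 & Pq0 & O0).
    destruct (IH (fun x => x ^ n)) as (p & Pp & Op).
    { intros x; apply (PL_continuous (S n)), PL_monom; lia. }
    set (L := fun x => x ^ n - p x) in *.
    assert (PL' : PL (S n) L).
    { apply (PL_ext _ (fun x => x ^ n + (-1) * p x)); [intros; unfold L; ring|].
      apply PL_plus; [apply PL_monom; lia|apply PL_scal, PL_incr, Pp]. }
    assert (CL : forall x, continuous L x) by (intros; apply (PL_continuous _ _ _ PL')).
    assert (Cq : forall x, continuous q0 x) by (intros; apply (PL_continuous _ _ _ Pq0)).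
    set (u := fun x => f x - q0 x).
    assert (Cu : forall x, continuous u x).
    { intros x; apply (continuous_minus f q0); auto. }
    assert (Hc : exists c, RInt (fun x => u x * L x) 0 l = c * N L).
    { destruct (Req_dec (N L) 0) as [Z|Z].
      - exists 0; rewrite (null_orthogonal u L); auto; rring.
      - exists (RInt (fun x => u x * L x) 0 l / N L); symmetry; exact (Rdiv_mult_cancel_r _ _ Z). }
    destruct Hc as [c Hc].
    exists (fun x => q0 x + c * L x); split.
    { apply PL_plus; [apply PL_incr, Pq0|apply PL_scal, PL']. }
    intros g Hg; apply PL_S in Hg; destruct Hg as (a & g0 & Pg0 & Hg).
    (* Writing [x ^ n] as [L + p] gives [g = a L + g1], with [g1] in the lower space where both
       orthogonality relations apply. *)
    set (g1 := fun x => g0 x + a * p x).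
    assert (Pg1 : PL n g1) by (apply PL_plus; [|apply PL_scal]; assumption).
    assert (Cg1 : forall x, continuous g1 x) by (intros; apply (PL_continuous _ _ _ Pg1)).
    rewrite (RInt_ext _ (fun x => 1 * (a * (u x * L x) + (- (a * c)) * (L x * L x))
        + 1 * (1 * (u x * g1 x) + (- c) * (L x * g1 x)))).
    2:{ intros x _; rewrite Hg; unfold u, L, g1; rring. }
    assert (CC : forall (v w : R -> R) r s, (forall x, continuous v x) ->
       (forall x, continuous w x) -> forall x, continuous (fun y => r * v y + s * w y) x).
    { intros v w r s Hv Hw x; apply (continuous_plus (fun y => r * v y) (fun y => s * w y));
      apply (continuous_scal_r (V := R_NormedModule)); auto. }
    rewrite !RInt_lincomb; auto using continuous_Rmult.
    assert (O1 : RInt (fun x => u x * g1 x) 0 l = 0) by exact (O0 g1 Pg1).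
    assert (O2 : RInt (fun x => L x * g1 x) 0 l = 0) by exact (Op g1 Pg1).
    rewrite O1, O2, Hc; unfold N; rring.
Qed.

(* The degree [n] Legendre polynomial of [[0,l]], up to normalisation. *)
Lemma legendre n : exists L dL, (forall x, is_derive L x (dL x)) /\ PL n dL /\
  PL n (fun x => L x - x ^ n) /\
  (forall g, PL n g -> RInt (fun x => L x * g x) 0 l = 0) /\
  l * L 0 ^ 2 = (2 * INR n + 1) * N L /\ l * L l ^ 2 = (2 * INR n + 1) * N L.
Proof.
  destruct (PL_projection n (fun x => x ^ n)) as (q & Pq & O).
  { intros x; apply (PL_continuous (S n)), PL_monom; lia. }
  destruct (PL_derive n q Pq) as (dq & D & P1 & P2).
  set (L := fun x => x ^ n - q x); set (dL := fun x => INR n * x ^ pred n - dq x).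
  assert (DL : forall x, is_derive L x (dL x)).
  { intros x; unfold L, dL; apply (is_derive_minus (fun x => x ^ n) q); [|apply D].
    auto_derive; [exact I|ring]. }
  assert (PdL : PL n dL).
  { apply (PL_ext _ (fun x => INR n * x ^ pred n + (-1) * dq x)); [intros; unfold dL; ring|].
    apply PL_plus; [|apply PL_scal, P1].
    destruct n as [|n]; [|apply PL_scal, PL_monom; simpl; lia].
    apply (PL_ext _ (fun _ => 0)); [simpl; intros; ring|apply PL_zero]. }
  assert (PLL : PL (S n) L).
  { apply PL_S; exists 1, (fun x => -1 * q x); split; [apply PL_scal, Pq|].
    intros x; unfold L; ring. }
  assert (CL : forall x, continuous L x) by (intros; apply (PL_continuous _ _ _ PLL)).
  assert (CdL : forall x, continuous dL x) by (intros; apply (PL_continuous _ _ _ PdL)).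
  (* [x L'] and [n L] differ by an element of lower degree. *)
  set (w := fun x => INR n * q x + (-1) * (x * dq x)).
  assert (Pw : PL n w) by (apply PL_plus; apply PL_scal; assumption).
  assert (Cw : forall x, continuous w x) by (intros; apply (PL_continuous _ _ _ Pw)).
  assert (E : forall x, x * dL x = INR n * L x + w x).
  { intros x; unfold dL, L, w; destruct n as [|m].
    - simpl; ring.
    - simpl pred; rewrite <- (tech_pow_Rmult x m); ring. }
  (* The integrand is the derivative of [(x - z) L ^ 2]. Orthogonality gives its integral
     independently of [z] ([K]), the fundamental theorem gives boundary values ([F]); [z = 0] and
     [z = l] isolate the two end points. *)
  assert (K : forall z, RInt (fun x => (x - z) * (2 * (L x * dL x)) + L x * L x) 0 l =
      (2 * INR n + 1) * N L).
  { intros z.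
    rewrite (RInt_ext _ (fun x => (2 * INR n + 1) * (L x * L x) +
        1 * (2 * (L x * w x) + (-2 * z) * (L x * dL x)))).
    2:{ intros x _.
        transitivity (2 * L x * (x * dL x) - 2 * z * (L x * dL x) + L x * L x); [rring|].
        rewrite E; rring. }
    rewrite !RInt_lincomb; auto using continuous_Rmult.
    - assert (O1 : RInt (fun x => L x * w x) 0 l = 0) by exact (O w Pw).
      assert (O2 : RInt (fun x => L x * dL x) 0 l = 0) by exact (O dL PdL).
      rewrite O1, O2; unfold N; rring.
    - intros x; apply (continuous_plus (fun x => 2 * (L x * w x)) (fun x => -2 * z * (L x * dL x)));
        apply (continuous_scal_r (V := R_NormedModule)); apply continuous_Rmult; auto. }
  assert (F : forall z, RInt (fun x => (x - z) * (2 * (L x * dL x)) + L x * L x) 0 l =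
      (l - z) * L l ^ 2 + z * L 0 ^ 2).
  { intros z.
    transitivity (minus ((fun x => (x - z) * L x ^ 2) l) ((fun x => (x - z) * L x ^ 2) 0)).
    2:{ unfold minus, plus, opp; simpl; ring. }
    apply is_RInt_unique, (is_RInt_derive (V := R_CompleteNormedModule) (fun x => (x - z) * L x ^ 2)).
    - intros x _; auto_derive; [exists (dL x); apply DL|].
      change (fun x0 : R => L x0) with L; rewrite (is_derive_unique _ _ _ (DL x)); ring.
    - intros x _. apply continuous_Rplus; [|apply continuous_Rmult; auto].
      apply continuous_Rmult; [|apply continuous_Rmult; [|apply continuous_Rmult; auto]].
      + intros y; apply (continuous_minus (fun x => x) (fun _ => z));
          [apply continuous_id|apply continuous_const].
      + intros y; apply continuous_const. }
  exists L, dL; split; [exact DL|]; split; [exact PdL|]; split; [|split; [exact O|]].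
  - apply (PL_ext _ (fun x => -1 * q x)); [intros; unfold L; ring|apply PL_scal, Pq].
  - generalize (F l) (F 0) (K l) (K 0); intros F1 F2 K1 K2; split; lra.
Qed.

(** The weights are those for which constants add: [u ^ 2 <= A X] and [v ^ 2 <= B Y] yield
    [(u + v) ^ 2 <= (A + B) (X + Y)]. *)
Lemma young_sq A B u v : 0 < A -> 0 < B ->
  (u + v) ^ 2 <= (A + B) / A * u ^ 2 + (A + B) / B * v ^ 2.
Proof.
  intros HA HB.
  assert (0 <= (B * u - A * v) ^ 2 / (A * B)).
  { apply Rdiv_le_0_compat; [apply pow2_ge_0|apply Rmult_lt_0_compat; assumption]. }
  replace ((A + B) / A * u ^ 2 + (A + B) / B * v ^ 2) with
    ((u + v) ^ 2 + (B * u - A * v) ^ 2 / (A * B)) by (field; lra); lra.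
Qed.

Lemma sqnorm_pythagoras L q a : (forall x, continuous L x) -> (forall x, continuous q x) ->
  RInt (fun x => L x * q x) 0 l = 0 ->
  N (fun x => a * L x + q x) = a ^ 2 * N L + N q.
Proof.
  intros CL Cq O; unfold N.
  rewrite (RInt_ext _ (fun x => a ^ 2 * (L x * L x) + 1 * (1 * (q x * q x) + 2 * a * (L x * q x)))).
  2:{ intros; rring. }
  rewrite !RInt_lincomb; auto using continuous_Rmult.
  - rewrite O; rring.
  - intros x; apply (continuous_plus (fun x => 1 * (q x * q x)) (fun x => 2 * a * (L x * q x)));
      apply (continuous_scal_r (V := R_NormedModule)); apply continuous_Rmult; auto.
Qed.

Lemma PL_split n L r : PL n (fun x => L x - x ^ n) -> PL (S n) r ->
  exists a q, PL n q /\ forall x, r x = a * L x + q x.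
Proof.
  intros HL Hr; apply PL_S in Hr; destruct Hr as (a & q & Pq & E).
  exists a, (fun x => q x + (- a) * (L x - x ^ n)); split.
  - apply PL_plus; [|apply PL_scal]; assumption.
  - intros x; rewrite E; ring.
Qed.

Lemma sqnorm_ext f g : (forall x, f x = g x) -> N f = N g.
Proof. intros H; unfold N; apply RInt_ext; intros; rewrite !H; reflexivity. Qed.

(** In the induction the Legendre part contributes [2 n + 1] and the remainder [(n + 1) ^ 2]; their
    sum [n ^ 2 + 4 n + 2] stays below [(n + 2) ^ 2]. *)
Lemma PL_endpoints n r : PL n r ->
  l * r 0 ^ 2 <= (INR n + 1) ^ 2 * N r /\ l * r l ^ 2 <= (INR n + 1) ^ 2 * N r.
Proof.
  revert r; induction n as [|n IH]; intros r Hr.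
  - assert (H0 := sqnorm_ge0 r (fun x => PL_continuous _ _ x Hr)).
    destruct Hr as [c Hc]; rewrite !Hc; simpl; split; nra.
  - destruct (legendre n) as (L & dL & DL & PdL & PLn & O & E0 & El).
    destruct (PL_split n L r PLn Hr) as (a & q & Pq & E).
    assert (CL : forall x, continuous L x).
    { intros x; apply (ex_derive_continuous (V := R_NormedModule)); exists (dL x); apply DL. }
    assert (Cq : forall x, continuous q x) by (intros; apply (PL_continuous _ _ _ Pq)).
    assert (HN : N r = a ^ 2 * N L + N q).
    { rewrite <- sqnorm_pythagoras; auto; apply sqnorm_ext, E. }
    destruct (IH q Pq) as [Q0 Ql].
    assert (HL := sqnorm_ge0 L CL); assert (Hq := sqnorm_ge0 q Cq).
    assert (Hn : 0 <= INR n) by apply pos_INR.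
    assert (G : forall z, l * L z ^ 2 = (2 * INR n + 1) * N L ->
        l * q z ^ 2 <= (INR n + 1) ^ 2 * N q -> l * r z ^ 2 <= (INR (S n) + 1) ^ 2 * N r).
    { intros z Hz Qz; rewrite E, S_INR, HN.
      set (A := 2 * INR n + 1) in *; set (B := (INR n + 1) ^ 2) in *.
      assert (0 < A) by (unfold A; lra); assert (0 < B) by (unfold B; nra).
      apply Rle_trans with (l * ((A + B) / A * (a * L z) ^ 2 + (A + B) / B * q z ^ 2)).
      { apply Rmult_le_compat_l; [exact l_ge0|apply young_sq; assumption]. }
      apply Rle_trans with ((A + B) / A * (a ^ 2 * (l * L z ^ 2)) + (A + B) / B * (l * q z ^ 2));
        [right; ring|].
      rewrite Hz.
      apply Rle_trans with ((A + B) * (a ^ 2 * N L) + (A + B) / B * (B * N q)).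
      { apply Rplus_le_compat; [right; field; lra|].
        apply Rmult_le_compat_l; [|exact Qz].
        apply Rdiv_le_0_compat; lra. }
      replace ((A + B) / B * (B * N q)) with ((A + B) * N q) by (field; lra).
      rewrite <- Rmult_plus_distr_l; apply Rmult_le_compat_r.
      - assert (0 <= a ^ 2 * N L) by (apply Rmult_le_pos; [apply pow2_ge_0|lra]); lra.
      - unfold A, B; nra. }
    split; apply G; assumption.
Qed.

(** Same splitting as for the end points, now with [A = 4 (2 n + 1) (n + 1) ^ 2] for the derivative
    of the Legendre polynomial and [B = 4 (n + 1) ^ 4] for the remainder, where
    [A + B <= 4 (n + 2) ^ 4]. *)
Lemma PL_markov n r dr : PL n r -> (forall x, is_derive r x (dr x)) ->
  l ^ 2 * N dr <= 4 * (INR n + 1) ^ 4 * N r.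
Proof.
  revert r dr; induction n as [|n IH]; intros r dr Hr Dr.
  - assert (H0 := sqnorm_ge0 r (fun x => PL_continuous _ _ x Hr)).
    destruct Hr as [c Hc].
    assert (Z : forall x, dr x = 0).
    { intros x; rewrite <- (is_derive_unique _ _ _ (Dr x)).
      rewrite (Derive_ext _ (fun _ => 0)); [apply Derive_const|].
      intros t; rewrite Hc; reflexivity. }
    rewrite (sqnorm_ext dr (fun _ => 0) Z); unfold N at 1.
    rewrite (RInt_ext _ (fun _ => 0)); [|intros; rring].
    rewrite RInt_const; unfold scal; simpl; unfold mult; simpl; nra.
  - destruct (legendre n) as (L & dL & DL & PdL & PLn & O & E0 & El).
    destruct (PL_split n L r PLn Hr) as (a & q & Pq & E).
    destruct (PL_derive n q Pq) as (dq & Dq & Pdq & _).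
    assert (CL : forall x, continuous L x).
    { intros x; apply (ex_derive_continuous (V := R_NormedModule)); exists (dL x); apply DL. }
    assert (Cq : forall x, continuous q x) by (intros; apply (PL_continuous _ _ _ Pq)).
    assert (CdL : forall x, continuous dL x) by (intros; apply (PL_continuous _ _ _ PdL)).
    assert (Cdq : forall x, continuous dq x) by (intros; apply (PL_continuous _ _ _ Pdq)).
    assert (HN : N r = a ^ 2 * N L + N q).
    { rewrite <- sqnorm_pythagoras; auto; apply sqnorm_ext, E. }
    assert (Ed : forall x, dr x = a * dL x + dq x).
    { intros x; rewrite <- (is_derive_unique _ _ _ (Dr x)); apply is_derive_unique.
      apply (is_derive_ext (fun x => a * L x + q x)); [intros; symmetry; apply E|].
      apply (is_derive_plus (fun x => a * L x) q); [|apply Dq].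
      apply (is_derive_scal L); apply DL. }
    assert (HL := sqnorm_ge0 L CL); assert (Hq := sqnorm_ge0 q Cq).
    assert (HdL := sqnorm_ge0 dL CdL).
    assert (Hn : 0 <= INR n) by apply pos_INR.
    set (B := 4 * (INR n + 1) ^ 4); set (A := 4 * (2 * INR n + 1) * (INR n + 1) ^ 2).
    assert (HA : 0 < A) by (unfold A; nra).
    assert (HB : 0 < B).
    { unfold B; apply Rmult_lt_0_compat; [lra|apply pow_lt; lra]. }
    assert (Q : l ^ 2 * N dq <= B * N q) by (apply IH; assumption).
    assert (QL : l ^ 2 * N dL <= A * N L).
    { (* [L'] is orthogonal to [L''], up to the boundary terms of [L L']. *)
      assert (IBP : N dL = L l * dL l - L 0 * dL 0).
      { destruct (PL_derive n dL PdL) as (ddL & DdL & PddL & _).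
        assert (CddL : forall x, continuous ddL x) by (intros; apply (PL_continuous _ _ _ PddL)).
        assert (H : RInt (fun x => 1 * (dL x * dL x) + 1 * (L x * ddL x)) 0 l =
            L l * dL l - L 0 * dL 0).
        { apply is_RInt_unique.
          apply (is_RInt_derive (V := R_CompleteNormedModule) (fun x => L x * dL x)).
          - intros x _.
            assert (e1 := DL x); assert (e2 := DdL x); auto_derive.
            + split; [exists (dL x); apply e1|split; [exists (ddL x); apply e2|exact I]].
            + change (fun x0 : R => L x0) with L; change (fun x0 : R => dL x0) with dL.
              rewrite (is_derive_unique _ _ _ e1), (is_derive_unique _ _ _ e2); ring.
          - intros x _; apply continuous_Rplus; apply continuous_Rmult;
              auto using continuous_Rmult; intros; apply continuous_const. }
        rewrite RInt_lincomb in H; auto using continuous_Rmult.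
        rewrite (O ddL PddL) in H; unfold N; lra. }
      destruct (PL_endpoints n dL PdL) as [D0 Dl].
      set (P := (INR n + 1) ^ 2) in *.
      (* Cauchy-Schwarz on the two boundary terms. The end values of [L] are known exactly; those of
         [dL] are bounded by [PL_endpoints], which produces one factor [N dL] that is cancelled
         afterwards. *)
      assert (S1 : (l * N dL) ^ 2 <= (l * L l ^ 2 + l * L 0 ^ 2) * (l * dL l ^ 2 + l * dL 0 ^ 2)).
      { rewrite IBP.
        assert (0 <= l ^ 2 * (L l * dL 0 + L 0 * dL l) ^ 2).
        { apply Rmult_le_pos; apply pow2_ge_0. }
        nra. }
      rewrite E0, El in S1.
      assert (S2 : (l * N dL) ^ 2 <= (2 * (2 * INR n + 1) * N L) * (2 * P * N dL)).
      { eapply Rle_trans; [exact S1|].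
        replace ((2 * INR n + 1) * N L + (2 * INR n + 1) * N L) with (2 * (2 * INR n + 1) * N L) by ring.
        apply Rmult_le_compat_l; [nra|lra]. }
      destruct (Rle_lt_or_eq_dec _ _ HdL) as [pos|z].
      - apply (Rmult_le_reg_r (N dL)); [exact pos|].
        unfold A; fold P; nra.
      - rewrite <- z; nra. }
    apply Rle_trans with ((A + B) * N r).
    2:{ apply Rmult_le_compat_r; [rewrite HN|].
        - assert (0 <= a ^ 2 * N L) by (apply Rmult_le_pos; [apply pow2_ge_0|lra]); lra.
        - unfold A, B; rewrite S_INR.
          replace (4 * (2 * INR n + 1) * (INR n + 1) ^ 2 + 4 * (INR n + 1) ^ 4) with
            (4 * ((INR n + 1) ^ 2 * (INR n ^ 2 + 4 * INR n + 2))) by ring.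
          apply Rmult_le_compat_l; [lra|].
          replace ((INR n + 1 + 1) ^ 4) with ((INR n + 1 + 1) ^ 2 * (INR n + 1 + 1) ^ 2) by ring.
          apply Rmult_le_compat; nra. }
    apply Rle_trans with (l ^ 2 * ((A + B) / A * a ^ 2 * N dL + (A + B) / B * N dq)).
    { apply Rmult_le_compat_l; [apply pow2_ge_0|].
      unfold N; rewrite <- RInt_lincomb; auto using continuous_Rmult.
      apply RInt_le; [exact l_ge0| | |].
      - apply ex_RInt_cont.
        assert (Cdr : forall x, continuous dr x).
        { intros x; apply (continuous_ext (fun x => a * dL x + dq x)); [intros; symmetry; apply Ed|].
          apply continuous_Rplus; auto; apply continuous_Rmult; auto; intros; apply continuous_const. }
        apply continuous_Rmult; auto.
      - apply ex_RInt_cont, continuous_Rplus; apply continuous_Rmult; auto using continuous_Rmult;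
          intros; apply continuous_const.
      - intros x _; rewrite Ed.
        generalize (young_sq A B (a * dL x) (dq x) HA HB); lra. }
    replace (l ^ 2 * ((A + B) / A * a ^ 2 * N dL + (A + B) / B * N dq)) with
      ((A + B) / A * a ^ 2 * (l ^ 2 * N dL) + (A + B) / B * (l ^ 2 * N dq)) by ring.
    rewrite HN.
    apply Rle_trans with ((A + B) / A * a ^ 2 * (A * N L) + (A + B) / B * (B * N q)).
    + apply Rplus_le_compat; apply Rmult_le_compat_l; try assumption.
      * apply Rmult_le_pos; [apply Rdiv_le_0_compat; lra|apply pow2_ge_0].
      * apply Rdiv_le_0_compat; lra.
    + right; field; lra.
Qed.
End Interval.

(** * Reindexing of finite sums and products, adjacent transpositions *)

Lemma sumR_S_l n f : sumR (S n) f = f 0%nat + sumR n (fun i => f (S i)).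
Proof. induction n as [|n IH]; [simpl; ring|]. simpl in *; rewrite IH; ring. Qed.

Lemma sumN_S_l n f : sumN (S n) f = (f 0%nat + sumN n (fun i => f (S i)))%nat.
Proof. induction n as [|n IH]; [simpl; lia|]. simpl in *; rewrite IH; lia. Qed.

Lemma prodR_S_l n f : prodR (S n) f = f 0%nat * prodR n (fun i => f (S i)).
Proof. induction n as [|n IH]; [simpl; ring|]. simpl in *; rewrite IH; ring. Qed.

Lemma prodR_ext n f g : (forall i, (i < n)%nat -> f i = g i) -> prodR n f = prodR n g.
Proof.
  induction n as [|n IH]; intros H; simpl; [reflexivity|].
  rewrite IH, (H n); auto.
Qed.

Lemma sumN_ext n f g : (forall i, (i < n)%nat -> f i = g i) -> sumN n f = sumN n g.
Proof.
  induction n as [|n IH]; intros H; simpl; [reflexivity|].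
  rewrite IH, (H n); auto.
Qed.

Lemma prodR_mult n f g : prodR n (fun i => f i * g i) = prodR n f * prodR n g.
Proof. induction n as [|n IH]; simpl; [|rewrite IH]; ring. Qed.

(** Adjacent transpositions are enough: the inductions below bring a vertex to its place one step at
    a time. *)
Definition swap (n i : nat) : nat :=
  if (i =? n)%nat then S n else if (i =? S n)%nat then n else i.

Lemma swap_l n : swap n n = S n.
Proof. unfold swap; rewrite Nat.eqb_refl; reflexivity. Qed.

Lemma swap_r n : swap n (S n) = n.
Proof.
  unfold swap; rewrite Nat.eqb_refl; destruct (Nat.eqb_spec (S n) n); [lia|reflexivity].
Qed.

Lemma swap_neq n i : i <> n -> i <> S n -> swap n i = i.
Proof.
  intros; unfold swap; destruct (Nat.eqb_spec i n), (Nat.eqb_spec i (S n)); congruence.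
Qed.

Lemma swap_involutive n i : swap n (swap n i) = i.
Proof.
  destruct (Nat.eq_dec i n) as [->|H1]; [rewrite swap_l; apply swap_r|].
  destruct (Nat.eq_dec i (S n)) as [->|H2]; [rewrite swap_r; apply swap_l|].
  rewrite (swap_neq n i) by assumption; apply swap_neq; assumption.
Qed.

Ltac swap_big IH n m f ext :=
  destruct (Nat.eq_dec (S n) m) as [<-|Hne];
  [ simpl; rewrite swap_l, swap_r;
    rewrite (ext n (fun i => f (swap n i)) f) by (intros; rewrite swap_neq by lia; reflexivity)
  | simpl; rewrite IH by lia; rewrite swap_neq by lia; reflexivity ].

Lemma sumR_swap n m f : (S n < m)%nat -> sumR m (fun i => f (swap n i)) = sumR m f.
Proof.
  induction m as [|m IH]; intros H; [lia|].
  swap_big IH n m f sumR_ext; ring.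
Qed.

Lemma sumN_swap n m f : (S n < m)%nat -> sumN m (fun i => f (swap n i)) = sumN m f.
Proof.
  induction m as [|m IH]; intros H; [lia|].
  swap_big IH n m f sumN_ext; lia.
Qed.

Lemma prodR_swap n m f : (S n < m)%nat -> prodR m (fun i => f (swap n i)) = prodR m f.
Proof.
  induction m as [|m IH]; intros H; [lia|].
  swap_big IH n m f prodR_ext; ring.
Qed.

(** * Iterated integrals over the reference simplex *)

(* [refint m s g] is defined and equal to [I]; unlike [refint], this is stable under
   linear combinations without side conditions. *)
Fixpoint is_refint (m : nat) (s : R) (g : pt -> R) (I : R) : Prop :=
  match m with
  | O => I = g (fun _ => 0)
  | S m' => exists phi : R -> R,
      (forall t, is_refint m' (s - t) (fun y => g (cons_pt t y)) (phi t)) /\ is_RInt phi 0 s I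
  end.

Lemma is_refint_unique m s g I : is_refint m s g I -> refint m s g = I.
Proof.
  revert s g I; induction m as [|m IH]; intros s g I H; simpl in *; [auto|].
  destruct H as (phi & H1 & H2).
  rewrite (RInt_ext _ phi).
  - apply is_RInt_unique, H2.
  - intros t _; apply IH, H1.
Qed.

Lemma is_refint_ext m s g h I : (forall x, g x = h x) -> is_refint m s g I -> is_refint m s h I.
Proof. intros H; replace h with g by (apply functional_extensionality, H); auto. Qed.

Lemma is_refint_lincomb m s a b g h I J : is_refint m s g I -> is_refint m s h J ->
  is_refint m s (fun x => a * g x + b * h x) (a * I + b * J).
Proof.
  revert s g h I J; induction m as [|m IH]; intros s g h I J H1 H2; simpl in *.
  - congruence.
  - destruct H1 as (phi & P1 & P2), H2 as (psi & Q1 & Q2).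
    exists (fun t => a * phi t + b * psi t); split; [intros; apply IH; auto|].
    apply (is_RInt_plus (V := R_NormedModule) (fun t => a * phi t) (fun t => b * psi t));
      apply (is_RInt_scal (V := R_NormedModule)); assumption.
Qed.

Definition in_ref (m : nat) (s : R) (y : pt) : Prop :=
  (forall i, (i < m)%nat -> 0 <= y i) /\ sumR m y <= s.

Lemma is_refint_le m s g h I J : 0 <= s -> is_refint m s g I -> is_refint m s h J ->
  (forall y, in_ref m s y -> g y <= h y) -> I <= J.
Proof.
  revert s g h I J; induction m as [|m IH]; intros s g h I J Hs H1 H2 H; simpl in *.
  - subst; apply H; split; [intros; lia|exact Hs].
  - destruct H1 as (phi & P1 & P2), H2 as (psi & Q1 & Q2).
    apply (is_RInt_le phi psi 0 s); auto.
    intros t Ht; apply (IH (s - t) _ _ _ _ ltac:(lra) (P1 t) (Q1 t)).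
    intros y [Y1 Y2]; apply H; split.
    + intros [|i] Hi; simpl; [lra|apply Y1; lia].
    + change (sumR (S m) (cons_pt t y) <= s); rewrite sumR_S_l.
      change (t + sumR m y <= s); lra.
Qed.

Lemma is_refint_ge0 m s g I : 0 <= s -> is_refint m s g I ->
  (forall y, in_ref m s y -> 0 <= g y) -> 0 <= I.
Proof.
  intros Hs HI H.
  enough (0 * I + 0 * I <= I) by lra.
  apply (is_refint_le m s _ _ _ _ Hs (is_refint_lincomb m s 0 0 g g I I HI HI) HI).
  intros y Hy; specialize (H y Hy); lra.
Qed.

(* [refint] integrates the last coordinate innermost. *)
Lemma upd_cons_pt t y m u : upd (cons_pt t y) (S m) u = cons_pt t (upd y m u).
Proof. apply functional_extensionality; intros [|j]; reflexivity. Qed.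

(** No exchange of integrations is involved: the last coordinate is already innermost, and the
    iterated integral is only regrouped. The upper limit [s - sumR m y] is the length of the segment
    over [y], to which the one-variable inequalities will be applied. *)
Lemma is_refint_slice m s g I : is_refint (S m) s g I ->
  is_refint m s (fun y => RInt (fun u => g (upd y m u)) 0 (s - sumR m y)) I.
Proof.
  revert s g I; induction m as [|m IH]; intros s g I (phi & P1 & P2).
  - simpl in *; rewrite Rminus_0_r; symmetry; apply is_RInt_unique.
    apply (is_RInt_ext phi); [|exact P2].
    intros u _; rewrite P1; f_equal; apply functional_extensionality; intros [|j]; reflexivity.
  - exists phi; split; [|exact P2].
    intros t; specialize (IH _ _ _ (P1 t)).
    revert IH; apply is_refint_ext; intros y.
    rewrite sumR_S_l; simpl (cons_pt t y 0%nat).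
    change (fun i => cons_pt t y (S i)) with y.
    replace (s - (t + sumR m y)) with (s - t - sumR m y) by ring.
    apply RInt_ext; intros u _; rewrite upd_cons_pt; reflexivity.
Qed.

(** Euler's beta integral, by induction on [b]: the derivative of [t ^ (a + 1) * (s - t) ^ (b + 1)]
    integrates to zero, which trades one power of [s - t] for one of [t]. The sign of [s] is free
    because [is_refint] quantifies over all slices [s - t]. *)
Lemma is_RInt_beta s a b : is_RInt (fun t => t ^ a * (s - t) ^ b) 0 s
  (INR (fact a) * INR (fact b) / INR (fact (a + b + 1)) * s ^ (a + b + 1)).
Proof.
  revert a; induction b as [|b IH]; intros a.
  - evar_last.
    + apply (is_RInt_derive (V := R_CompleteNormedModule) (fun t => / INR (S a) * t ^ S a)).
      * intros x _; auto_derive; [exact I|].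
        simpl pred; change (match a with O => 1 | S _ => INR a + 1 end) with (INR (S a)).
        field; apply not_0_INR; discriminate.
      * intros x _; apply (ex_derive_continuous (V := R_NormedModule)); auto_derive; exact I.
    + unfold minus, plus, opp; simpl minus.
      replace (a + 0 + 1)%nat with (S a) by lia.
      change (fact (S a)) with (S a * fact a)%nat; rewrite mult_INR.
      rewrite pow_i by lia; simpl (fact 0); simpl (INR 1).
      assert (INR (fact a) <> 0) by apply INR_fact_neq_0.
      assert (INR (S a) <> 0) by (apply not_0_INR; discriminate).
      change (/ INR (S a) * s ^ S a + - (/ INR (S a) * 0) =
        INR (fact a) * 1 / (INR (S a) * INR (fact a)) * s ^ S a).
      field; auto.
  - assert (Ha : INR (S a) <> 0) by (apply not_0_INR; discriminate).
    assert (D : is_RInt (fun t => INR (S a) * (t ^ a * (s - t) ^ S b)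
         + - INR (S b) * (t ^ S a * (s - t) ^ b)) 0 s 0).
    { evar_last.
      - apply (is_RInt_derive (V := R_CompleteNormedModule) (fun t => t ^ S a * (s - t) ^ S b)).
        + intros x _; auto_derive; [exact I|].
          simpl pred; change (match a with O => 1 | S _ => INR a + 1 end) with (INR (S a)).
          change (match b with O => 1 | S _ => INR b + 1 end) with (INR (S b)).
          simpl pow; unfold Rminus; ring.
        + intros x _; apply (ex_derive_continuous (V := R_NormedModule)); auto_derive; exact I.
      - change (s ^ S a * (s - s) ^ S b + - (0 ^ S a * (s - 0) ^ S b) = 0).
        replace (s - s) with 0 by ring; rewrite !pow_i by lia; ring. }
    specialize (IH (S a)).
    assert (E := is_RInt_plus _ _ _ _ _ _ (is_RInt_scal _ _ _ (/ INR (S a)) _ D)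
      (is_RInt_scal _ _ _ (INR (S b) / INR (S a)) _ IH)).
    evar_last.
    + eapply is_RInt_ext; [|exact E].
      intros x _; unfold scal, plus; simpl; unfold mult; simpl.
      change (match a with O => 1 | S _ => INR a + 1 end) with (INR (S a)).
      change (match b with O => 1 | S _ => INR b + 1 end) with (INR (S b)).
      field; exact Ha.
    + replace (S a + b + 1)%nat with (a + S b + 1)%nat by lia.
      change (fact (S a)) with (S a * fact a)%nat.
      change (fact (S b)) with (S b * fact b)%nat; rewrite !mult_INR.
      unfold scal, plus; simpl scal; unfold mult; simpl mult.
      set (F := INR (fact (a + S b + 1))).
      assert (F <> 0) by apply INR_fact_neq_0.
      change (/ INR (S a) * 0 + INR (S b) / INR (S a) *
         (INR (S a) * INR (fact a) * INR (fact b) / F * s ^ (a + S b + 1)) =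
         INR (fact a) * (INR (S b) * INR (fact b)) / F * s ^ (a + S b + 1)).
      field; auto.
Qed.

Definition monom (m : nat) (al : nat -> nat) (x : pt) : R := prodR m (fun i => x i ^ al i).

(** The factor with exponent [b] stands for the barycentric coordinate of vertex [0]. It also lets
    the induction close: the inner integral is a multiple of a power of [s - t], so the outer one is
    a beta integral. *)
Lemma is_refint_dirichlet m s al b :
  is_refint m s (fun t => monom m al t * (s - sumR m t) ^ b)
    (prodR m (fun i => INR (fact (al i))) * INR (fact b) /
     INR (fact (sumN m al + b + m)) * s ^ (sumN m al + b + m)).
Proof.
  revert s al; induction m as [|m IH]; intros s al.
  - unfold monom; simpl; rewrite Rminus_0_r, Nat.add_0_r; field; apply INR_fact_neq_0.
  - set (be := fun i => al (S i)); set (M := (sumN m be + b + m)%nat).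
    set (K := prodR m (fun i => INR (fact (be i))) * INR (fact b) / INR (fact M)).
    exists (fun t => K * (t ^ al 0%nat * (s - t) ^ M)); split.
    + intros t; specialize (IH (s - t) be).
      assert (H := is_refint_lincomb _ _ (t ^ al 0%nat) 0 _ _ _ _ IH IH).
      fold M in H; fold K in H.
      replace (K * (t ^ al 0%nat * (s - t) ^ M)) with
        (t ^ al 0%nat * (K * (s - t) ^ M) + 0 * (K * (s - t) ^ M)) by ring.
      revert H; apply is_refint_ext; intros y.
      unfold monom; rewrite prodR_S_l, sumR_S_l; simpl (cons_pt t y 0%nat).
      change (prodR m (fun i => cons_pt t y (S i) ^ al (S i))) with (prodR m (fun i => y i ^ be i)).
      change (sumR m (fun i => cons_pt t y (S i))) with (sumR m y).
      replace (s - (t + sumR m y)) with (s - t - sumR m y) by ring; ring.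
    + assert (H := is_RInt_scal _ _ _ K _ (is_RInt_beta s (al 0%nat) M)).
      evar_last; [exact H|].
      rewrite prodR_S_l, sumN_S_l.
      replace (al 0%nat + sumN m (fun i => al (S i)) + b + S m)%nat with (al 0%nat + M + 1)%nat
        by (unfold M, be; lia).
      unfold K; fold be; unfold scal; simpl; unfold mult; simpl.
      change (prodR m (fun i => INR (fact (al (S i))))) with (prodR m (fun i => INR (fact (be i)))).
      field; split; apply INR_fact_neq_0.
Qed.

(** * Multivariate polynomials *)

(** Generated by closure rules, so that products, substitutions and derivatives are handled by rule
    induction instead of on coefficient lists. The index [k] is only an upper bound of the
    degree. *)
Inductive pol (m : nat) : nat -> (pt -> R) -> Prop :=
| pol_const c : pol m 0 (fun _ => c)
| pol_var i : (i < m)%nat -> pol m 1 (fun x => x i)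
| pol_add k f g : pol m k f -> pol m k g -> pol m k (fun x => f x + g x)
| pol_mul k l f g : pol m k f -> pol m l g -> pol m (k + l) (fun x => f x * g x)
| pol_le k l f : (k <= l)%nat -> pol m k f -> pol m l f.

Lemma pol_ext m k f g : (forall x, f x = g x) -> pol m k f -> pol m k g.
Proof. intros H; replace g with f by (apply functional_extensionality, H); auto. Qed.

Lemma pol_scal m k a f : pol m k f -> pol m k (fun x => a * f x).
Proof. intros H; apply (pol_mul m 0 k (fun _ => a) f); [apply pol_const|exact H]. Qed.

Lemma pol_cst m k c : pol m k (fun _ => c).
Proof. apply pol_le with 0%nat; [lia|apply pol_const]. Qed.

Lemma pol_minus m k f g : pol m k f -> pol m k g -> pol m k (fun x => f x - g x).
Proof.
  intros Hf Hg; apply (pol_ext _ _ (fun x => f x + -1 * g x)); [intros; ring|].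
  apply pol_add, pol_scal; assumption.
Qed.

Lemma pol_sumR m k n f : (forall i, (i < n)%nat -> pol m k (f i)) ->
  pol m k (fun x => sumR n (fun i => f i x)).
Proof. induction n as [|n IH]; intros H; simpl; [apply pol_cst|apply pol_add; auto]. Qed.

Lemma pol_sqr m k f : pol m k f -> pol m (k + k) (fun x => f x ^ 2).
Proof.
  intros H; apply (pol_ext _ _ (fun x => f x * f x)); [intros; ring|apply pol_mul; exact H].
Qed.

Lemma pol_pow m f n : pol m 1 f -> pol m n (fun x => f x ^ n).
Proof.
  intros H; induction n as [|n IH]; simpl; [apply pol_const|].
  apply (pol_mul m 1 n f); assumption.
Qed.

Lemma pol_monom m al : pol m (sumN m al) (monom m al).
Proof.
  unfold monom.
  enough (H : forall n, (n <= m)%nat -> pol m (sumN n al) (fun x => prodR n (fun i => x i ^ al i)))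
    by (apply H; lia).
  induction n as [|n IH]; intros Hn; simpl; [apply pol_const|].
  apply (pol_mul m _ _ (fun x => prodR n (fun i => x i ^ al i))); [apply IH; lia|].
  apply pol_pow, pol_var; lia.
Qed.

Lemma is_poly_pol d k f : is_poly d k f -> pol d k f.
Proof.
  intros (l & Hl & E).
  apply (pol_ext _ _ (fun x => sum_list (map (fun ca => fst ca * monom d (snd ca) x) l))).
  { intros x; symmetry; apply E. }
  clear E; induction Hl as [|ca l Hca Hl IH]; simpl; [apply pol_cst|].
  apply pol_add; [|exact IH].
  apply pol_scal, pol_le with (sumN d (snd ca)); [exact Hca|apply pol_monom].
Qed.

Lemma pol_dep m k f x y : pol m k f -> (forall i, (i < m)%nat -> x i = y i) -> f x = f y.
Proof.
  intros H E; induction H; simpl; auto; [rewrite IHpol1, IHpol2|rewrite IHpol1, IHpol2]; reflexivity.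
Qed.

Lemma pol_comp m n k f (phi : pt -> pt) : pol m k f ->
  (forall i, (i < m)%nat -> pol n 1 (fun y => phi y i)) -> pol n k (fun y => f (phi y)).
Proof.
  intros H E; induction H.
  - apply pol_const.
  - apply E; assumption.
  - apply (pol_add n k (fun y => f (phi y)) (fun y => g (phi y))); assumption.
  - apply (pol_mul n k l (fun y => f (phi y)) (fun y => g (phi y))); assumption.
  - apply pol_le with k; assumption.
Qed.

(** Restriction to a line. The index becomes [S k] since [PL] bounds the degree strictly. *)
Lemma pol_PL m k f (phi : R -> pt) : pol m k f ->
  (forall i, (i < m)%nat -> PL 2 (fun t => phi t i)) -> PL (S k) (fun t => f (phi t)).
Proof.
  intros H E; induction H.
  - apply PL_S; exists c, (fun _ => 0); split; [apply PL_zero|intros; simpl; ring].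
  - apply E; assumption.
  - apply (PL_plus _ (fun t => f (phi t)) (fun t => g (phi t))); assumption.
  - apply (PL_mult k l (fun t => f (phi t)) (fun t => g (phi t))); assumption.
  - apply PL_le with (S k); [lia|assumption].
Qed.

Lemma upd_id x i : upd x i (x i) = x.
Proof.
  apply functional_extensionality; intros j; unfold upd.
  destruct (Nat.eqb_spec j i); congruence.
Qed.

(** Both claims go through one induction because the product rule needs differentiability. The
    degree bound is kept and not lowered, which is harmless for the powers of [p]. *)
Lemma pol_pd_aux m k f : pol m k f -> forall i,
  (forall x t, ex_derive (fun u => f (upd x i u)) t) /\ pol m k (pd i f).
Proof.
  intros H i; unfold pd; induction H.
  - split; [intros; apply ex_derive_const|].
    apply (pol_ext _ _ (fun _ => 0)); [|apply pol_const].
    intros x; symmetry; apply Derive_const.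
  - unfold upd; destruct (Nat.eqb_spec i0 i) as [->|Hne].
    + split; [intros; apply ex_derive_id|].
      apply (pol_ext _ _ (fun _ => 1)); [|apply pol_cst].
      intros x; symmetry; apply Derive_id.
    + split; [intros; apply ex_derive_const|].
      apply (pol_ext _ _ (fun _ => 0)); [|apply pol_cst].
      intros x; symmetry; apply Derive_const.
  - destruct IHpol1 as [A1 A2], IHpol2 as [B1 B2]; split.
    + intros x t; apply (ex_derive_plus (fun u => f (upd x i u)) (fun u => g (upd x i u))); auto.
    + eapply pol_ext; [|apply pol_add; [exact A2|exact B2]].
      intros x; symmetry; apply (Derive_plus (fun u => f (upd x i u)) (fun u => g (upd x i u))); auto.
  - destruct IHpol1 as [A1 A2], IHpol2 as [B1 B2]; split.
    + intros x t; apply (ex_derive_mult (fun u => f (upd x i u)) (fun u => g (upd x i u))); auto.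
    + eapply pol_ext; [|apply pol_add; [apply pol_mul; [exact A2|exact H0]|
        apply pol_mul; [exact H|exact B2]]].
      intros x; symmetry; simpl.
      rewrite (Derive_mult (fun u => f (upd x i u)) (fun u => g (upd x i u))), upd_id; auto.
  - destruct IHpol as [A1 A2]; split; [exact A1|].
    apply pol_le with k; assumption.
Qed.

Lemma pol_pd m k i f : pol m k f -> pol m k (pd i f).
Proof. intros H; apply (pol_pd_aux m k f H). Qed.

Lemma pol_ex_derive m k f x i t : pol m k f -> ex_derive (fun u => f (upd x i u)) t.
Proof. intros H; apply (pol_pd_aux m k f H). Qed.

Lemma sumR_single n i f : (i < n)%nat -> (forall j, (j < n)%nat -> j <> i -> f j = 0) -> sumR n f = f i.
Proof.
  intros Hi H; induction n as [|n IH]; [lia|]; simpl.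
  destruct (Nat.eq_dec i n) as [<-|Hne].
  - rewrite sumR_zero; [ring|]; intros; apply H; lia.
  - rewrite (H n) by lia; rewrite IH by (try lia; intros; apply H; lia); ring.
Qed.

Lemma pol_chain m k f (phi : R -> pt) (e : R -> R) t : pol m k f -> forall de : nat -> R,
  (forall j, (j < m)%nat -> is_derive (fun u => phi u j) t (de j)) ->
  is_derive (fun u => f (phi u)) t (sumR m (fun j => de j * pd j f (phi t))).
Proof.
  intros H de D; induction H.
  - rewrite sumR_zero; [apply (is_derive_const (c : R))|].
    intros j _; unfold pd; rewrite Derive_const; ring.
  - rewrite (sumR_single m i); [|assumption|].
    + unfold pd, upd; rewrite Nat.eqb_refl, Derive_id, Rmult_1_r; auto.
    + intros j _ Hne; unfold pd, upd.
      destruct (Nat.eqb_spec i j); [congruence|rewrite Derive_const; ring].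
  - evar_last; [apply (is_derive_plus (fun u => f (phi u)) (fun u => g (phi u))); eassumption|].
    unfold plus; simpl; rewrite <- sumR_plus; apply sumR_ext; intros j _.
    unfold pd; rewrite Derive_plus; [ring| |]; eapply pol_ex_derive; eassumption.
  - evar_last; [apply (is_derive_mult (fun u => f (phi u)) (fun u => g (phi u)));
      [eassumption|eassumption|intros; apply Rmult_comm]|].
    unfold plus, mult; simpl; rewrite Rmult_comm, <- !sumR_scal, <- sumR_plus.
    apply sumR_ext; intros j _.
    unfold pd; rewrite Derive_mult; [rewrite upd_id; ring| |]; eapply pol_ex_derive; eassumption.
  - assumption.
Qed.

(** The expanded form of a polynomial, on which Dirichlet's formula acts term by term; the degree is
    forgotten. *)
Inductive msp (m : nat) : (pt -> R) -> Prop :=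
| msp_nil : msp m (fun _ => 0)
| msp_cons c al f : msp m f -> msp m (fun x => c * monom m al x + f x).

Lemma msp_ext m f g : (forall x, f x = g x) -> msp m f -> msp m g.
Proof. intros H; replace g with f by (apply functional_extensionality, H); auto. Qed.

Lemma msp_add m f g : msp m f -> msp m g -> msp m (fun x => f x + g x).
Proof.
  intros Hf Hg; induction Hf as [|c al f Hf IH].
  - apply (msp_ext _ g); [intros; ring|exact Hg].
  - apply (msp_ext _ (fun x => c * monom m al x + (f x + g x))); [intros; ring|].
    apply msp_cons, IH.
Qed.

Lemma msp_mul_monom m c al f : msp m f -> msp m (fun x => c * monom m al x * f x).
Proof.
  induction 1 as [|e be f Hf IH].
  - apply (msp_ext _ (fun _ => 0)); [intros; ring|apply msp_nil].
  - apply (msp_ext _ (fun x => c * e * monom m (fun i => al i + be i)%nat x + c * monom m al x * f x)).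
    + intros x; unfold monom; rewrite (prodR_ext _ _ (fun i => x i ^ al i * x i ^ be i)).
      * rewrite prodR_mult; ring.
      * intros; apply pow_add.
    + apply msp_cons, IH.
Qed.

Lemma msp_mul m f g : msp m f -> msp m g -> msp m (fun x => f x * g x).
Proof.
  intros Hf Hg; induction Hf as [|c al f Hf IH].
  - apply (msp_ext _ (fun _ => 0)); [intros; ring|apply msp_nil].
  - apply (msp_ext _ (fun x => c * monom m al x * g x + f x * g x)); [intros; ring|].
    apply msp_add; [apply msp_mul_monom|]; assumption.
Qed.

Lemma prodR_one n f : (forall i, (i < n)%nat -> f i = 1) -> prodR n f = 1.
Proof.
  induction n as [|n IH]; intros H; simpl; [reflexivity|].
  rewrite IH, (H n); auto; ring.
Qed.

Lemma prodR_single n i f : (i < n)%nat -> (forall j, (j < n)%nat -> j <> i -> f j = 1) -> prodR n f = f i.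
Proof.
  intros Hi H; induction n as [|n IH]; [lia|]; simpl.
  destruct (Nat.eq_dec i n) as [<-|Hne].
  - rewrite prodR_one; [ring|]; intros; apply H; lia.
  - rewrite (H n) by lia; rewrite IH by (try lia; intros; apply H; lia); ring.
Qed.

Lemma pol_msp m k f : pol m k f -> msp m f.
Proof.
  induction 1; auto using msp_add, msp_mul.
  - apply (msp_ext _ (fun x => c * monom m (fun _ => 0%nat) x + 0)).
    + intros x; unfold monom; rewrite prodR_one; [ring|reflexivity].
    + apply msp_cons, msp_nil.
  - apply (msp_ext _ (fun x => 1 * monom m (fun j => if (j =? i)%nat then 1%nat else 0%nat) x + 0)).
    + intros x; unfold monom; rewrite (prodR_single m i); [|assumption|].
      * rewrite Nat.eqb_refl; ring.
      * intros j _ Hj; destruct (Nat.eqb_spec j i); [congruence|reflexivity].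
    + apply msp_cons, msp_nil.
Qed.

Lemma is_refint_zero m s : is_refint m s (fun _ => 0) 0.
Proof.
  revert s; induction m as [|m IH]; intros s; simpl; [reflexivity|].
  exists (fun _ => 0); split; [auto|].
  evar_last; [apply (is_RInt_const (V := R_NormedModule))|].
  unfold scal; simpl; unfold mult; simpl; ring.
Qed.

Lemma pol_is_refint m k f s : pol m k f -> is_refint m s f (refint m s f).
Proof.
  intros H; enough (E : exists I, is_refint m s f I).
  { destruct E as [I E]; rewrite (is_refint_unique _ _ _ _ E); exact E. }
  apply pol_msp in H; induction H as [|c al f Hf [I IH]].
  - exists 0; apply is_refint_zero.
  - assert (D := is_refint_dirichlet m s al 0).
    eexists; eapply is_refint_ext; [|apply (is_refint_lincomb _ _ c 1 _ _ _ _ D IH)].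
    intros x; simpl; ring.
Qed.

Definition bary (m : nat) (t : pt) : pt := cons_pt (1 - sumR m t) t.

(* The Dirichlet integrals are symmetric in the exponents of all [m + 1] barycentric coordinates. *)
Lemma refint_swap m k n Q : pol (S m) k Q -> (n < m)%nat ->
  refint m 1 (fun t => Q (fun i => bary m t (swap n i))) = refint m 1 (fun t => Q (bary m t)).
Proof.
  intros H Hn.
  enough (E : exists I, is_refint m 1 (fun t => Q (bary m t)) I /\
    is_refint m 1 (fun t => Q (fun i => bary m t (swap n i))) I).
  { destruct E as (I & E1 & E2).
    rewrite (is_refint_unique _ _ _ _ E1), (is_refint_unique _ _ _ _ E2); reflexivity. }
  apply pol_msp in H; induction H as [|c al f Hf (I & I1 & I2)].
  - exists 0; split; apply is_refint_zero.
  - set (V := fun be : nat -> nat => prodR (S m) (fun i => INR (fact (be i))) / INR (fact (sumN (S m) be + m))).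
    assert (D : forall be, is_refint m 1 (fun t => monom (S m) be (bary m t)) (V be)).
    { intros be; assert (D := is_refint_dirichlet m 1 (fun i => be (S i)) (be 0%nat)).
      unfold V; rewrite prodR_S_l, sumN_S_l.
      replace (be 0%nat + sumN m (fun i => be (S i)) + m)%nat with
        (sumN m (fun i => be (S i)) + be 0%nat + m)%nat by lia.
      rewrite pow1, Rmult_1_r, (Rmult_comm (prodR _ _)) in D.
      revert D; apply is_refint_ext; intros x.
      unfold monom, bary; rewrite prodR_S_l; simpl; ring. }
    assert (S1 : V (fun i => al (swap n i)) = V al).
    { unfold V; rewrite (sumN_swap n (S m) al) by lia.
      rewrite (prodR_swap n (S m) (fun i => INR (fact (al i)))) by lia; reflexivity. }
    exists (c * V al + 1 * I); split.
    + eapply is_refint_ext; [|apply (is_refint_lincomb _ _ c 1 _ _ _ _ (D al) I1)].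
      intros x; simpl; ring.
    + rewrite <- S1.
      eapply is_refint_ext; [|apply (is_refint_lincomb _ _ c 1 _ _ _ _ (D _) I2)].
      intros x; simpl; rewrite Rmult_1_l; f_equal; f_equal.
      change (monom (S m) (fun i => al (swap n i)) (bary m x) =
        monom (S m) al (fun i => bary m x (swap n i))); unfold monom.
      rewrite <- (prodR_swap n (S m)) by lia; apply prodR_ext; intros i _.
      rewrite swap_involutive; reflexivity.
Qed.

(** * Inverse inequalities on a simplex *)

(** The point given by [affine], written symmetrically in all [m + 1] vertices, so that permuting
    vertices amounts to permuting coordinates. *)
Definition comb (m : nat) (a : nat -> pt) (lam : pt) : pt :=
  fun l => sumR (S m) (fun i => lam i * a i l).

Lemma affine_comb m a t : affine m a t = comb m a (bary m t).
Proof.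
  apply functional_extensionality; intros l; unfold affine, comb, bary.
  rewrite sumR_S_l; simpl cons_pt.
  rewrite (sumR_ext m (fun i => t i * (a (S i) l - a 0%nat l))
    (fun i => t i * a (S i) l + - a 0%nat l * t i)) by (intros; ring).
  rewrite sumR_plus, sumR_scal.
  change (cons_pt (1 - sumR m t) t 0%nat) with (1 - sumR m t).
  change (fun i => cons_pt (1 - sumR m t) t (S i) * a (S i) l) with (fun i => t i * a (S i) l); ring.
Qed.

Lemma comb_swap m n a lam : (n < m)%nat ->
  comb m (fun i => a (swap n i)) lam = comb m a (fun i => lam (swap n i)).
Proof.
  intros H; apply functional_extensionality; intros l; unfold comb.
  rewrite <- (sumR_swap n (S m)) by lia; apply sumR_ext; intros i _.
  rewrite swap_involutive; reflexivity.
Qed.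

Lemma pol_comb d m k a q : pol d k q -> pol (S m) k (fun lam => q (comb m a lam)).
Proof.
  intros H; apply (pol_comp d (S m) k q (comb m a) H); intros l _; unfold comb.
  apply pol_sumR; intros i Hi.
  apply (pol_ext _ _ (fun lam => a i l * lam i)); [intros; ring|apply pol_scal, pol_var, Hi].
Qed.

Lemma pol_affine d m k a q : pol d k q -> pol m k (fun t => q (affine m a t)).
Proof.
  intros H; apply (pol_comp d m k q (affine m a) H); intros l _; unfold affine.
  apply (pol_add m 1 (fun _ => a 0%nat l)); [apply pol_cst|].
  apply pol_sumR; intros i Hi.
  apply (pol_ext _ _ (fun t => (a (S i) l - a 0%nat l) * t i)); [intros; ring|].
  apply pol_scal, pol_var, Hi.
Qed.

Lemma pol_bary m i : (i <= m)%nat -> pol m 1 (fun t => bary m t i).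
Proof.
  intros H; destruct i as [|i]; unfold bary; simpl.
  - apply (pol_minus m 1 (fun _ => 1)); [apply pol_cst|].
    apply (pol_sumR m 1 m (fun i t => t i)); intros; apply pol_var; assumption.
  - apply pol_var; lia.
Qed.

Lemma refint_swap_affine d m k l n W a q : pol (S m) l W -> pol d k q -> (n < m)%nat ->
  refint m 1 (fun t => W (fun i => bary m t (swap n i)) * q (affine m (fun i => a (swap n i)) t)) =
  refint m 1 (fun t => W (bary m t) * q (affine m a t)).
Proof.
  intros HW Hq Hn.
  assert (HQ : pol (S m) (l + k) (fun lam => W lam * q (comb m a lam))).
  { apply pol_mul; [exact HW|apply (pol_comb d), Hq]. }
  transitivity (refint m 1 (fun t => (fun lam => W lam * q (comb m a lam)) (fun i => bary m t (swap n i)))).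
  - f_equal; apply functional_extensionality; intros t.
    rewrite affine_comb, comb_swap by exact Hn; reflexivity.
  - etransitivity; [exact (refint_swap m (l + k) n _ HQ Hn)|].
    f_equal; apply functional_extensionality; intros t; rewrite affine_comb; reflexivity.
Qed.

Lemma refint_swap_affine0 d m k n a q : pol d k q -> (n < m)%nat ->
  refint m 1 (fun t => q (affine m (fun i => a (swap n i)) t)) = refint m 1 (fun t => q (affine m a t)).
Proof.
  intros Hq Hn.
  assert (H := refint_swap_affine d m k 0 n (fun _ => 1) a q (pol_const _ 1) Hq Hn).
  cbv beta in H; revert H.
  replace (fun t => 1 * q (affine m (fun i => a (swap n i)) t)) with
    (fun t => q (affine m (fun i => a (swap n i)) t)) by (apply functional_extensionality; intros; ring).
  replace (fun t => 1 * q (affine m a t)) with (fun t => q (affine m a t))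
    by (apply functional_extensionality; intros; ring).
  auto.
Qed.

Lemma PL2_affine a m y l : PL 2 (fun u => affine (S m) a (upd y m u) l).
Proof.
  apply PL_S; exists (a (S m) l - a 0%nat l), (fun _ => affine m a y l); split.
  - apply PL_S; exists (affine m a y l), (fun _ => 0); split; [apply PL_zero|intros; simpl; ring].
  - intros u; unfold affine; simpl sumR.
    rewrite (sumR_ext m _ (fun i => y i * (a (S i) l - a 0%nat l))).
    + unfold upd; rewrite Nat.eqb_refl; ring.
    + intros i Hi; unfold upd; destruct (Nat.eqb_spec i m); [lia|reflexivity].
Qed.

Lemma affine_upd a m y u l :
  affine (S m) a (upd y m u) l = affine m a y l + u * (a (S m) l - a 0%nat l).
Proof.
  unfold affine; simpl sumR.
  rewrite (sumR_ext m _ (fun i => y i * (a (S i) l - a 0%nat l))).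
  - unfold upd; rewrite Nat.eqb_refl; ring.
  - intros i Hi; unfold upd; destruct (Nat.eqb_spec i m); [lia|reflexivity].
Qed.

Lemma refint_le m k l f g : pol m k f -> pol m l g ->
  (forall y, in_ref m 1 y -> f y <= g y) -> refint m 1 f <= refint m 1 g.
Proof.
  intros Hf Hg H.
  apply (is_refint_le m 1 f g _ _ Rle_0_1 (pol_is_refint _ _ _ 1 Hf) (pol_is_refint _ _ _ 1 Hg) H).
Qed.

Lemma refint_scal m k c f : pol m k f -> refint m 1 (fun x => c * f x) = c * refint m 1 f.
Proof.
  intros Hf; apply is_refint_unique.
  assert (H := is_refint_lincomb _ _ c 0 _ _ _ _ (pol_is_refint _ _ _ 1 Hf) (pol_is_refint _ _ _ 1 Hf)).
  replace (c * refint m 1 f) with (c * refint m 1 f + 0 * refint m 1 f) by ring.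
  revert H; apply is_refint_ext; intros; ring.
Qed.

Lemma refint_plus m k l f g : pol m k f -> pol m l g ->
  refint m 1 (fun x => f x + g x) = refint m 1 f + refint m 1 g.
Proof.
  intros Hf Hg; apply is_refint_unique.
  assert (H := is_refint_lincomb _ _ 1 1 _ _ _ _ (pol_is_refint _ _ _ 1 Hf) (pol_is_refint _ _ _ 1 Hg)).
  rewrite <- (Rmult_1_l (refint m 1 f)), <- (Rmult_1_l (refint m 1 g)).
  revert H; apply is_refint_ext; intros; ring.
Qed.

Lemma refint_sumR m k n f : (forall i, (i < n)%nat -> pol m k (f i)) ->
  refint m 1 (fun x => sumR n (fun i => f i x)) = sumR n (fun i => refint m 1 (f i)).
Proof.
  induction n as [|n IH]; intros H; simpl.
  - apply is_refint_unique, is_refint_zero.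
  - rewrite (refint_plus m k k); [|apply pol_sumR; auto|auto].
    rewrite IH; auto.
Qed.

Lemma refint_ge0 m k f : pol m k f -> (forall y, in_ref m 1 y -> 0 <= f y) -> 0 <= refint m 1 f.
Proof. intros Hf; apply is_refint_ge0; [lra|apply (pol_is_refint _ _ _ 1 Hf)]. Qed.

Lemma sumR_upd m y u : sumR m (upd y m u) = sumR m y.
Proof.
  apply sumR_ext; intros i Hi; unfold upd; destruct (Nat.eqb_spec i m); [lia|reflexivity].
Qed.

(* On the segment of the simplex through a point [y] of the facet, in the direction of vertex
   [0], the length in barycentric coordinates is [bary m y 0]. *)
Lemma trace_vertex0 d m k a q : pol d k q ->
  refint m 1 (fun y => bary m y 0%nat * q (affine m a y) ^ 2) <=
  (INR k + 2) ^ 2 * refint (S m) 1 (fun t => q (affine (S m) a t) ^ 2).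
Proof.
  intros Hq.
  assert (Hm : forall n, pol n (k + k) (fun t => q (affine n a t) ^ 2)).
  { intros n; apply pol_sqr, (pol_affine d), Hq. }
  assert (H1 := pol_is_refint _ _ _ 1 (pol_mul m _ _ _ _ (pol_bary m 0 ltac:(lia)) (Hm m))).
  assert (H2 := is_refint_slice _ _ _ _ (pol_is_refint _ _ _ 1 (Hm (S m)))).
  assert (H3 := is_refint_lincomb _ _ ((INR k + 2) ^ 2) 0 _ _ _ _ H2 H2).
  match type of H3 with is_refint _ _ _ ?v => apply Rle_trans with v; [|right; ring] end.
  apply (is_refint_le m 1 _ _ _ _ Rle_0_1 H1 H3).
  intros y [Y1 Y2]; cbv beta.
  set (r := fun u => q (affine (S m) a (upd y m u))).
  assert (Pr : PL (S k) r).
  { apply (pol_PL d k q (fun u => affine (S m) a (upd y m u)) Hq); intros; apply PL2_affine. }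
  destruct (PL_endpoints (1 - sumR m y) ltac:(lra) (S k) r Pr) as [E _].
  change (bary m y 0%nat) with (1 - sumR m y).
  replace (affine m a y) with (affine (S m) a (upd y m 0)).
  2:{ apply functional_extensionality; intros l; rewrite affine_upd; ring. }
  rewrite S_INR in E; replace (INR k + 1 + 1) with (INR k + 2) in E by ring.
  rewrite (RInt_ext (fun u => q (affine (S m) a (upd y m u)) ^ 2) (fun u => r u * r u))
    by (intros; unfold r; rring).
  rewrite Rmult_0_l, Rplus_0_r; exact E.
Qed.

Definition dird (d : nat) (e : pt) (q : pt -> R) (x : pt) : R :=
  sumR d (fun l => e l * pd l q x).

Lemma pol_dird d k e q : pol d k q -> pol d k (dird d e q).
Proof. intros H; apply pol_sumR; intros; apply pol_scal, pol_pd, H. Qed.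

Definition edge (a : nat -> pt) (i j : nat) : pt := fun l => a i l - a j l.

(** The innermost coordinate moves the point parallel to the edge from vertex [0] to vertex [S m].
    On such a segment the two barycentric coordinates have a constant sum, equal to its length, so
    the factor [l ^ 2] of [PL_markov] can be put under the integral as the weight. *)
Lemma markov_edge0 d m k a q : pol d k q ->
  refint (S m) 1 (fun t => (bary (S m) t 0%nat + bary (S m) t (S m)) ^ 2 *
     dird d (edge a (S m) 0) q (affine (S m) a t) ^ 2) <=
  4 * (INR k + 2) ^ 4 * refint (S m) 1 (fun t => q (affine (S m) a t) ^ 2).
Proof.
  intros Hq.
  assert (Hm : pol (S m) (k + k) (fun t => q (affine (S m) a t) ^ 2)).
  { apply pol_sqr, (pol_affine d), Hq. }
  assert (Hd := pol_dird d k (edge a (S m) 0) q Hq).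
  assert (Hdm : pol (S m) (k + k) (fun t => dird d (edge a (S m) 0) q (affine (S m) a t) ^ 2)).
  { apply pol_sqr, (pol_affine d), Hd. }
  assert (HW : pol (S m) 2 (fun t => (bary (S m) t 0%nat + bary (S m) t (S m)) ^ 2)).
  { apply (pol_sqr _ 1), pol_add; apply pol_bary; lia. }
  assert (H1 := is_refint_slice _ _ _ _ (pol_is_refint _ _ _ 1 (pol_mul _ _ _ _ _ HW Hdm))).
  assert (H2 := is_refint_slice _ _ _ _ (pol_is_refint _ _ _ 1 Hm)).
  assert (H3 := is_refint_lincomb _ _ (4 * (INR k + 2) ^ 4) 0 _ _ _ _ H2 H2).
  match type of H3 with is_refint _ _ _ ?v => apply Rle_trans with v; [|right; ring] end.
  apply (is_refint_le m 1 _ _ _ _ Rle_0_1 H1 H3).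
  intros y [Y1 Y2]; cbv beta.
  set (r := fun u => q (affine (S m) a (upd y m u))).
  set (dr := fun u => dird d (edge a (S m) 0) q (affine (S m) a (upd y m u))).
  assert (Pr : PL (S k) r).
  { apply (pol_PL d k q (fun u => affine (S m) a (upd y m u)) Hq); intros; apply PL2_affine. }
  assert (Pdr : PL (S k) dr).
  { apply (pol_PL d k _ (fun u => affine (S m) a (upd y m u)) Hd); intros; apply PL2_affine. }
  assert (Dr : forall u, is_derive r u (dr u)).
  { intros u; apply (pol_chain d k q (fun u => affine (S m) a (upd y m u)) (fun _ => 0) u Hq).
    intros l _.
    apply (is_derive_ext (fun u => affine m a y l + u * edge a (S m) 0 l)).
    { intros t; rewrite affine_upd; reflexivity. }
    auto_derive; [exact I|ring]. }
  assert (E := PL_markov (1 - sumR m y) ltac:(lra) (S k) r dr Pr Dr).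
  rewrite S_INR in E; replace (INR k + 1 + 1) with (INR k + 2) in E by ring.
  rewrite (RInt_ext (fun u => q (affine (S m) a (upd y m u)) ^ 2) (fun u => r u * r u))
    by (intros; unfold r; rring).
  rewrite (RInt_ext _ (fun u => (1 - sumR m y) ^ 2 * (dr u * dr u))).
  - rewrite Rmult_0_l, Rplus_0_r.
    rewrite (RInt_scal (V := R_CompleteNormedModule) (fun u => dr u * dr u)).
    + exact E.
    + apply ex_RInt_cont, continuous_Rmult; intros; apply (PL_continuous _ _ _ Pdr).
  - intros u _; unfold dr.
    replace (bary (S m) (upd y m u) 0%nat + bary (S m) (upd y m u) (S m)) with (1 - sumR m y).
    { rring. }
    unfold bary; simpl; rewrite sumR_upd; ring.
Qed.

Lemma trace_vertex d m k i a q : pol d k q -> (i <= m)%nat ->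
  refint m 1 (fun y => bary m y i * q (affine m a y) ^ 2) <=
  (INR k + 2) ^ 2 * refint (S m) 1 (fun t => q (affine (S m) a t) ^ 2).
Proof.
  intros Hq; revert a; induction i as [|i IH]; intros a Hi; [apply (trace_vertex0 d); exact Hq|].
  specialize (IH (fun n => a (swap i n)) ltac:(lia)).
  assert (Hq2 := pol_sqr _ _ _ Hq).
  rewrite (refint_swap_affine0 d (S m) (k + k) i a (fun x => q x ^ 2) Hq2 ltac:(lia)) in IH.
  eapply Rle_trans; [|exact IH]; right; symmetry.
  rewrite <- (refint_swap_affine d m (k + k) 1 i (fun lam => lam (S i)) a (fun x => q x ^ 2)); auto.
  - f_equal; apply functional_extensionality; intros t; rewrite swap_r; reflexivity.
  - apply pol_var; lia.
Qed.

Lemma sumR_bary m t : sumR (S m) (bary m t) = 1.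
Proof.
  rewrite sumR_S_l; unfold bary; simpl.
  change (fun i => t i) with t; ring.
Qed.

Lemma sumR_le n f g : (forall i, (i < n)%nat -> f i <= g i) -> sumR n f <= sumR n g.
Proof.
  induction n as [|n IH]; intros H; simpl; [lra|].
  apply Rplus_le_compat; auto.
Qed.

Lemma sumR_cst n c : sumR n (fun _ => c) = INR n * c.
Proof. induction n as [|n IH]; [simpl; ring|]; rewrite S_INR; simpl sumR; rewrite IH; ring. Qed.

Lemma trace_last_facet d m k a q : pol d k q ->
  refint m 1 (fun y => q (affine m a y) ^ 2) <=
  INR (S m) * ((INR k + 2) ^ 2 * refint (S m) 1 (fun t => q (affine (S m) a t) ^ 2)).
Proof.
  intros Hq; rewrite <- sumR_cst.
  replace (fun y => q (affine m a y) ^ 2) with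
    (fun y => sumR (S m) (fun i => bary m y i * q (affine m a y) ^ 2)).
  - rewrite (refint_sumR m (1 + (k + k))).
    + apply sumR_le; intros i Hi; apply (trace_vertex d); [exact Hq|lia].
    + intros i Hi; apply pol_mul; [apply pol_bary; lia|apply pol_sqr, (pol_affine d), Hq].
  - apply functional_extensionality; intros y.
    rewrite (sumR_ext _ _ (fun i => q (affine m a y) ^ 2 * bary m y i)) by (intros; ring).
    rewrite sumR_scal, sumR_bary; ring.
Qed.

Lemma affine_ext m a b t : (forall i, (i <= m)%nat -> a i = b i) -> affine m a t = affine m b t.
Proof.
  intros H; apply functional_extensionality; intros l; unfold affine.
  rewrite (H 0%nat) by lia; f_equal; apply sumR_ext; intros i Hi; rewrite (H (S i)) by lia; reflexivity.
Qed.

(** Induction on [S m - j]: exchanging the vertices [j] and [S j] turns the facet opposite to [j]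
    into the one opposite to [S j], until the last facet is reached. *)
Lemma trace_facet d m k j a q : pol d k q -> (j <= S m)%nat ->
  refint m 1 (fun y => q (affine m (facet a j) y) ^ 2) <=
  INR (S m) * ((INR k + 2) ^ 2 * refint (S m) 1 (fun t => q (affine (S m) a t) ^ 2)).
Proof.
  intros Hq Hj; remember (S m - j)%nat as n eqn:En.
  revert j a Hj En; induction n as [|n IH]; intros j a Hj En.
  - replace j with (S m) by lia.
    eapply Rle_trans; [right|apply (trace_last_facet d); exact Hq].
    f_equal; apply functional_extensionality; intros t; do 2 f_equal.
    apply affine_ext; intros i Hi; unfold facet.
    destruct (Nat.ltb_spec i (S m)); [reflexivity|lia].
  - specialize (IH (S j) (fun i => a (swap j i)) ltac:(lia) ltac:(lia)).
    rewrite (refint_swap_affine0 d (S m) (k + k) j a (fun x => q x ^ 2) (pol_sqr _ _ _ Hq) ltac:(lia)) in IH.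
    eapply Rle_trans; [right|exact IH].
    f_equal; apply functional_extensionality; intros t; do 2 f_equal.
    apply affine_ext; intros i Hi; unfold facet.
    destruct (Nat.ltb_spec i j), (Nat.ltb_spec i (S j)); try lia.
    + rewrite swap_neq by lia; reflexivity.
    + replace i with j by lia; rewrite swap_l; reflexivity.
    + rewrite swap_neq by lia; reflexivity.
Qed.

(** The pair [(0, S m)] is the direction of the innermost integral. From there [i] is raised with
    [j = S m] fixed, and then [j] is lowered. *)
Lemma markov_edge_lt d m k i j a q : pol d k q -> (i < j <= S m)%nat ->
  refint (S m) 1 (fun t => (bary (S m) t i + bary (S m) t j) ^ 2 *
     dird d (edge a j i) q (affine (S m) a t) ^ 2) <=
  4 * (INR k + 2) ^ 4 * refint (S m) 1 (fun t => q (affine (S m) a t) ^ 2).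
Proof.
  intros Hq [Hij Hj]; remember (S m - j)%nat as n eqn:En.
  assert (HW : forall i j, (i <= S m)%nat -> (j <= S m)%nat ->
     pol (S (S m)) 2 (fun lam => (lam i + lam j) ^ 2)).
  { intros; apply (pol_sqr _ 1), pol_add; apply pol_var; lia. }
  revert j a Hij Hj En; induction n as [|n IHn]; intros j a Hij Hj En.
  - replace j with (S m) in * by lia; clear Hj En.
    revert a; induction i as [|i IH]; intros a; [apply markov_edge0; exact Hq|].
    specialize (IH ltac:(lia) (fun n => a (swap i n))).
    rewrite (refint_swap_affine0 d (S m) (k + k) i a (fun x => q x ^ 2) (pol_sqr _ _ _ Hq) ltac:(lia)) in IH.
    eapply Rle_trans; [right|exact IH].
    rewrite <- (refint_swap_affine d (S m) (k + k) 2 i (fun lam => (lam (S i) + lam (S m)) ^ 2) a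
      (fun x => dird d (edge a (S m) (S i)) q x ^ 2)); try lia.
    + f_equal; apply functional_extensionality; intros t.
      unfold edge; rewrite swap_r, swap_l, !swap_neq by lia; reflexivity.
    + apply HW; lia.
    + apply pol_sqr, pol_dird, Hq.
  - specialize (IHn (S j) (fun n => a (swap j n)) ltac:(lia) ltac:(lia) ltac:(lia)).
    rewrite (refint_swap_affine0 d (S m) (k + k) j a (fun x => q x ^ 2) (pol_sqr _ _ _ Hq) ltac:(lia)) in IHn.
    eapply Rle_trans; [right|exact IHn].
    rewrite <- (refint_swap_affine d (S m) (k + k) 2 j (fun lam => (lam i + lam j) ^ 2) a
      (fun x => dird d (edge a j i) q x ^ 2)); try lia.
    + f_equal; apply functional_extensionality; intros t.
      unfold edge; rewrite swap_r, swap_l, !swap_neq by lia; reflexivity.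
    + apply HW; lia.
    + apply pol_sqr, pol_dird, Hq.
Qed.

Lemma dird_edge_plus d a i j n q x :
  dird d (edge a i n) q x = dird d (edge a i j) q x + dird d (edge a j n) q x.
Proof. unfold dird, edge; rewrite <- sumR_plus; apply sumR_ext; intros; ring. Qed.

Lemma dird_edge_diag d a i q x : dird d (edge a i i) q x = 0.
Proof. unfold dird, edge; apply sumR_zero; intros; ring. Qed.

Lemma markov_edge d m k i j a q : pol d k q -> (i <= S m)%nat -> (j <= S m)%nat ->
  refint (S m) 1 (fun t => (bary (S m) t i + bary (S m) t j) ^ 2 *
     dird d (edge a i j) q (affine (S m) a t) ^ 2) <=
  4 * (INR k + 2) ^ 4 * refint (S m) 1 (fun t => q (affine (S m) a t) ^ 2).
Proof.
  intros Hq Hi Hj; destruct (Nat.lt_total i j) as [H|[<-|H]].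
  - eapply Rle_trans; [right|apply (markov_edge_lt d m k i j a q Hq); lia].
    f_equal; apply functional_extensionality; intros t.
    assert (E := dird_edge_plus d a i j i q (affine (S m) a t)).
    rewrite dird_edge_diag in E; replace (dird d (edge a i j) q (affine (S m) a t)) with
      (- dird d (edge a j i) q (affine (S m) a t)) by lra; ring.
  - rewrite (is_refint_unique _ _ _ 0).
    + apply Rmult_le_pos.
      * apply Rmult_le_pos; [lra|]; apply pow_le; generalize (pos_INR k); lra.
      * apply (refint_ge0 _ (k + k)); [apply pol_sqr, (pol_affine d), Hq|intros; apply pow2_ge_0].
    + apply (is_refint_ext _ _ (fun _ => 0)); [|apply is_refint_zero].
      intros t; rewrite dird_edge_diag; ring.
  - eapply Rle_trans; [right|apply (markov_edge_lt d m k j i a q Hq); lia].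
    f_equal; apply functional_extensionality; intros t; ring.
Qed.

Lemma sumR_term_le n i f : (i < n)%nat -> (forall j, (j < n)%nat -> 0 <= f j) -> f i <= sumR n f.
Proof.
  intros Hi H; induction n as [|n IH]; [lia|]; simpl.
  assert (P : 0 <= sumR n f).
  { clear IH Hi; induction n as [|n IH]; simpl; [lra|].
    assert (0 <= f n) by (apply H; lia).
    enough (0 <= sumR n f) by lra; apply IH; intros; apply H; lia. }
  destruct (Nat.eq_dec i n) as [->|Hne]; [lra|].
  assert (0 <= f n) by (apply H; lia).
  assert (f i <= sumR n f) by (apply IH; [lia|intros; apply H; lia]); lra.
Qed.

Lemma exists_large_bary m t : exists n, (n <= m)%nat /\ 1 <= INR (S m) * bary m t n.
Proof.
  destruct (Classical_Prop.classic (exists n, (n <= m)%nat /\ 1 <= INR (S m) * bary m t n))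
    as [|H]; [assumption|exfalso].
  assert (E : forall n, (n <= m)%nat -> INR (S m) * bary m t n < 1).
  { intros n Hn; apply Rnot_le_lt; intros C; apply H; exists n; split; assumption. }
  assert (F : forall n, (0 < n <= S m)%nat -> INR (S m) * sumR n (bary m t) < INR n).
  { induction n as [|n IH]; intros Hn; [lia|].
    specialize (E n ltac:(lia)); rewrite (S_INR n); simpl sumR.
    destruct n as [|n]; [simpl (INR 0); simpl sumR; lra|].
    specialize (IH ltac:(lia)); lra. }
  specialize (F (S m) ltac:(lia)); rewrite sumR_bary in F; lra.
Qed.

Lemma bary_ge0 m t n : in_ref m 1 t -> (n <= m)%nat -> 0 <= bary m t n.
Proof. intros [H1 H2] Hn; destruct n as [|n]; unfold bary; simpl; [lra|apply H1; lia]. Qed.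

(* The weights [(lam_i + lam_j)^2] cannot all vanish: some vertex [n] has [lam_n >= 1/(m+2)],
   and the edges at [n] span. *)
Lemma markov_ref d m k i a q : pol d k q -> (i <= S m)%nat ->
  refint (S m) 1 (fun t => dird d (edge a i 0) q (affine (S m) a t) ^ 2) <=
  16 * INR (S (S m)) ^ 4 * (INR k + 2) ^ 4 * refint (S m) 1 (fun t => q (affine (S m) a t) ^ 2).
Proof.
  intros Hq Hi; set (M := INR (S (S m))).
  set (J := refint (S m) 1 (fun t => q (affine (S m) a t) ^ 2)).
  set (D := fun i j t => dird d (edge a i j) q (affine (S m) a t)).
  set (E := fun i j t => (bary (S m) t i + bary (S m) t j) ^ 2 * D i j t ^ 2).
  assert (PD : forall i j, pol (S m) (k + k) (fun t => D i j t ^ 2)).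
  { intros; apply pol_sqr, (pol_affine d), pol_dird, Hq. }
  assert (PE : forall i j, (i < S (S m))%nat -> (j < S (S m))%nat -> pol (S m) (2 + (k + k)) (E i j)).
  { intros u v Hu Hv; apply (pol_mul (S m) 2 (k + k)); [|apply PD].
    apply (pol_sqr _ 1), pol_add; apply pol_bary; lia. }
  (* The good vertex [n] depends on the point, so all pairs are summed. The final [16 M ^ 4]
     collects [M ^ 2] pairs with constant [4] each, [M ^ 2] for the lower bound of the weight, and
     [4] for writing the derivative as a sum of two. *)
  set (T := fun t => sumR (S (S m)) (fun i => sumR (S (S m)) (fun j => E i j t))).
  assert (PT : pol (S m) (2 + (k + k)) T).
  { apply (pol_sumR _ _ _ (fun i t => sumR (S (S m)) (fun j => E i j t))); intros u Hu.
    apply pol_sumR; intros; apply PE; assumption. }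
  assert (HT : refint (S m) 1 T <= M * (M * (4 * (INR k + 2) ^ 4 * J))).
  { unfold T; rewrite (refint_sumR _ (2 + (k + k))).
    2:{ intros u Hu; apply pol_sumR; intros; apply PE; assumption. }
    unfold M; rewrite <- !sumR_cst; apply sumR_le; intros u Hu.
    rewrite (refint_sumR _ (2 + (k + k))); [|intros; apply PE; assumption].
    apply sumR_le; intros v Hv; apply markov_edge; [exact Hq|lia|lia]. }
  apply Rle_trans with (refint (S m) 1 (fun t => 4 * M ^ 2 * T t)).
  2:{ rewrite (refint_scal _ (2 + (k + k)) _ T PT).
      apply Rle_trans with (4 * M ^ 2 * (M * (M * (4 * (INR k + 2) ^ 4 * J)))); [|right; ring].
      apply Rmult_le_compat_l; [|exact HT].
      apply Rmult_le_pos; [lra|apply pow2_ge_0]. }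
  apply (refint_le _ (k + k) (2 + (k + k))); [apply PD|apply pol_scal, PT|].
  intros t Ht; destruct (exists_large_bary (S m) t) as (n & Hn & Ln).
  assert (M0 : 0 < M) by (apply lt_0_INR; lia).
  assert (TE : forall u v, (u <= S m)%nat -> (v <= S m)%nat -> E u v t <= T t).
  { assert (P : forall u v, 0 <= E u v t) by (intros; apply Rmult_le_pos; apply pow2_ge_0).
    intros u v Hu Hv; eapply Rle_trans;
      [|apply (sumR_term_le (S (S m)) u (fun i => sumR (S (S m)) (fun j => E i j t))); [lia|]].
    - apply (sumR_term_le (S (S m)) v (fun j => E u j t)); [lia|auto].
    - intros w Hw; cbv beta; eapply Rle_trans; [apply (P w 0%nat)|].
      apply (sumR_term_le (S (S m)) 0 (fun j => E w j t)); [lia|auto]. }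
  assert (B : forall u v, (u <= S m)%nat -> (v <= S m)%nat -> (u = n \/ v = n) ->
     D u v t ^ 2 <= M ^ 2 * T t).
  { intros u v Hu Hv Hn'.
    apply Rle_trans with (M ^ 2 * E u v t).
    - unfold E; rewrite <- Rmult_assoc.
      replace (M ^ 2 * (bary (S m) t u + bary (S m) t v) ^ 2) with
        ((M * (bary (S m) t u + bary (S m) t v)) ^ 2) by ring.
      assert (1 <= M * (bary (S m) t u + bary (S m) t v)).
      { assert (0 <= M * bary (S m) t u) by (apply Rmult_le_pos; [lra|apply bary_ge0; assumption]).
        assert (0 <= M * bary (S m) t v) by (apply Rmult_le_pos; [lra|apply bary_ge0; assumption]).
        destruct Hn' as [->| ->]; fold M in Ln; lra. }
      rewrite <- (Rmult_1_l (D u v t ^ 2)) at 1.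
      apply Rmult_le_compat_r; [apply pow2_ge_0|nra].
    - apply Rmult_le_compat_l; [apply pow2_ge_0|auto]. }
  assert (B1 := B i n Hi Hn (or_intror eq_refl)).
  assert (B2 := B n 0%nat Hn ltac:(lia) (or_introl eq_refl)).
  change (D i 0%nat t ^ 2 <= 4 * M ^ 2 * T t).
  replace (D i 0%nat t) with (D i n t + D n 0%nat t) by (symmetry; apply dird_edge_plus).
  assert (0 <= (D i n t - D n 0%nat t) ^ 2) by apply pow2_ge_0; nra.
Qed.

(** * Packing of non-overlapping face pieces *)

Definition interval_disjoint (I J : R * R) : Prop :=
  forall y, ~ ((fst I < y < snd I) /\ (fst J < y < snd J)).

Lemma interval_disjoint_sep u v p q : u < v -> p < q -> interval_disjoint (u, v) (p, q) ->
  q <= u \/ v <= p.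
Proof.
  intros H1 H2 D; destruct (Rle_or_lt q u) as [|H3]; [auto|].
  destruct (Rle_or_lt v p) as [|H4]; [auto|exfalso].
  apply (D ((Rmax u p + Rmin v q) / 2)); simpl.
  assert (Rmax u p < Rmin v q).
  { apply Rmax_lub_lt; apply Rmin_glb_lt; assumption. }
  generalize (Rmax_l u p) (Rmax_r u p) (Rmin_l v q) (Rmin_r v q); lra.
Qed.

(* Induction on the list: collapsing the first interval to a point, that is, replacing [F] by
   [x |-> F x - F (clamp x)], does not change the increments of [F] over the other ones. *)
Lemma pack_monotone (l : list (R * R)) : forall (F : R -> R) a b,
  (forall x y, x <= y -> F x <= F y) -> a <= b ->
  List.Forall (fun I => fst I <= snd I /\ (fst I < snd I -> a <= fst I /\ snd I <= b)) l ->
  ForallOrdPairs interval_disjoint l ->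
  sum_list (map (fun I => F (snd I) - F (fst I)) l) <= F b - F a.
Proof.
  induction l as [|[u v] l IH]; intros F a b HF Hab Hl Hd; simpl.
  - specialize (HF a b Hab); lra.
  - inversion Hl as [|? ? [Huv Hin] Hl']; subst; simpl in *.
    inversion Hd as [|? ? Hd1 Hd2]; subst.
    destruct (Rle_lt_or_eq_dec u v Huv) as [Hlt|<-].
    2:{ specialize (IH F a b HF Hab Hl' Hd2); lra. }
    destruct (Hin Hlt) as [Hau Hvb].
    set (F' := fun x => F x - F (Rmax u (Rmin x v))).
    assert (E : map (fun I => F' (snd I) - F' (fst I)) l = map (fun I => F (snd I) - F (fst I)) l).
    { apply map_ext_in; intros [p q] HI; simpl; unfold F'.
      rewrite Forall_forall in Hl', Hd1.
      destruct (Hl' _ HI) as [Hpq _]; simpl in Hpq.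
      destruct (Rle_lt_or_eq_dec p q Hpq) as [Hpq'|<-]; [|ring].
      destruct (interval_disjoint_sep u v p q Hlt Hpq' (Hd1 _ HI)) as [H|H].
      - rewrite !Rmin_left, !Rmax_left by lra; ring.
      - rewrite !Rmin_right, !Rmax_right by lra; ring. }
    assert (B : sum_list (map (fun I => F' (snd I) - F' (fst I)) l) <= F' b - F' a).
    { apply IH; auto.
      intros x y Hxy; unfold F', Rmax, Rmin.
      assert (m1 := HF _ _ Hxy).
      destruct (Rle_dec x v), (Rle_dec y v); try lra;
      repeat match goal with |- context [Rle_dec ?s ?t] => destruct (Rle_dec s t) end; try lra.
      - assert (F u <= F v) by auto with real.
        assert (m3 : F x <= F u) by (apply HF; lra).
        assert (m4 : F u <= F y) by (apply HF; lra).
        lra.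
      - assert (m3 : F v <= F y) by (apply HF; lra). lra.
      - assert (m3 : F v <= F y) by (apply HF; lra).
        assert (m4 : F x <= F u) by (apply HF; lra). lra. }
    rewrite E in B; unfold F' in B.
    rewrite (Rmin_right b v), (Rmax_right u v), (Rmin_left a v), (Rmax_left u a) in B by lra.
    lra.
Qed.

Lemma RInt_monotone (g : R -> R) a : (forall x, continuous g x) -> (forall x, 0 <= g x) ->
  forall x y, x <= y -> RInt g a x <= RInt g a y.
Proof.
  intros Cg Hg x y Hxy.
  assert (E : RInt g a y = RInt g a x + RInt g x y).
  { symmetry; apply (RInt_Chasles (V := R_CompleteNormedModule) g); apply ex_RInt_cont, Cg. }
  assert (0 <= RInt g x y) by (apply RInt_ge_0; auto using ex_RInt_cont); lra.
Qed.

Lemma pack_intervals (l : list (R * R)) g a b : (forall x, continuous g x) -> (forall x, 0 <= g x) ->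
  a <= b -> List.Forall (fun I => fst I <= snd I /\ (fst I < snd I -> a <= fst I /\ snd I <= b)) l ->
  ForallOrdPairs interval_disjoint l ->
  sum_list (map (fun I => RInt g (fst I) (snd I)) l) <= RInt g a b.
Proof.
  intros Cg Hg Hab Hl Hd.
  assert (H := pack_monotone l (RInt g a) a b (RInt_monotone g a Cg Hg) Hab Hl Hd).
  rewrite RInt_point in H; change zero with 0 in H; rewrite Rminus_0_r in H.
  eapply Rle_trans; [right|exact H]; f_equal; apply map_ext; intros [u v]; simpl.
  assert (E : RInt g a v = RInt g a u + RInt g u v).
  { symmetry; apply (RInt_Chasles (V := R_CompleteNormedModule) g); apply ex_RInt_cont, Cg. }
  assert (Sub : forall p q r : R, p = q + r -> r = p - q) by (intros; lra).
  exact (Sub _ _ _ E).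
Qed.

(** * Integrals over triangles by vertical slices *)

Definition pt2 (x y : R) : pt := cons_pt x (cons_pt y (fun _ => 0)).

(* The region [O] of the strip [A < x < B] has vertical slices [(lo x, hi x)] and
   [V] is the integral of [G] over it. *)
Definition sliced (G : pt -> R) (A B V : R) (O : R -> R -> Prop) : Prop :=
  exists lo hi : R -> R,
    is_RInt (fun x => RInt (fun y => G (pt2 x y)) (lo x) (hi x)) A B V /\
    forall x, A < x < B -> lo x <= hi x /\ forall y, lo x < y < hi x -> O x y.

Lemma sliced_point G A O : sliced G A A 0 O.
Proof.
  exists (fun _ => 0), (fun _ => 0); split; [|intros; lra].
  apply (is_RInt_point (V := R_NormedModule)).
Qed.

Lemma sliced_empty G A B O : sliced G A B 0 O.
Proof.
  exists (fun _ => 0), (fun _ => 0); split; [|intros; split; intros; lra].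
  apply (is_RInt_ext (fun _ => 0)).
  - intros x _; rewrite RInt_point; reflexivity.
  - evar_last; [apply (is_RInt_const (V := R_NormedModule))|].
    unfold scal; simpl; unfold mult; simpl; ring.
Qed.

Lemma sliced_glue G A B C V W O : A <= B -> B <= C ->
  sliced G A B V O -> sliced G B C W O -> sliced G A C (V + W) O.
Proof.
  intros HAB HBC (lo1 & hi1 & I1 & S1) (lo2 & hi2 & I2 & S2).
  (* At [x = B] the slice is made empty: a single abscissa does not change the integral, and nothing
     is known about [O] there. *)
  set (sel := fun (f g : R -> R) x => if Rlt_dec x B then f x else if Rlt_dec B x then g x else 0).
  exists (sel lo1 lo2), (sel hi1 hi2); split.
  - apply (is_RInt_Chasles (V := R_NormedModule) _ A B C).
    + eapply is_RInt_ext; [|exact I1]; intros x; rewrite Rmin_left, Rmax_right by assumption.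
      intros Hx; unfold sel; destruct (Rlt_dec x B); [reflexivity|lra].
    + eapply is_RInt_ext; [|exact I2]; intros x; rewrite Rmin_left, Rmax_right by assumption.
      intros Hx; unfold sel; destruct (Rlt_dec x B); [lra|].
      destruct (Rlt_dec B x); [reflexivity|lra].
  - intros x Hx; unfold sel; destruct (Rlt_dec x B); [apply S1; lra|].
    destruct (Rlt_dec B x); [apply S2; lra|split; intros; lra].
Qed.

Lemma sliced_impl G A B V (O O' : R -> R -> Prop) :
  (forall x y, A < x < B -> O x y -> O' x y) -> sliced G A B V O -> sliced G A B V O'.
Proof.
  intros H (lo & hi & I1 & S1); exists lo, hi; split; [exact I1|].
  intros x Hx; destruct (S1 x Hx) as [H1 H2]; split; [exact H1|]; intros; apply H; auto.
Qed.

Definition tri (P Q S : pt) : nat -> pt := fun i => match i with 0%nat => P | 1%nat => Q | _ => S end.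
Definition otri (P Q S : pt) (x y : R) : Prop := exists p q s, 0 < p /\ 0 < q /\ 0 < s /\
  p + q + s = 1 /\ x = p * P 0%nat + q * Q 0%nat + s * S 0%nat /\
  y = p * P 1%nat + q * Q 1%nat + s * S 1%nat.
(** The integral over the triangle is [Rabs (det2 P Q S) * itri G P Q S]. Keeping the Jacobian apart
    makes the splitting identity hold for degenerate triangles too. *)
Definition itri (G : pt -> R) (P Q S : pt) : R := refint 2 1 (fun t => G (affine 2 (tri P Q S) t)).
Definition det2 (P Q S : pt) : R :=
  (Q 0%nat - P 0%nat) * (S 1%nat - P 1%nat) - (Q 1%nat - P 1%nat) * (S 0%nat - P 0%nat).

Section Triangles.
Variables (k : nat) (G : pt -> R).
Hypothesis G_pol : pol 2 k G.

Lemma pol2_ext x y z : x = z 0%nat -> y = z 1%nat -> G (pt2 x y) = G z.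
Proof.
  intros; apply (pol_dep 2 k); [exact G_pol|].
  intros [|[|i]] Hi; simpl; [assumption|assumption|lia].
Qed.

Lemma pol2_continuous (f g : R -> R) : PL 2 f -> PL 2 g -> forall v, continuous (fun v => G (pt2 (f v) (g v))) v.
Proof.
  intros Hf Hg v; apply (PL_continuous (S k)).
  apply (pol_PL 2 k G (fun v => pt2 (f v) (g v)) G_pol).
  intros [|[|i]] Hi; simpl; [assumption|assumption|lia].
Qed.

Lemma PL2_lin a b : PL 2 (fun v => a * v + b).
Proof.
  apply PL_S; exists a, (fun _ => b); split; [|intros; ring].
  apply PL_S; exists b, (fun _ => 0); split; [apply PL_zero|intros; simpl; ring].
Qed.

Lemma pol2_continuous_y x v : continuous (fun y => G (pt2 x y)) v.
Proof.
  apply (pol2_continuous (fun _ => x) (fun y => y)).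
  - apply (PL_ext _ (fun v => 0 * v + x)); [intros; ring|apply PL2_lin].
  - apply (PL_ext _ (fun v => 1 * v + 0)); [intros; ring|apply PL2_lin].
Qed.

Lemma refint2_is_RInt f l : pol 2 l f ->
  is_RInt (fun u => RInt (fun v => f (pt2 u v)) 0 (1 - u)) 0 1 (refint 2 1 f).
Proof.
  intros Hf; destruct (pol_is_refint 2 l f 1 Hf) as (phi & H1 & H2).
  apply (is_RInt_ext phi); [|exact H2].
  intros u _; destruct (H1 u) as (psi & H3 & H4); symmetry.
  rewrite (RInt_ext _ psi); [apply is_RInt_unique, H4|].
  intros v _; rewrite H3; reflexivity.
Qed.

Lemma itri_is_RInt P Q S :
  is_RInt (fun u => RInt (fun v => G (pt2 (P 0%nat + u * (Q 0%nat - P 0%nat) + v * (S 0%nat - P 0%nat))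
     (P 1%nat + u * (Q 1%nat - P 1%nat) + v * (S 1%nat - P 1%nat)))) 0 (1 - u)) 0 1 (itri G P Q S).
Proof.
  eapply is_RInt_ext; [|apply (refint2_is_RInt _ k (pol_affine 2 2 k (tri P Q S) G G_pol))].
  intros u _; apply RInt_ext; intros v _; symmetry; apply pol2_ext;
    unfold affine; simpl; ring.
Qed.

Lemma RInt_split (h : R -> R) th b : (forall x, continuous h x) ->
  RInt h 0 b = th * RInt (fun v => h (th * v)) 0 b +
    (1 - th) * RInt (fun v => h ((1 - th) * v + th * b)) 0 b.
Proof.
  intros Ch.
  rewrite <- (RInt_Chasles (V := R_CompleteNormedModule) h 0 (th * b) b) by (apply ex_RInt_cont, Ch).
  assert (E : forall a c, RInt h c (a * b + c) = a * RInt (fun v => h (a * v + c)) 0 b).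
  { intros a c; transitivity (RInt h (a * 0 + c) (a * b + c)); [f_equal; ring|].
    rewrite <- (RInt_comp_lin (V := R_CompleteNormedModule) h a c 0 b) by (apply ex_RInt_cont, Ch).
    rewrite (RInt_scal (V := R_CompleteNormedModule) (fun y => h (a * y + c))); [reflexivity|].
    apply ex_RInt_cont; intros x; apply (continuous_comp (fun y => a * y + c) h); [|apply Ch].
    apply (PL_continuous 2), PL2_lin. }
  assert (E1 := E th 0); rewrite Rplus_0_r in E1; rewrite E1.
  assert (E2 := E (1 - th) (th * b)).
  replace ((1 - th) * b + th * b) with b in E2 by ring; rewrite E2.
  change plus with Rplus; f_equal; f_equal; apply RInt_ext; intros v _; f_equal; ring.
Qed.

(** The triangle is cut from [Q] to the point [M] of the edge [PS]. The inner integrals run along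
    segments parallel to [PS], and each of them is cut in the same ratio, so only a one-variable
    rescaling is needed. *)
Lemma itri_split P Q S th : let M := fun j => (1 - th) * P j + th * S j in
  itri G P Q S = th * itri G P Q M + (1 - th) * itri G M Q S.
Proof.
  intros M.
  assert (H1 := itri_is_RInt P Q M); assert (H2 := itri_is_RInt M Q S).
  assert (H := is_RInt_plus _ _ _ _ _ _ (is_RInt_scal _ _ _ th _ H1) (is_RInt_scal _ _ _ (1 - th) _ H2)).
  apply is_RInt_unique in H; etransitivity; [|exact H].
  rewrite <- (is_RInt_unique _ _ _ _ (itri_is_RInt P Q S)).
  apply RInt_ext; intros u _.
  rewrite (RInt_split _ th).
  - unfold plus, scal; simpl; unfold mult; simpl.
    f_equal; f_equal; apply RInt_ext; intros v _; unfold M; f_equal; f_equal; ring.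
  - apply pol2_continuous.
    + apply (PL_ext _ (fun v => (S 0%nat - P 0%nat) * v + (P 0%nat + u * (Q 0%nat - P 0%nat))));
        [intros; ring|apply PL2_lin].
    + apply (PL_ext _ (fun v => (S 1%nat - P 1%nat) * v + (P 1%nat + u * (Q 1%nat - P 1%nat))));
        [intros; ring|apply PL2_lin].
Qed.

Lemma tri_swap0 P Q S : (fun i => tri P Q S (swap 0 i)) = tri Q P S.
Proof. apply functional_extensionality; intros [|[|[|i]]]; reflexivity. Qed.
Lemma itri_swap0 P Q S : itri G Q P S = itri G P Q S.
Proof. unfold itri; rewrite <- tri_swap0; apply (refint_swap_affine0 2 2 k 0); [exact G_pol|lia]. Qed.
Lemma itri_swap1 P Q S : itri G P S Q = itri G P Q S.
Proof.
  unfold itri; rewrite <- (refint_swap_affine0 2 2 k 1 (tri P Q S) G G_pol) by lia.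
  reflexivity.
Qed.

(** When the edge [V0 V1] is vertical, so are the segments of the inner integral, and the pull-back
    is undone by two one-variable affine substitutions. [W] may lie on either side of that edge; the
    outer integral is then oriented accordingly. *)
Lemma vertical_slices V0 W V1 : V1 0%nat = V0 0%nat -> V0 1%nat < V1 1%nat -> W 0%nat <> V0 0%nat ->
  exists lo hi, is_RInt (fun x => RInt (fun y => G (pt2 x y)) (lo x) (hi x)) (V0 0%nat) (W 0%nat)
    ((W 0%nat - V0 0%nat) * (V1 1%nat - V0 1%nat) * itri G V0 W V1) /\
  forall x, 0 < (x - V0 0%nat) / (W 0%nat - V0 0%nat) < 1 -> lo x <= hi x /\
    forall y, lo x < y < hi x -> otri V0 W V1 x y.
Proof.
  intros HV Hlt HW.
  set (X := V0 0%nat) in *; set (e := V1 1%nat - V0 1%nat); set (D := W 0%nat - X).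
  assert (HD : D <> 0) by (unfold D; lra). assert (He : 0 < e) by (unfold e; lra).
  set (u := fun x => (x - X) / D).
  exists (fun x => V0 1%nat + u x * (W 1%nat - V0 1%nat)),
    (fun x => V0 1%nat + u x * (W 1%nat - V0 1%nat) + (1 - u x) * e); split.
  - assert (H := itri_is_RInt V0 W V1); fold X in H; rewrite HV in H.
    set (phi := fun u => RInt _ 0 (1 - u)) in H.
    assert (H' : is_RInt phi (/ D * X + - X / D) (/ D * W 0%nat + - X / D) (itri G V0 W V1)).
    { replace (/ D * X + - X / D) with 0 by (field; exact HD).
      replace (/ D * W 0%nat + - X / D) with 1 by (unfold D; field; exact HD); exact H. }
    apply (is_RInt_comp_lin (V := R_NormedModule)) in H'.
    apply (is_RInt_scal (V := R_NormedModule) _ _ _ (D * e)) in H'.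
    eapply is_RInt_ext; [|exact H'].
    intros x _; unfold scal; simpl; unfold mult; simpl.
    replace (/ D * x + - X / D) with (u x) by (unfold u; field; exact HD).
    transitivity (e * phi (u x)); [field; exact HD|].
    unfold phi; symmetry.
    set (lo := V0 1%nat + u x * (W 1%nat - V0 1%nat)).
    transitivity (RInt (fun y => G (pt2 x y)) (e * 0 + lo) (e * (1 - u x) + lo)).
    { f_equal; ring. }
    rewrite <- (RInt_comp_lin (V := R_CompleteNormedModule) (fun y => G (pt2 x y)) e lo)
      by (apply ex_RInt_cont, pol2_continuous_y).
    rewrite (RInt_scal (V := R_CompleteNormedModule) (fun v => G (pt2 x (e * v + lo)))).
    + unfold scal; simpl; unfold mult; simpl; f_equal.
      apply RInt_ext; intros v _; f_equal; f_equal; [|unfold lo, e; ring].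
      unfold u; fold D; field; exact HD.
    + apply ex_RInt_cont, (pol2_continuous (fun _ => x)); [|apply PL2_lin].
      apply (PL_ext _ (fun v => 0 * v + x)); [intros; ring|apply PL2_lin].
  - intros x Hx; fold (u x) in Hx; split.
    + assert (0 <= (1 - u x) * e) by (apply Rmult_le_pos; lra); lra.
    + intros y [Y1 Y2].
      set (v := (y - (V0 1%nat + u x * (W 1%nat - V0 1%nat))) / e).
      assert (Ev : v * e = y - (V0 1%nat + u x * (W 1%nat - V0 1%nat))) by (unfold v; field; lra).
      assert (0 < v) by (apply (Rmult_lt_reg_r e); lra).
      assert (v < 1 - u x) by (apply (Rmult_lt_reg_r e); lra).
      exists (1 - u x - v), (u x), v; repeat split; try lra.
      * fold X; rewrite HV.
        assert (u x * D = x - X) by (unfold u; field; exact HD).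
        unfold D in *; lra.
      * unfold e in Ev; lra.
Qed.

Lemma det2_swap0 P Q S : det2 Q P S = - det2 P Q S.
Proof. unfold det2; ring. Qed.
Lemma det2_swap1 P Q S : det2 P S Q = - det2 P Q S.
Proof. unfold det2; ring. Qed.

Lemma otri_swap0 P Q S x y : otri P Q S x y -> otri Q P S x y.
Proof. intros (p & q & s & ?); exists q, p, s; intuition lra. Qed.
Lemma otri_swap1 P Q S x y : otri P Q S x y -> otri P S Q x y.
Proof. intros (p & q & s & ?); exists p, s, q; intuition lra. Qed.

(* With [M] the point of the edge [PS] on the vertical line through [Q], the triangle is the
   union of two triangles with the vertical edge [QM]. *)
Lemma sliced_sorted_aux P Q S V0 V1 th : P 0%nat <= Q 0%nat <= S 0%nat -> P 0%nat < S 0%nat ->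
  0 <= P 0%nat -> S 0%nat <= 1 ->
  th * (S 0%nat - P 0%nat) = Q 0%nat - P 0%nat ->
  let M := fun j => (1 - th) * P j + th * S j in
  (V0 = Q /\ V1 = M \/ V0 = M /\ V1 = Q) -> V0 1%nat < V1 1%nat ->
  sliced G 0 1 (Rabs (det2 P Q S) * itri G P Q S) (otri P Q S).
Proof.
  intros HPQS HPS HP HS Hth M HV Hlt.
  assert (M0 : M 0%nat = Q 0%nat) by (unfold M; lra).
  assert (V00 : V0 0%nat = Q 0%nat) by (destruct HV as [[-> _]|[-> _]]; auto).
  assert (V10 : V1 0%nat = Q 0%nat) by (destruct HV as [[_ ->]|[_ ->]]; auto).
  assert (Hdet : Rabs (det2 P Q S) = (S 0%nat - P 0%nat) * (V1 1%nat - V0 1%nat)).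
  { assert (E : det2 P Q S = (S 0%nat - P 0%nat) * (M 1%nat - Q 1%nat)).
    { unfold det2, M; rewrite <- Hth; ring. }
    rewrite E, Rabs_mult, (Rabs_pos_eq (S 0%nat - P 0%nat)) by lra; f_equal.
    destruct HV as [[-> ->]|[-> ->]]; [apply Rabs_pos_eq; lra|].
    rewrite <- Rabs_Ropp, Rabs_pos_eq by lra; ring. }
  assert (IL : itri G P Q M = itri G V0 P V1).
  { destruct HV as [[-> ->]|[-> ->]]; [apply itri_swap0|].
    rewrite (itri_swap0 P M Q); apply itri_swap1. }
  assert (IR : itri G M Q S = itri G V0 S V1).
  { destruct HV as [[-> ->]|[-> ->]]; [|apply itri_swap1].
    rewrite <- (itri_swap0 M Q S); apply itri_swap1. }
  set (e := V1 1%nat - V0 1%nat) in *.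
  (* Four strips of [[0,1]]: the outer zeros are the empty strips left of [P] and right of [S], the
     other two terms are the triangles on both sides of the vertical edge. *)
  replace (Rabs (det2 P Q S) * itri G P Q S) with
    (0 + ((Q 0%nat - P 0%nat) * e * itri G V0 P V1 + ((S 0%nat - Q 0%nat) * e * itri G V0 S V1 + 0))).
  2:{ rewrite Hdet, (itri_split P Q S th); fold M; rewrite IL, IR, <- Hth.
      replace (S 0%nat - Q 0%nat) with ((1 - th) * (S 0%nat - P 0%nat)) by lra; ring. }
  assert (th01 : 0 <= th <= 1).
  { split; apply (Rmult_le_reg_r (S 0%nat - P 0%nat)); lra. }
  assert (OL : P 0%nat < Q 0%nat -> forall x y, otri V0 P V1 x y -> otri P Q S x y).
  { intros H x y.
    assert (0 < th) by (apply (Rmult_lt_reg_r (S 0%nat - P 0%nat)); lra).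
    assert (W : forall p q s, 0 < p -> 0 < q -> 0 < s -> p + q + s = 1 ->
      otri P Q S (p * P 0%nat + q * Q 0%nat + s * M 0%nat) (p * P 1%nat + q * Q 1%nat + s * M 1%nat)).
    { intros p q s Hp Hq Hs Hsum; exists (p + s * (1 - th)), q, (s * th); unfold M.
      assert (0 <= s * (1 - th)) by (apply Rmult_le_pos; lra).
      assert (0 < s * th) by (apply Rmult_lt_0_compat; lra).
      repeat split; try lra; ring. }
    intros (p & q & s & Hp & Hq & Hs & Hsum & -> & ->).
    destruct HV as [[-> ->]|[-> ->]].
    - replace (p * Q 0%nat + q * P 0%nat) with (q * P 0%nat + p * Q 0%nat) by ring.
      replace (p * Q 1%nat + q * P 1%nat) with (q * P 1%nat + p * Q 1%nat) by ring.
      apply W; lra.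
    - replace (p * M 0%nat + q * P 0%nat + s * Q 0%nat) with (q * P 0%nat + s * Q 0%nat + p * M 0%nat) by ring.
      replace (p * M 1%nat + q * P 1%nat + s * Q 1%nat) with (q * P 1%nat + s * Q 1%nat + p * M 1%nat) by ring.
      apply W; lra. }
  assert (OR : Q 0%nat < S 0%nat -> forall x y, otri V0 S V1 x y -> otri P Q S x y).
  { intros H x y.
    assert (th < 1) by (apply (Rmult_lt_reg_r (S 0%nat - P 0%nat)); lra).
    assert (W : forall p q s, 0 < p -> 0 < q -> 0 < s -> p + q + s = 1 ->
      otri P Q S (p * M 0%nat + q * Q 0%nat + s * S 0%nat) (p * M 1%nat + q * Q 1%nat + s * S 1%nat)).
    { intros p q s Hp Hq Hs Hsum; exists (p * (1 - th)), q, (s + p * th); unfold M.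
      assert (0 < p * (1 - th)) by (apply Rmult_lt_0_compat; lra).
      assert (0 <= p * th) by (apply Rmult_le_pos; lra).
      repeat split; try lra; ring. }
    intros (p & q & s & Hp & Hq & Hs & Hsum & -> & ->).
    destruct HV as [[-> ->]|[-> ->]].
    - replace (p * Q 0%nat + q * S 0%nat + s * M 0%nat) with (s * M 0%nat + p * Q 0%nat + q * S 0%nat) by ring.
      replace (p * Q 1%nat + q * S 1%nat + s * M 1%nat) with (s * M 1%nat + p * Q 1%nat + q * S 1%nat) by ring.
      apply W; lra.
    - replace (p * M 0%nat + q * S 0%nat + s * Q 0%nat) with (p * M 0%nat + s * Q 0%nat + q * S 0%nat) by ring.
      replace (p * M 1%nat + q * S 1%nat + s * Q 1%nat) with (p * M 1%nat + s * Q 1%nat + q * S 1%nat) by ring.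
      apply W; lra. }
  apply (sliced_glue _ 0 (P 0%nat) 1); [lra|lra|apply sliced_empty|].
  apply (sliced_glue _ _ (Q 0%nat) 1); [lra|lra| |].
  - destruct (Req_dec (P 0%nat) (Q 0%nat)) as [E|NE].
    + rewrite E; replace ((Q 0%nat - Q 0%nat) * e * itri G V0 P V1) with 0 by ring; apply sliced_point.
    + destruct (vertical_slices V0 P V1) as (lo & hi & H1 & H2); try lra.
      exists lo, hi; split.
      * apply (is_RInt_swap (V := R_NormedModule)) in H1.
        rewrite V00 in H1; fold e in H1.
        evar_last; [exact H1|]; unfold opp; simpl; ring.
      * intros x Hx; destruct (H2 x) as [H3 H4].
        { rewrite V00; replace ((x - Q 0%nat) / (P 0%nat - Q 0%nat)) with
            ((Q 0%nat - x) / (Q 0%nat - P 0%nat)) by (field; lra).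
          split; [apply Rdiv_lt_0_compat; lra|].
          apply (Rmult_lt_reg_r (Q 0%nat - P 0%nat)); [lra|].
          unfold Rdiv; rewrite Rmult_assoc, Rinv_l by lra; lra. }
        split; [exact H3|]; intros y Hy; apply OL; [lra|auto].
  - apply (sliced_glue _ _ (S 0%nat) 1); [lra|lra| |apply sliced_empty].
    destruct (Req_dec (Q 0%nat) (S 0%nat)) as [E|NE].
    + rewrite E; replace ((S 0%nat - S 0%nat) * e * itri G V0 S V1) with 0 by ring; apply sliced_point.
    + destruct (vertical_slices V0 S V1) as (lo & hi & H1 & H2); try lra.
      exists lo, hi; split.
      * rewrite V00 in H1; fold e in H1; exact H1.
      * intros x Hx; destruct (H2 x) as [H3 H4].
        { rewrite V00; split; [apply Rdiv_lt_0_compat; lra|].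
          apply (Rmult_lt_reg_r (S 0%nat - Q 0%nat)); [lra|].
          unfold Rdiv; rewrite Rmult_assoc, Rinv_l by lra; lra. }
        split; [exact H3|]; intros y Hy; apply OR; [lra|auto].
Qed.

Lemma sliced_sorted P Q S : det2 P Q S <> 0 -> P 0%nat <= Q 0%nat <= S 0%nat ->
  0 <= P 0%nat -> S 0%nat <= 1 ->
  sliced G 0 1 (Rabs (det2 P Q S) * itri G P Q S) (otri P Q S).
Proof.
  intros Hd HPQS HP HS.
  assert (HPS : P 0%nat < S 0%nat).
  { destruct (Req_dec (P 0%nat) (S 0%nat)) as [E|]; [exfalso|lra].
    apply Hd; unfold det2; replace (Q 0%nat) with (P 0%nat) by lra; rewrite <- E; ring. }
  set (th := (Q 0%nat - P 0%nat) / (S 0%nat - P 0%nat)).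
  assert (Hth : th * (S 0%nat - P 0%nat) = Q 0%nat - P 0%nat) by (unfold th; field; lra).
  assert (E : det2 P Q S = (S 0%nat - P 0%nat) * ((1 - th) * P 1%nat + th * S 1%nat - Q 1%nat)).
  { unfold det2; rewrite <- Hth; ring. }
  set (M := fun j => (1 - th) * P j + th * S j).
  (* [M] and [Q] lie on one vertical line; the lower of them serves as [V0], and equality would make
     the triangle degenerate. *)
  destruct (Rtotal_order (M 1%nat) (Q 1%nat)) as [H|[H|H]].
  - apply (sliced_sorted_aux P Q S M Q th); auto.
  - exfalso; apply Hd; rewrite E; unfold M in H; rewrite H; ring.
  - apply (sliced_sorted_aux P Q S Q M th); auto.
Qed.

Lemma sliced_swap0 P Q S : sliced G 0 1 (Rabs (det2 P Q S) * itri G P Q S) (otri P Q S) ->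
  sliced G 0 1 (Rabs (det2 Q P S) * itri G Q P S) (otri Q P S).
Proof.
  rewrite det2_swap0, Rabs_Ropp, itri_swap0; apply sliced_impl; intros x y _; apply otri_swap0.
Qed.
Lemma sliced_swap1 P Q S : sliced G 0 1 (Rabs (det2 P Q S) * itri G P Q S) (otri P Q S) ->
  sliced G 0 1 (Rabs (det2 P S Q) * itri G P S Q) (otri P S Q).
Proof.
  rewrite det2_swap1, Rabs_Ropp, itri_swap1; apply sliced_impl; intros x y _; apply otri_swap1.
Qed.

Lemma sliced_triangle P Q S : det2 P Q S <> 0 -> 0 <= P 0%nat <= 1 -> 0 <= Q 0%nat <= 1 ->
  0 <= S 0%nat <= 1 ->
  sliced G 0 1 (Rabs (det2 P Q S) * itri G P Q S) (otri P Q S).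
Proof.
  intros Hd HP HQ HS.
  assert (d0 := det2_swap0); assert (d1 := det2_swap1).
  destruct (Rle_dec (P 0%nat) (Q 0%nat)), (Rle_dec (Q 0%nat) (S 0%nat)), (Rle_dec (P 0%nat) (S 0%nat));
    try lra.
  - apply sliced_sorted; auto; lra.
  - apply sliced_swap1, sliced_sorted; [rewrite d1; lra|lra..].
  - apply sliced_swap1, sliced_swap0, sliced_sorted; [rewrite d0, d1; lra|lra..].
  - apply sliced_swap0, sliced_sorted; [rewrite d0; lra|lra..].
  - apply sliced_swap0, sliced_swap1, sliced_sorted; [rewrite d1, d0; lra|lra..].
  - apply sliced_swap0, sliced_swap1, sliced_swap0, sliced_sorted; [rewrite d0, d1, d0; lra|lra..].
Qed.

(** All pieces are sliced over the same range [[0,1]] of abscissas, so the sum of their integrals is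
    the integral of the sum of the slice integrals, and the inequality can be checked at each
    abscissa, where it is the packing of intervals. *)
Lemma pack_sliced {A : Type} (V : A -> R) (O : A -> R -> R -> Prop) (l : list A) :
  (forall z, 0 <= G z) ->
  (forall a x y, O a x y -> 0 <= y <= 1 - x) ->
  List.Forall (fun a => sliced G 0 1 (V a) (O a)) l ->
  ForallOrdPairs (fun a b => forall x y, ~ (O a x y /\ O b x y)) l ->
  sum_list (map V l) <= refint 2 1 G.
Proof.
  intros HG HO Hl Hd.
  (* The slice bounds of the pieces are gathered in one list; each entry remembers, through [O], the
     piece it comes from. *)
  assert (E : exists L : list ((R -> R) * (R -> R)),
    is_RInt (fun x => sum_list (map (fun I => RInt (fun y => G (pt2 x y)) (fst I x) (snd I x)) L)) 0 1
      (sum_list (map V l)) /\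
    (forall x, 0 < x < 1 -> List.Forall (fun I => fst I x <= snd I x) L) /\
    (forall I, In I L -> exists a, In a l /\
       forall x y, 0 < x < 1 -> fst I x < y < snd I x -> O a x y) /\
    (forall x, 0 < x < 1 ->
       ForallOrdPairs interval_disjoint (map (fun I => (fst I x, snd I x)) L))).
  { clear HO HG; induction Hl as [|a l (lo & hi & Ha1 & Ha2) Hl IH].
    - exists nil; simpl; split; [|split; [auto|split; [intros I []|constructor]]].
      evar_last; [apply (is_RInt_const (V := R_NormedModule))|].
      unfold scal; simpl; unfold mult; simpl; ring.
    - inversion Hd as [|? ? Hd1 Hd2]; subst.
      destruct (IH Hd2) as (L & L1 & L2 & L3 & L4).
      exists ((lo, hi) :: L); simpl; split; [|split; [|split]].
      + apply (is_RInt_plus (V := R_NormedModule)); assumption.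
      + intros x Hx; constructor; [apply Ha2, Hx|auto].
      + intros I [<-|HI].
        * exists a; split; [left; reflexivity|]; intros x y Hx; apply Ha2, Hx.
        * destruct (L3 I HI) as (b & Hb & H); exists b; auto.
      + intros x Hx; constructor; [|auto].
        apply Forall_forall; intros I HI; apply in_map_iff in HI.
        destruct HI as (J & <- & HJ); destruct (L3 J HJ) as (b & Hb & H).
        rewrite Forall_forall in Hd1; intros y [Y1 Y2]; simpl in *.
        apply (Hd1 b Hb x y); split; [apply Ha2|apply H]; assumption. }
  destruct E as (L & L1 & L2 & L3 & L4).
  apply (is_RInt_le _ _ _ _ _ _ Rle_0_1 L1 (refint2_is_RInt G k G_pol)).
  intros x Hx.
  assert (M := pack_intervals (map (fun I => (fst I x, snd I x)) L) (fun y => G (pt2 x y)) 0 (1 - x)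
    (pol2_continuous_y x) (fun y => HG _) ltac:(lra)).
  rewrite map_map in M; apply M; [|auto].
  apply Forall_forall; intros I HI; apply in_map_iff in HI; destruct HI as (J & <- & HJ); simpl.
  specialize (L2 x Hx); rewrite Forall_forall in L2; split; [apply L2, HJ|].
  intros Hlt; destruct (L3 J HJ) as (a & _ & H).
  (* Only the open slice is known to lie in [[0, 1 - x]]. Its end points follow: otherwise a
     midpoint would be a point of the slice outside that interval. *)
  assert (K : forall y, fst J x < y < snd J x -> 0 <= y <= 1 - x).
  { intros y Hy; apply (HO a), H; assumption. }
  split; apply Rnot_lt_le; intros C.
  - specialize (K ((fst J x + Rmin 0 (snd J x)) / 2)).
    assert (fst J x < Rmin 0 (snd J x)) by (apply Rmin_glb_lt; assumption).
    generalize (Rmin_l 0 (snd J x)) (Rmin_r 0 (snd J x)); lra.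
  - specialize (K ((Rmax (1 - x) (fst J x) + snd J x) / 2)).
    assert (Rmax (1 - x) (fst J x) < snd J x) by (apply Rmax_lub_lt; assumption).
    generalize (Rmax_l (1 - x) (fst J x)) (Rmax_r (1 - x) (fst J x)); lra.
Qed.
End Triangles.

Lemma pack_segments {A : Type} (V : A -> R) (O : A -> R -> Prop) (g : R -> R) (l : list A) :
  (forall x, continuous g x) -> (forall x, 0 <= g x) ->
  List.Forall (fun a => exists u v, u <= v /\ 0 <= u /\ v <= 1 /\ V a = RInt g u v /\
    forall y, u < y < v -> O a y) l ->
  ForallOrdPairs (fun a b => forall y, ~ (O a y /\ O b y)) l ->
  sum_list (map V l) <= RInt g 0 1.
Proof.
  intros Cg Hg Hl Hd.
  assert (E : exists L : list (R * R),
    sum_list (map V l) = sum_list (map (fun I => RInt g (fst I) (snd I)) L) /\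
    List.Forall (fun I => fst I <= snd I /\ (fst I < snd I -> 0 <= fst I /\ snd I <= 1)) L /\
    (forall I, In I L -> exists a, In a l /\ forall y, fst I < y < snd I -> O a y) /\
    ForallOrdPairs interval_disjoint L).
  { induction Hl as [|a l (u & v & Huv & Hu & Hv & HV & HO) Hl IH].
    - exists nil; simpl; repeat split; [constructor|intros I []|constructor].
    - inversion Hd as [|? ? Hd1 Hd2]; subst.
      destruct (IH Hd2) as (L & L1 & L2 & L3 & L4).
      exists ((u, v) :: L); simpl; split; [|split; [|split]].
      + rewrite HV, L1; reflexivity.
      + constructor; [simpl; auto|exact L2].
      + intros I [<-|HI]; [exists a; auto|].
        destruct (L3 I HI) as (b & Hb & H); exists b; auto.
      + constructor; [|exact L4].
        apply Forall_forall; intros I HI; destruct (L3 I HI) as (b & Hb & H).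
        rewrite Forall_forall in Hd1; intros y [Y1 Y2]; simpl in *.
        apply (Hd1 b Hb y); split; [apply HO|apply H]; assumption. }
  destruct E as (L & L1 & L2 & _ & L4); rewrite L1.
  apply pack_intervals; auto; lra.
Qed.

(** * Face pieces in the parameters of their facet *)

Lemma in_simplex_affine d m c x : in_simplex false d m c x ->
  exists be, in_ref m 1 be /\ forall l, (l < d)%nat -> x l = affine m c be l.
Proof.
  intros (lam & H1 & H2 & H3); exists (fun i => lam (S i)).
  rewrite sumR_S_l in H2; split; [split|].
  - intros i Hi; apply (H1 (S i)); lia.
  - assert (A0 := H1 0%nat ltac:(lia)); simpl in A0; lra.
  - intros l Hl; rewrite H3 by exact Hl; rewrite affine_comb; unfold comb.
    apply sumR_ext; intros [|i] _; [|reflexivity].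
    unfold bary; change (lam 0%nat * c 0%nat l = (1 - sumR m (fun i => lam (S i))) * c 0%nat l).
    f_equal; lra.
Qed.

Lemma jac21 a : jac 2 1 a = sqrt ((a 1%nat 0%nat - a 0%nat 0%nat) ^ 2 + (a 1%nat 1%nat - a 0%nat 1%nat) ^ 2).
Proof. unfold jac; f_equal; simpl; ring. Qed.

Definition gram3 (u v : pt) : R := u 0%nat * v 0%nat + u 1%nat * v 1%nat + u 2%nat * v 2%nat.

Lemma jac32 a : jac 3 2 a = sqrt (gram3 (edge a 1 0) (edge a 1 0) * gram3 (edge a 2 0) (edge a 2 0)
  - gram3 (edge a 1 0) (edge a 2 0) ^ 2).
Proof. unfold jac, gram3, edge; f_equal; simpl; ring. Qed.

Lemma sqrt_sqr_mult D X : sqrt (D ^ 2 * X) = Rabs D * sqrt X.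
Proof.
  rewrite sqrt_mult_alt by apply pow2_ge_0; f_equal.
  rewrite <- Rsqr_pow2; apply sqrt_Rsqr_abs.
Qed.

(** In the parameter of the edge [c] a piece is an interval with end points [u] and [v]. Its
    orientation relative to [c] is arbitrary, hence the absolute value of [v - u] and the two cases
    at the end. *)
Lemma packing2 {A : Type} (fv : A -> nat -> pt) (l : list A) c k g : pol 2 k g -> (forall x, 0 <= g x) ->
  List.Forall (fun f => forall i, (i < 2)%nat -> in_simplex false 2 1 c (fv f i)) l ->
  ForallOrdPairs (fun f f' => ~ exists x, in_simplex true 2 1 (fv f) x /\ in_simplex true 2 1 (fv f') x) l ->
  sum_list (map (fun f => int_simplex 2 1 (fv f) g) l) <= int_simplex 2 1 c g.
Proof.
  intros Hg Pg Hl Hd.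
  set (p1 := fun x : R => cons_pt x (fun _ => 0)).
  set (G := fun x => jac 2 1 c * g (affine 1 c (p1 x))).
  assert (CG : forall x, continuous G x).
  { intros x; apply (PL_continuous (S k)), PL_scal.
    apply (pol_PL 2 k g (fun x => affine 1 c (p1 x)) Hg); intros i _.
    apply (PL_ext _ (fun x => (c 1%nat i - c 0%nat i) * x + c 0%nat i));
      [intros; unfold affine; simpl; ring|apply PL2_lin]. }
  assert (J0 : 0 <= jac 2 1 c) by apply sqrt_pos.
  replace (int_simplex 2 1 c g) with (RInt G 0 1).
  2:{ unfold int_simplex, G; simpl.
      rewrite (RInt_scal (V := R_CompleteNormedModule) (fun x => g (affine 1 c (p1 x)))); [reflexivity|].
      apply ex_RInt_cont; intros x; apply (PL_continuous (S k)).
      apply (pol_PL 2 k g (fun x => affine 1 c (p1 x)) Hg); intros i _.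
      apply (PL_ext _ (fun x => (c 1%nat i - c 0%nat i) * x + c 0%nat i));
        [intros; unfold affine; simpl; ring|apply PL2_lin]. }
  apply (pack_segments _ (fun f y => in_simplex true 2 1 (fv f) (affine 1 c (p1 y)))); auto.
  - intros x; apply Rmult_le_pos; auto.
  - apply Forall_forall; intros f Hf; rewrite Forall_forall in Hl; specialize (Hl f Hf).
    destruct (in_simplex_affine _ _ _ _ (Hl 0%nat ltac:(lia))) as (b0 & [B01 B02] & E0).
    destruct (in_simplex_affine _ _ _ _ (Hl 1%nat ltac:(lia))) as (b1 & [B11 B12] & E1).
    specialize (B01 0%nat ltac:(lia)); specialize (B11 0%nat ltac:(lia)); simpl in B02, B12.
    set (u := b0 0%nat) in *; set (v := b1 0%nat) in *.
    assert (F0 : forall i, (i < 2)%nat -> fv f 0%nat i = c 0%nat i + u * (c 1%nat i - c 0%nat i)).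
    { intros i Hi; rewrite E0 by exact Hi; unfold affine; simpl; fold u; ring. }
    assert (F1 : forall i, (i < 2)%nat -> fv f 1%nat i = c 0%nat i + v * (c 1%nat i - c 0%nat i)).
    { intros i Hi; rewrite E1 by exact Hi; unfold affine; simpl; fold v; ring. }
    assert (EV : int_simplex 2 1 (fv f) g = Rabs (v - u) * RInt (fun t => G ((v - u) * t + u)) 0 1).
    { unfold int_simplex.
      assert (EJ : jac 2 1 (fv f) = Rabs (v - u) * jac 2 1 c).
      { rewrite !jac21, <- sqrt_sqr_mult; f_equal.
        rewrite !F0, !F1 by lia; ring. }
      rewrite EJ, Rmult_assoc; f_equal; unfold G.
      rewrite (RInt_scal (V := R_CompleteNormedModule) (fun t => g (affine 1 c (p1 ((v - u) * t + u))))).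
      - unfold scal; simpl; unfold mult; simpl; f_equal; apply RInt_ext; intros t _.
        apply (pol_dep 2 k); [exact Hg|]; intros i Hi; unfold affine; simpl.
        rewrite F0, F1 by exact Hi; ring.
      - apply ex_RInt_cont; intros x; apply (PL_continuous (S k)).
        apply (pol_PL 2 k g (fun t => affine 1 c (p1 ((v - u) * t + u))) Hg); intros i _.
        apply (PL_ext _ (fun x => ((v - u) * (c 1%nat i - c 0%nat i)) * x + (c 0%nat i + u * (c 1%nat i - c 0%nat i))));
        [intros; unfold affine; simpl; ring|apply PL2_lin]. }
    assert (EI : (v - u) * RInt (fun t => G ((v - u) * t + u)) 0 1 = RInt G u v).
    { transitivity (RInt G ((v - u) * 0 + u) ((v - u) * 1 + u)); [|f_equal; ring].
      rewrite <- (RInt_comp_lin (V := R_CompleteNormedModule)) by (apply ex_RInt_cont, CG).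
      rewrite (RInt_scal (V := R_CompleteNormedModule) (fun t => G ((v - u) * t + u))); [reflexivity|].
      apply ex_RInt_cont; intros x; apply (continuous_comp (fun t => (v - u) * t + u) G); [|apply CG].
      apply (PL_continuous 2), PL2_lin. }
    assert (HO : forall y, (u < y < v \/ v < y < u) -> in_simplex true 2 1 (fv f) (affine 1 c (p1 y))).
    { intros y Hy; set (w := (y - u) / (v - u)).
      assert (Ew : w * (v - u) = y - u) by (unfold w; field; lra).
      assert (Hw : 0 < w < 1).
      { split; destruct Hy.
        - apply (Rmult_lt_reg_r (v - u)); lra.
        - apply (Rmult_lt_reg_r (u - v)); lra.
        - apply (Rmult_lt_reg_r (v - u)); lra.
        - apply (Rmult_lt_reg_r (u - v)); lra. }
      exists (fun i => match i with 0%nat => 1 - w | _ => w end); split; [|split].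
      - intros [|i] _; lra.
      - simpl; ring.
      - intros i Hi; unfold affine; simpl; rewrite F0, F1 by exact Hi.
        replace y with (w * (v - u) + u) by lra; ring. }
    destruct (Rle_or_lt u v) as [Huv|Huv].
    + exists u, v; repeat split; try lra.
      * rewrite EV, Rabs_pos_eq by lra; exact EI.
      * intros y Hy; apply HO; left; exact Hy.
    + exists v, u; repeat split; try lra.
      * rewrite EV, Rabs_left by lra.
        rewrite <- (opp_RInt_swap (V := R_CompleteNormedModule) G) by (apply ex_RInt_cont, CG).
        rewrite <- EI; unfold opp; simpl; ring.
      * intros y Hy; apply HO; right; exact Hy.
  - clear Hl; induction Hd as [|f l H1 H2 IH]; constructor; [|exact IH].
    apply Forall_forall; intros f' Hf' y [Y1 Y2]; rewrite Forall_forall in H1.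
    apply (H1 f' Hf'); eauto.
Qed.

Lemma packing3 {A : Type} (fv : A -> nat -> pt) (l : list A) c k g : pol 3 k g -> (forall x, 0 <= g x) ->
  List.Forall (fun f => 0 < jac 3 2 (fv f) /\
    forall i, (i < 3)%nat -> in_simplex false 3 2 c (fv f i)) l ->
  ForallOrdPairs (fun f f' => ~ exists x, in_simplex true 3 2 (fv f) x /\ in_simplex true 3 2 (fv f') x) l ->
  sum_list (map (fun f => int_simplex 3 2 (fv f) g) l) <= int_simplex 3 2 c g.
Proof.
  intros Hg Pg Hl Hd.
  set (G := fun t => jac 3 2 c * g (affine 2 c t)).
  assert (Gc := pol_affine 3 2 k c g Hg).
  assert (HG : pol 2 k G) by (apply pol_scal; exact Gc).
  assert (J0 : 0 <= jac 3 2 c) by apply sqrt_pos.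
  unfold int_simplex at 2; rewrite <- (refint_scal 2 k (jac 3 2 c) _ Gc); fold G.
  (* The second conjunct records that the parameters stay in the reference triangle, which
     membership of the image point does not state by itself. *)
  apply (pack_sliced k G HG _ (fun f x y => in_simplex true 3 2 (fv f) (affine 2 c (pt2 x y)) /\ 0 <= y <= 1 - x)).
  - intros x; apply Rmult_le_pos; auto.
  - intros f x y [_ H]; exact H.
  - apply Forall_forall; intros f Hf; rewrite Forall_forall in Hl; destruct (Hl f Hf) as [Jf Hv].
    destruct (in_simplex_affine _ _ _ _ (Hv 0%nat ltac:(lia))) as (b0 & [B01 B02] & E0).
    destruct (in_simplex_affine _ _ _ _ (Hv 1%nat ltac:(lia))) as (b1 & [B11 B12] & E1).
    destruct (in_simplex_affine _ _ _ _ (Hv 2%nat ltac:(lia))) as (b2 & [B21 B22] & E2).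
    (* The Gram determinant of a parametrised triangle is that of [c] times the squared determinant
       in the parameters. Positivity of the left-hand side then shows that the parameter triangle is
       nondegenerate. *)
    assert (EJ : jac 3 2 (fv f) = Rabs (det2 b0 b1 b2) * jac 3 2 c).
    { rewrite !jac32, <- sqrt_sqr_mult; f_equal; unfold gram3, edge.
      rewrite !E0, !E1, !E2 by lia; unfold affine, det2; simpl; ring. }
    assert (D0 : det2 b0 b1 b2 <> 0).
    { intros Z; rewrite EJ, Z, Rabs_R0 in Jf; lra. }
    assert (EV : int_simplex 3 2 (fv f) g = Rabs (det2 b0 b1 b2) * itri G b0 b1 b2).
    { unfold int_simplex, itri; rewrite EJ, Rmult_assoc; f_equal; unfold G.
      rewrite (refint_scal 2 k (jac 3 2 c) (fun t => g (affine 2 c (affine 2 (tri b0 b1 b2) t)))).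
      - f_equal; f_equal; apply functional_extensionality; intros t.
        apply (pol_dep 3 k); [exact Hg|]; intros i Hi.
        unfold affine at 1; simpl sumR; rewrite E0, E1, E2 by exact Hi.
        unfold affine; simpl; ring.
      - apply (pol_affine 2 2 k (tri b0 b1 b2) (fun z => g (affine 2 c z))); exact Gc. }
    rewrite EV.
    assert (P0 := B01 0%nat ltac:(lia)); assert (P0' := B01 1%nat ltac:(lia)).
    assert (P1 := B11 0%nat ltac:(lia)); assert (P1' := B11 1%nat ltac:(lia)).
    assert (P2 := B21 0%nat ltac:(lia)); assert (P2' := B21 1%nat ltac:(lia)).
    simpl in B02, B12, B22.
    eapply sliced_impl; [|apply (sliced_triangle k G HG b0 b1 b2 D0); lra].
    intros x y _ (p & q & s & Hp & Hq & Hs & Hsum & -> & ->); split; [|split].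
    + exists (fun i => match i with 0%nat => p | 1%nat => q | _ => s end); split; [|split].
      * intros [|[|i]] _; assumption.
      * simpl; lra.
      * intros i Hi; unfold affine; simpl; rewrite E0, E1, E2 by exact Hi; unfold affine; simpl.
        replace p with (1 - q - s) by lra; ring.
    + assert (0 <= p * b0 1%nat) by (apply Rmult_le_pos; lra).
      assert (0 <= q * b1 1%nat) by (apply Rmult_le_pos; lra).
      assert (0 <= s * b2 1%nat) by (apply Rmult_le_pos; lra). lra.
    + assert (0 <= p * (1 - b0 0%nat - b0 1%nat)) by (apply Rmult_le_pos; lra).
      assert (0 <= q * (1 - b1 0%nat - b1 1%nat)) by (apply Rmult_le_pos; lra).
      assert (0 <= s * (1 - b2 0%nat - b2 1%nat)) by (apply Rmult_le_pos; lra). lra.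
  - clear Hl; induction Hd as [|f l H1 H2 IH]; constructor; [|exact IH].
    apply Forall_forall; intros f' Hf' x y [[Y1 _] [Y2 _]]; rewrite Forall_forall in H1.
    apply (H1 f' Hf'); eauto.
Qed.

Lemma packing {A : Type} d (fv : A -> nat -> pt) (l : list A) c k g : (d = 2 \/ d = 3)%nat ->
  pol d k g -> (forall x, 0 <= g x) ->
  List.Forall (fun f => 0 < jac d (d - 1) (fv f) /\
    forall i, (i < d)%nat -> in_simplex false d (d - 1) c (fv f i)) l ->
  ForallOrdPairs (fun f f' => ~ exists x, in_simplex true d (d - 1) (fv f) x /\
    in_simplex true d (d - 1) (fv f') x) l ->
  sum_list (map (fun f => int_simplex d (d - 1) (fv f) g) l) <= int_simplex d (d - 1) c g.
Proof.
  intros [-> | ->] Hg Pg Hl Hd; simpl (_ - _)%nat in *.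
  - apply (packing2 fv l c k); auto.
    eapply Forall_impl; [|exact Hl]; intros f [_ H]; exact H.
  - apply (packing3 fv l c k); auto.
Qed.

(** * Scaling to a physical element *)

Lemma maxR_ge n i f : (i < n)%nat -> f i <= maxR n f.
Proof.
  induction n as [|n IH]; intros Hi; [lia|]; simpl.
  destruct (Nat.eq_dec i n) as [->|Hne]; [apply Rmax_r|].
  eapply Rle_trans; [apply IH; lia|apply Rmax_l].
Qed.

Lemma maxR_ge0 n f : 0 <= maxR n f.
Proof. induction n as [|n IH]; simpl; [lra|]; eapply Rle_trans; [exact IH|apply Rmax_l]. Qed.

Lemma edge_le_diam d m a i j l : (i <= m)%nat -> (j <= m)%nat -> (l < d)%nat ->
  Rabs (edge a i j l) <= diam d m a.
Proof.
  intros Hi Hj Hl; apply Rle_trans with (distd d (a i) (a j)).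
  - unfold distd, edge; rewrite <- sqrt_Rsqr_abs; apply sqrt_le_1_alt.
    rewrite Rsqr_pow2; apply (sumR_term_le d l (fun n => (a i n - a j n) ^ 2)); [exact Hl|].
    intros; apply pow2_ge_0.
  - unfold diam; eapply Rle_trans; [|apply (maxR_ge (S m) i); lia].
    apply (maxR_ge (S m) j (fun j => distd d (a i) (a j))); lia.
Qed.

Lemma sqr_le_of_Rabs x h : Rabs x <= h -> x ^ 2 <= h ^ 2.
Proof. intros H; rewrite <- (pow2_abs x); apply pow_incr; split; [apply Rabs_pos|exact H]. Qed.

Lemma facet_edge a j i i' l : exists n n', facet a j i l - facet a j i' l = edge a n n' l /\
  (n <= S i)%nat /\ (n' <= S i')%nat.
Proof.
  unfold facet; destruct (i <? j)%nat, (i' <? j)%nat;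
  [exists i, i'|exists i, (S i')|exists (S i), i'|exists (S i), (S i')]; repeat split; lia.
Qed.

Lemma jac_facet_le d a j : (d = 2 \/ d = 3)%nat ->
  jac d (d - 1) (facet a j) <= 3 * diam d d a ^ (d - 1).
Proof.
  intros Hd; set (h := diam d d a).
  assert (h0 : 0 <= h) by apply maxR_ge0.
  assert (B : forall i l, (i < d)%nat -> (l < d)%nat -> (edge (facet a j) i 0 l) ^ 2 <= h ^ 2).
  { intros i l Hi Hl; destruct (facet_edge a j i 0 l) as (n & n' & E & Hn & Hn').
    unfold edge at 1; rewrite E; apply sqr_le_of_Rabs, edge_le_diam; lia. }
  destruct Hd as [-> | ->]; simpl (_ - _)%nat.
  - rewrite jac21; apply Rle_trans with (sqrt ((3 * h) ^ 2)).
    + apply sqrt_le_1_alt.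
      assert (B0 := B 1%nat 0%nat ltac:(lia) ltac:(lia)); assert (B1 := B 1%nat 1%nat ltac:(lia) ltac:(lia)).
      unfold edge in B0, B1; nra.
    + rewrite sqrt_pow2 by lra; simpl; lra.
  - rewrite jac32; apply Rle_trans with (sqrt ((3 * h ^ 2) ^ 2)).
    + apply sqrt_le_1_alt.
      assert (G : forall i, (i < 3)%nat -> 0 <= gram3 (edge (facet a j) i 0) (edge (facet a j) i 0) <= 3 * h ^ 2).
      { intros i Hi; assert (B0 := B i 0%nat Hi ltac:(lia)); assert (B1 := B i 1%nat Hi ltac:(lia));
        assert (B2 := B i 2%nat Hi ltac:(lia)); unfold gram3; nra. }
      assert (G1 := G 1%nat ltac:(lia)); assert (G2 := G 2%nat ltac:(lia)).
      assert (0 <= gram3 (edge (facet a j) 1 0) (edge (facet a j) 2 0) ^ 2) by apply pow2_ge_0.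
      replace ((3 * h ^ 2) ^ 2) with ((3 * h ^ 2) * (3 * h ^ 2)) by ring.
      enough (gram3 (edge (facet a j) 1 0) (edge (facet a j) 1 0) *
        gram3 (edge (facet a j) 2 0) (edge (facet a j) 2 0) <= (3 * h ^ 2) * (3 * h ^ 2)) by lra.
      apply Rmult_le_compat; lra.
    + rewrite sqrt_pow2; [lra|]; assert (0 <= h ^ 2) by apply pow2_ge_0; lra.
Qed.

Definition det_edges2 (a : nat -> pt) : R :=
  edge a 1 0 0%nat * edge a 2 0 1%nat - edge a 1 0 1%nat * edge a 2 0 0%nat.
Definition det_edges3 (a : nat -> pt) : R :=
  edge a 1 0 0%nat * (edge a 2 0 1%nat * edge a 3 0 2%nat - edge a 2 0 2%nat * edge a 3 0 1%nat)
  - edge a 1 0 1%nat * (edge a 2 0 0%nat * edge a 3 0 2%nat - edge a 2 0 2%nat * edge a 3 0 0%nat)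
  + edge a 1 0 2%nat * (edge a 2 0 0%nat * edge a 3 0 1%nat - edge a 2 0 1%nat * edge a 3 0 0%nat).

Lemma jac22 a : jac 2 2 a = Rabs (det_edges2 a).
Proof.
  rewrite <- sqrt_Rsqr_abs; unfold jac, det_edges2, edge, Rsqr; f_equal; simpl; ring.
Qed.

Lemma jac33 a : jac 3 3 a = Rabs (det_edges3 a).
Proof.
  rewrite <- sqrt_Rsqr_abs; unfold jac, det_edges3, edge, Rsqr; f_equal; simpl; ring.
Qed.

Lemma sq3_le x y z : (x + y + z) ^ 2 <= 3 * (x ^ 2 + y ^ 2 + z ^ 2).
Proof.
  assert (0 <= (x - y) ^ 2) by apply pow2_ge_0; assert (0 <= (y - z) ^ 2) by apply pow2_ge_0.
  assert (0 <= (x - z) ^ 2) by apply pow2_ge_0; lra.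
Qed.

Lemma mult_sq_le x y A : x ^ 2 <= A -> (x * y) ^ 2 <= A * y ^ 2.
Proof. intros H; rewrite Rpow_mult_distr; apply Rmult_le_compat_r; [apply pow2_ge_0|exact H]. Qed.

Lemma minor_sq_le x y z w h : Rabs x <= h -> Rabs y <= h -> Rabs z <= h -> Rabs w <= h ->
  (x * y - z * w) ^ 2 <= 4 * h ^ 4.
Proof.
  intros Hx Hy Hz Hw.
  assert (M : forall s t, Rabs s <= h -> Rabs t <= h -> (s * t) ^ 2 <= h ^ 2 * h ^ 2).
  { intros s t Hs Ht; rewrite Rpow_mult_distr.
    apply Rmult_le_compat; try apply pow2_ge_0; apply sqr_le_of_Rabs; assumption. }
  assert (M1 := M x y Hx Hy); assert (M2 := M z w Hz Hw).
  assert (0 <= (x * y + z * w) ^ 2) by apply pow2_ge_0.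
  replace (4 * h ^ 4) with (4 * (h ^ 2 * h ^ 2)) by ring; lra.
Qed.

(** For [d = 2] the three-dimensional [curl] also differentiates in the third variable; those terms
    vanish. *)
Lemma pd_outside d k q l x : pol d k q -> (d <= l)%nat -> pd l q x = 0.
Proof.
  intros Hq Hl; unfold pd; rewrite (Derive_ext _ (fun _ => q x)); [apply Derive_const|].
  intros t; apply (pol_dep d k); [exact Hq|]; intros i Hi; unfold upd.
  destruct (Nat.eqb_spec i l); [lia|reflexivity].
Qed.

(* Cramer's rule for the gradient in terms of the edge derivatives. *)
Lemma gradient_le d a k q l x : (d = 2 \/ d = 3)%nat -> pol d k q ->
  jac d d a ^ 2 * pd l q x ^ 2 <= 12 * (diam d d a ^ (d - 1)) ^ 2 *
    sumR d (fun i => dird d (edge a (S i) 0) q x ^ 2).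
Proof.
  intros Hd Hq; set (h := diam d d a).
  assert (P : 0 <= sumR d (fun i => dird d (edge a (S i) 0) q x ^ 2)).
  { rewrite <- (sumR_zero d (fun _ => 0)) by reflexivity; apply sumR_le; intros; apply pow2_ge_0. }
  destruct (le_lt_dec d l) as [Hl|Hl].
  { rewrite (pd_outside d k) by assumption.
    replace (jac d d a ^ 2 * 0 ^ 2) with 0 by ring.
    apply Rmult_le_pos; [|exact P]; apply Rmult_le_pos; [lra|apply pow2_ge_0]. }
  assert (B : forall i l, (i <= d)%nat -> (l < d)%nat -> Rabs (edge a i 0 l) <= h).
  { intros; apply edge_le_diam; lia. }
  assert (BN : forall i l, (i <= d)%nat -> (l < d)%nat -> Rabs (- edge a i 0 l) <= h).
  { intros; rewrite Rabs_Ropp; auto. }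
  destruct Hd as [-> | ->]; simpl (_ - _)%nat.
  - rewrite jac22, pow2_abs, <- Rpow_mult_distr; simpl sumR; rewrite Rplus_0_l.
    set (D1 := dird 2 (edge a 1 0) q x); set (D2 := dird 2 (edge a 2 0) q x).
    assert (C : exists c1 c2, det_edges2 a * pd l q x = c1 * D1 + c2 * D2 /\ Rabs c1 <= h /\ Rabs c2 <= h).
    { destruct l as [|[|l]]; [| |lia].
      - exists (edge a 2 0 1%nat), (- edge a 1 0 1%nat); split; [|split; auto].
        unfold D1, D2, dird, det_edges2; simpl; ring.
      - exists (- edge a 2 0 0%nat), (edge a 1 0 0%nat); split; [|split; auto].
        unfold D1, D2, dird, det_edges2; simpl; ring. }
    destruct C as (c1 & c2 & -> & H1 & H2).
    assert (M1 := mult_sq_le c1 D1 _ (sqr_le_of_Rabs _ _ H1)).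
    assert (M2 := mult_sq_le c2 D2 _ (sqr_le_of_Rabs _ _ H2)).
    assert (T := sq3_le (c1 * D1) (c2 * D2) 0).
    assert (0 <= h ^ 2 * D1 ^ 2) by (apply Rmult_le_pos; apply pow2_ge_0).
    assert (0 <= h ^ 2 * D2 ^ 2) by (apply Rmult_le_pos; apply pow2_ge_0).
    rewrite Rplus_0_r, pow_1 in *; lra.
  - rewrite jac33, pow2_abs, <- Rpow_mult_distr; simpl sumR; rewrite Rplus_0_l.
    set (D1 := dird 3 (edge a 1 0) q x); set (D2 := dird 3 (edge a 2 0) q x);
    set (D3 := dird 3 (edge a 3 0) q x).
    assert (C : exists c1 c2 c3, det_edges3 a * pd l q x = c1 * D1 + c2 * D2 + c3 * D3 /\
      c1 ^ 2 <= 4 * h ^ 4 /\ c2 ^ 2 <= 4 * h ^ 4 /\ c3 ^ 2 <= 4 * h ^ 4).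
    { destruct l as [|[|[|l]]]; [| | |lia].
      - exists (edge a 2 0 1%nat * edge a 3 0 2%nat - edge a 2 0 2%nat * edge a 3 0 1%nat),
          (edge a 3 0 1%nat * edge a 1 0 2%nat - edge a 3 0 2%nat * edge a 1 0 1%nat),
          (edge a 1 0 1%nat * edge a 2 0 2%nat - edge a 1 0 2%nat * edge a 2 0 1%nat).
        split; [|repeat split; apply minor_sq_le; auto].
        unfold D1, D2, D3, dird, det_edges3; simpl; ring.
      - exists (edge a 2 0 2%nat * edge a 3 0 0%nat - edge a 2 0 0%nat * edge a 3 0 2%nat),
          (edge a 3 0 2%nat * edge a 1 0 0%nat - edge a 3 0 0%nat * edge a 1 0 2%nat),
          (edge a 1 0 2%nat * edge a 2 0 0%nat - edge a 1 0 0%nat * edge a 2 0 2%nat).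
        split; [|repeat split; apply minor_sq_le; auto].
        unfold D1, D2, D3, dird, det_edges3; simpl; ring.
      - exists (edge a 2 0 0%nat * edge a 3 0 1%nat - edge a 2 0 1%nat * edge a 3 0 0%nat),
          (edge a 3 0 0%nat * edge a 1 0 1%nat - edge a 3 0 1%nat * edge a 1 0 0%nat),
          (edge a 1 0 0%nat * edge a 2 0 1%nat - edge a 1 0 1%nat * edge a 2 0 0%nat).
        split; [|repeat split; apply minor_sq_le; auto].
        unfold D1, D2, D3, dird, det_edges3; simpl; ring. }
    destruct C as (c1 & c2 & c3 & -> & H1 & H2 & H3).
    assert (M1 := mult_sq_le c1 D1 _ H1); assert (M2 := mult_sq_le c2 D2 _ H2).
    assert (M3 := mult_sq_le c3 D3 _ H3).
    (* The factor [12] is [3] for a sum of three terms times [4] for each squared minor. *)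
    assert (T := sq3_le (c1 * D1) (c2 * D2) (c3 * D3)).
    replace ((h ^ 2) ^ 2) with (h ^ 4) by ring; lra.
Qed.

Section Element.
Variables (d : nat) (a : nat -> pt) (sigma : R).
Hypothesis d_23 : (d = 2 \/ d = 3)%nat.
Hypothesis jac_gt0 : 0 < jac d d a.
Hypothesis shape_regular : diam d d a ^ d <= sigma * jac d d a.
Let h := diam d d a.

(** The scaling costs [h] times the ratio of the Jacobians of facet and element, at most [3 * sigma]
    by shape regularity; the other [3] bounds the number of vertices of the facet in the reference
    inequality. *)
Lemma facet_inverse_inequality k q j : pol d k q -> (j <= d)%nat ->
  h * int_simplex d (d - 1) (facet a j) (fun x => q x ^ 2) <=
  9 * sigma * (INR k + 2) ^ 2 * int_simplex d d a (fun x => q x ^ 2).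
Proof.
  intros Hq Hj; unfold int_simplex.
  set (J := refint d 1 (fun t => q (affine d a t) ^ 2)).
  set (I := refint (d - 1) 1 (fun t => q (affine (d - 1) (facet a j) t) ^ 2)).
  assert (h0 : 0 <= h) by apply maxR_ge0.
  assert (I0 : 0 <= I).
  { apply (refint_ge0 _ (k + k)); [apply pol_sqr, (pol_affine d), Hq|intros; apply pow2_ge_0]. }
  assert (J0 : 0 <= J).
  { apply (refint_ge0 _ (k + k)); [apply pol_sqr, (pol_affine d), Hq|intros; apply pow2_ge_0]. }
  assert (T : I <= 3 * ((INR k + 2) ^ 2 * J)).
  { assert (Ed : S (d - 1) = d) by lia.
    assert (T := trace_facet d (d - 1) k j a q Hq); rewrite Ed in T.
    eapply Rle_trans; [apply T, Hj|]; apply Rmult_le_compat_r.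
    - apply Rmult_le_pos; [apply pow2_ge_0|exact J0].
    - destruct d_23 as [-> | ->]; simpl; lra. }
  assert (F : h * jac d (d - 1) (facet a j) <= 3 * (sigma * jac d d a)).
  { assert (F := jac_facet_le d a j d_23); fold h in F.
    apply Rle_trans with (h * (3 * h ^ (d - 1))); [apply Rmult_le_compat_l; assumption|].
    replace (h * (3 * h ^ (d - 1))) with (3 * (h * h ^ (d - 1))) by ring.
    change (h * h ^ (d - 1)) with (h ^ S (d - 1)); replace (S (d - 1)) with d by lia.
    apply Rmult_le_compat_l; [lra|exact shape_regular]. }
  assert (F0 : 0 <= h * jac d (d - 1) (facet a j)) by (apply Rmult_le_pos; [exact h0|apply sqrt_pos]).
  rewrite <- Rmult_assoc.
  apply Rle_trans with (3 * (sigma * jac d d a) * (3 * ((INR k + 2) ^ 2 * J))); [|right; ring].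
  apply Rmult_le_compat; assumption.
Qed.

(** Cramer's rule and the factor [h ^ 2] combine to [(h ^ d / jac) ^ 2], at most [sigma ^ 2]. The
    constant rounds up [12 * 3 * 4096], with at most three edge derivatives and [4096 = 16 * 4 ^ 4]
    since a simplex has at most four vertices. *)
Lemma gradient_inverse_inequality k q l : pol d k q ->
  h ^ 2 * int_simplex d d a (fun x => pd l q x ^ 2) <=
  150000 * sigma ^ 2 * (INR k + 2) ^ 4 * int_simplex d d a (fun x => q x ^ 2).
Proof.
  intros Hq; unfold int_simplex.
  set (J := refint d 1 (fun t => q (affine d a t) ^ 2)).
  set (D := fun i t => dird d (edge a (S i) 0) q (affine d a t) ^ 2).
  assert (h0 : 0 <= h) by apply maxR_ge0.
  assert (J0 : 0 <= J).
  { apply (refint_ge0 _ (k + k)); [apply pol_sqr, (pol_affine d), Hq|intros; apply pow2_ge_0]. }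
  assert (Hpd := pol_pd d k l q Hq).
  assert (PD : forall i, pol d (k + k) (D i)).
  { intros; apply pol_sqr, (pol_affine d), pol_dird, Hq. }
  assert (PS : pol d (k + k) (fun t => sumR d (fun i => D i t))) by (apply pol_sumR; auto).
  assert (M : forall i, (i < d)%nat -> refint d 1 (D i) <= 4096 * (INR k + 2) ^ 4 * J).
  { intros i Hi; assert (Ed : S (d - 1) = d) by lia.
    assert (M := markov_ref d (d - 1) k (S i) a q Hq); rewrite Ed in M.
    eapply Rle_trans; [apply M; lia|]; fold J.
    apply Rmult_le_compat_r; [exact J0|].
    apply Rmult_le_compat_r; [apply pow_le; generalize (pos_INR k); lra|].
    destruct d_23 as [-> | ->]; simpl; lra. }
  assert (K : h ^ 2 * refint d 1 (fun t => pd l q (affine d a t) ^ 2) <=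
     12 * sigma ^ 2 * refint d 1 (fun t => sumR d (fun i => D i t))).
  { rewrite <- (refint_scal d (k + k)), <- (refint_scal d (k + k)); [|exact PS|apply pol_sqr, (pol_affine d), Hpd].
    apply (refint_le d (k + k) (k + k)).
    - apply pol_scal, pol_sqr, (pol_affine d), Hpd.
    - apply pol_scal, PS.
    - intros t _; assert (G := gradient_le d a k q l (affine d a t) d_23 Hq); fold h in G.
      change (sumR d (fun i => dird d (edge a (S i) 0) q (affine d a t) ^ 2)) with (sumR d (fun i => D i t)) in G.
      set (SD := sumR d (fun i => D i t)) in *; set (g2 := pd l q (affine d a t) ^ 2) in *.
      assert (SD0 : 0 <= SD).
      { unfold SD; rewrite <- (sumR_zero d (fun _ => 0)) by reflexivity; apply sumR_le; intros; apply pow2_ge_0. }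
      apply (Rmult_le_reg_l (jac d d a ^ 2)); [apply pow_lt, jac_gt0|].
      apply Rle_trans with (h ^ 2 * (12 * (h ^ (d - 1)) ^ 2 * SD)).
      { replace (jac d d a ^ 2 * (h ^ 2 * g2)) with (h ^ 2 * (jac d d a ^ 2 * g2)) by ring.
        apply Rmult_le_compat_l; [apply pow2_ge_0|exact G]. }
      replace (h ^ 2 * (12 * (h ^ (d - 1)) ^ 2 * SD)) with (12 * (h * h ^ (d - 1)) ^ 2 * SD) by ring.
      change (h * h ^ (d - 1)) with (h ^ S (d - 1)); replace (S (d - 1)) with d by lia.
      apply Rle_trans with (12 * (sigma * jac d d a) ^ 2 * SD); [|right; ring].
      apply Rmult_le_compat_r; [exact SD0|]; apply Rmult_le_compat_l; [lra|].
      apply pow_incr; split; [apply pow_le, h0|exact shape_regular]. }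
  assert (L : refint d 1 (fun t => sumR d (fun i => D i t)) <= 3 * (4096 * (INR k + 2) ^ 4 * J)).
  { rewrite (refint_sumR d (k + k)) by auto.
    apply Rle_trans with (sumR d (fun _ => 4096 * (INR k + 2) ^ 4 * J)); [apply sumR_le, M|].
    rewrite sumR_cst; apply Rmult_le_compat_r.
    - apply Rmult_le_pos; [|exact J0]; apply Rmult_le_pos; [lra|].
      apply pow_le; generalize (pos_INR k); lra.
    - destruct d_23 as [-> | ->]; simpl; lra. }
  set (g := refint d 1 (fun t => pd l q (affine d a t) ^ 2)) in *.
  assert (s0 : 0 <= sigma ^ 2) by apply pow2_ge_0.
  assert (N0 : 0 <= (INR k + 2) ^ 4 * J).
  { apply Rmult_le_pos; [apply pow_le; generalize (pos_INR k); lra|exact J0]. }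
  apply Rle_trans with (jac d d a * (12 * sigma ^ 2 * (3 * (4096 * (INR k + 2) ^ 4 * J)))).
  - replace (h ^ 2 * (jac d d a * g)) with (jac d d a * (h ^ 2 * g)) by ring.
    apply Rmult_le_compat_l; [lra|]; eapply Rle_trans; [exact K|].
    apply Rmult_le_compat_l; [lra|exact L].
  - assert (0 <= jac d d a * (sigma ^ 2 * ((INR k + 2) ^ 4 * J))).
    { apply Rmult_le_pos; [lra|apply Rmult_le_pos; assumption]. }
    lra.
Qed.
End Element.

(** * Coercivity *)

Lemma int_simplex_le d m a k l f g : pol d k f -> pol d l g -> (forall x, f x <= g x) ->
  int_simplex d m a f <= int_simplex d m a g.
Proof.
  intros Hf Hg H; apply Rmult_le_compat_l; [apply sqrt_pos|].
  apply (refint_le m k l); [apply (pol_affine d); exact Hf|apply (pol_affine d); exact Hg|auto].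
Qed.

Lemma int_simplex_plus d m a k l f g : pol d k f -> pol d l g ->
  int_simplex d m a (fun x => f x + g x) = int_simplex d m a f + int_simplex d m a g.
Proof.
  intros Hf Hg; unfold int_simplex.
  rewrite (refint_plus m k l (fun t => f (affine m a t)) (fun t => g (affine m a t))
    (pol_affine d m k a f Hf) (pol_affine d m l a g Hg)); ring.
Qed.

Lemma int_simplex_scal d m a k c f : pol d k f ->
  int_simplex d m a (fun x => c * f x) = c * int_simplex d m a f.
Proof.
  intros Hf; unfold int_simplex.
  rewrite (refint_scal m k c (fun t => f (affine m a t)) (pol_affine d m k a f Hf)); ring.
Qed.

Lemma int_simplex_ge0 d m a k f : pol d k f -> (forall x, 0 <= f x) -> 0 <= int_simplex d m a f.
Proof.
  intros Hf H; apply Rmult_le_pos; [apply sqrt_pos|].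
  apply (refint_ge0 m k); [apply (pol_affine d); exact Hf|auto].
Qed.

Lemma sum_list_app l l' : sum_list (l ++ l') = sum_list l + sum_list l'.
Proof. induction l as [|x l IH]; simpl; [|rewrite IH]; ring. Qed.

Lemma sum_list_seq n f : sum_list (map f (seq 0 n)) = sumR n f.
Proof.
  induction n as [|n IH]; [reflexivity|].
  rewrite seq_S, map_app, sum_list_app, IH; simpl; ring.
Qed.

Lemma sum_list_le {A : Type} (f g : A -> R) l : (forall x, In x l -> f x <= g x) ->
  sum_list (map f l) <= sum_list (map g l).
Proof.
  induction l as [|x l IH]; intros H; simpl; [lra|].
  apply Rplus_le_compat; [apply H; left; reflexivity|apply IH; intros; apply H; right; assumption].
Qed.

Lemma sum_list_lincomb {A : Type} a b (f g : A -> R) l :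
  sum_list (map (fun x => a * f x + b * g x) l) = a * sum_list (map f l) + b * sum_list (map g l).
Proof. induction l as [|x l IH]; simpl; [|rewrite IH]; ring. Qed.

(** * Polynomial vector fields and their curls *)

Definition pol_field (d k : nat) (F : field) : Prop := forall c, pol d k (fun x => F x c).

Lemma pol_field_le d k l F : (k <= l)%nat -> pol_field d k F -> pol_field d l F.
Proof. intros H HF c; apply pol_le with k; auto. Qed.

Lemma pol_field_curl d k F : pol_field d k F -> pol_field d k (curl F).
Proof.
  intros H [|[|[|c]]]; unfold curl; [apply pol_minus; apply pol_pd, H..|apply pol_cst].
Qed.

Lemma pol_field_curlk d k n F : pol_field d k F -> pol_field d k (curlk n F).
Proof. intros H; induction n as [|n IH]; [exact H|apply pol_field_curl, IH]. Qed.

Lemma pol_dot3 d k F G : pol_field d k F -> pol_field d k G ->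
  pol d (k + k) (fun x => dot3 (F x) (G x)).
Proof.
  intros HF HG; apply (pol_sumR d (k + k) 3 (fun i x => F x i * G x i)).
  intros i _; apply pol_mul; [apply HF|apply HG].
Qed.

Lemma dot3_self u : dot3 u u = u 0%nat ^ 2 + u 1%nat ^ 2 + u 2%nat ^ 2.
Proof. unfold dot3; simpl; ring. Qed.

Lemma dot3_ge0 u : 0 <= dot3 u u.
Proof.
  rewrite dot3_self; assert (H := pow2_ge_0 (u 0%nat)); assert (H1 := pow2_ge_0 (u 1%nat));
    assert (H2 := pow2_ge_0 (u 2%nat)); lra.
Qed.

Lemma int_dot3_self d m a k F : pol_field d k F ->
  int_simplex d m a (fun x => dot3 (F x) (F x)) = int_simplex d m a (fun x => F x 0%nat ^ 2) +
    int_simplex d m a (fun x => F x 1%nat ^ 2) + int_simplex d m a (fun x => F x 2%nat ^ 2).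
Proof.
  intros HF; assert (P : forall c, pol d (k + k) (fun x => F x c ^ 2)) by (intros; apply pol_sqr, HF).
  rewrite <- (int_simplex_plus d m a (k + k) (k + k)) by apply P.
  rewrite <- (int_simplex_plus d m a (k + k) (k + k)); [|apply pol_add; apply P|apply P].
  f_equal; apply functional_extensionality; intros x; apply dot3_self.
Qed.

Lemma curl_sq_le F x : dot3 (curl F x) (curl F x) <=
  2 * (pd 0 (comp F 1) x ^ 2 + pd 0 (comp F 2) x ^ 2 + (pd 1 (comp F 0) x ^ 2 + pd 1 (comp F 2) x ^ 2)
   + (pd 2 (comp F 0) x ^ 2 + pd 2 (comp F 1) x ^ 2)).
Proof.
  assert (M : forall s t : R, (s - t) ^ 2 <= 2 * (s ^ 2 + t ^ 2)).
  { intros s t; assert (0 <= (s + t) ^ 2) by apply pow2_ge_0; lra. }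
  rewrite dot3_self; unfold curl.
  assert (M1 := M (pd 1 (comp F 2) x) (pd 2 (comp F 1) x)).
  assert (M2 := M (pd 2 (comp F 0) x) (pd 0 (comp F 2) x)).
  assert (M3 := M (pd 0 (comp F 1) x) (pd 1 (comp F 0) x)).
  lra.
Qed.

(** Serves to sort the face pieces of an element by the facet containing them, so that packing
    applies facet by facet. A piece that fits several indices is assigned to one only, hence counted
    once. *)
Lemma sum_partition {A : Type} (P : nat -> A -> Prop) (Q : A -> A -> Prop) (V : A -> R) n l :
  List.Forall (fun f => exists j, (j < n)%nat /\ P j f) l -> ForallOrdPairs Q l ->
  exists Ls : nat -> list A, (forall j, incl (Ls j) l /\ List.Forall (P j) (Ls j) /\ ForallOrdPairs Q (Ls j)) /\
    sum_list (map V l) = sumR n (fun j => sum_list (map V (Ls j))).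
Proof.
  intros Hl; induction Hl as [|f l (j & Hj & HP) Hl IH]; intros Hd.
  - exists (fun _ => nil); split; [|symmetry; apply sumR_zero; reflexivity].
    intros j; split; [intros x []|split; constructor].
  - inversion Hd as [|? ? Hd1 Hd2]; subst.
    destruct (IH Hd2) as (Ls & H1 & H2).
    exists (fun i => if (i =? j)%nat then f :: Ls i else Ls i); split.
    + intros i; destruct (H1 i) as (I1 & I2 & I3); destruct (Nat.eqb_spec i j) as [->|Hne].
      * split; [|split; constructor; auto].
        { intros x [<-|Hx]; [left; reflexivity|right; apply I1, Hx]. }
        apply Forall_forall; intros x Hx; rewrite Forall_forall in Hd1; apply Hd1, I1, Hx.
      * split; [|split; assumption]; intros x Hx; right; apply I1, Hx.
    + simpl; rewrite H2.
      rewrite (sumR_ext n (fun i => sum_list (map V (if (i =? j)%nat then f :: Ls i else Ls i)))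
        (fun i => (if (i =? j)%nat then V f else 0) + sum_list (map V (Ls i)))).
      * rewrite sumR_plus, (sumR_single n j (fun i => if (i =? j)%nat then V f else 0)); auto.
        { rewrite Nat.eqb_refl; reflexivity. }
        intros i _ Hne; destruct (Nat.eqb_spec i j); [congruence|reflexivity].
      * intros i _; destruct (i =? j)%nat; simpl; ring.
Qed.

Section ElementFields.
Variables (d : nat) (a : nat -> pt) (sigma : R) (k : nat) (F : field).
Hypothesis d_23 : (d = 2 \/ d = 3)%nat.
Hypothesis jac_gt0 : 0 < jac d d a.
Hypothesis shape_regular : diam d d a ^ d <= sigma * jac d d a.
Hypothesis F_pol : pol_field d k F.
Let h := diam d d a.

Lemma facet_inverse_field j : (j <= d)%nat ->
  h * int_simplex d (d - 1) (facet a j) (fun x => dot3 (F x) (F x)) <=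
  9 * sigma * (INR k + 2) ^ 2 * int_simplex d d a (fun x => dot3 (F x) (F x)).
Proof.
  intros Hj; rewrite !(int_dot3_self d _ _ k F F_pol), !Rmult_plus_distr_l.
  repeat apply Rplus_le_compat;
    apply (facet_inverse_inequality d a sigma d_23 jac_gt0 shape_regular k (fun x => F x _) j (F_pol _) Hj).
Qed.

(** [600000 = 4 * 150000]: the curl differentiates each component in two directions, and squaring a
    difference costs another [2]. *)
Lemma curl_inverse_field :
  h ^ 2 * int_simplex d d a (fun x => dot3 (curl F x) (curl F x)) <=
  600000 * sigma ^ 2 * (INR k + 2) ^ 4 * int_simplex d d a (fun x => dot3 (F x) (F x)).
Proof.
  assert (Q : forall l c, pol d (k + k) (fun x => pd l (comp F c) x ^ 2)).
  { intros; apply pol_sqr, pol_pd, (F_pol c). }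
  assert (B : forall l c, h ^ 2 * int_simplex d d a (fun x => pd l (comp F c) x ^ 2) <=
    150000 * sigma ^ 2 * (INR k + 2) ^ 4 * int_simplex d d a (fun x => F x c ^ 2)).
  { intros l c; apply (gradient_inverse_inequality d a sigma d_23 jac_gt0 shape_regular k (fun x => F x c) l).
    apply F_pol. }
  apply Rle_trans with (h ^ 2 * int_simplex d d a (fun x =>
    2 * (pd 0 (comp F 1) x ^ 2 + pd 0 (comp F 2) x ^ 2 + (pd 1 (comp F 0) x ^ 2 + pd 1 (comp F 2) x ^ 2)
   + (pd 2 (comp F 0) x ^ 2 + pd 2 (comp F 1) x ^ 2)))).
  { apply Rmult_le_compat_l; [apply pow2_ge_0|].
    apply (int_simplex_le d d a (k + k) (k + k)); [|apply pol_scal; repeat apply pol_add; apply Q|].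
    - apply pol_dot3; apply pol_field_curl, F_pol.
    - intros; apply curl_sq_le. }
  rewrite (int_simplex_scal d d a (k + k)); [|repeat apply pol_add; apply Q].
  rewrite !(int_simplex_plus d d a (k + k) (k + k)); try (repeat apply pol_add; apply Q).
  rewrite (int_dot3_self d _ _ k F F_pol).
  assert (B01 := B 0%nat 1%nat); assert (B02 := B 0%nat 2%nat); assert (B10 := B 1%nat 0%nat).
  assert (B12 := B 1%nat 2%nat); assert (B20 := B 2%nat 0%nat); assert (B21 := B 2%nat 1%nat).
  lra.
Qed.

(** The number of pieces does not enter: after packing only the at most four facets are counted,
    whence [36 = 4 * 9]. *)
Lemma boundary_inverse_field (l : list face) :
  List.Forall (fun f => 0 < jac d (d - 1) (fverts f) /\ exists j, (j <= d)%nat /\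
    forall i, (i < d)%nat -> in_simplex false d (d - 1) (facet a j) (fverts f i)) l ->
  ForallOrdPairs (fun f f' => ~ exists x, in_simplex true d (d - 1) (fverts f) x /\
    in_simplex true d (d - 1) (fverts f') x) l ->
  h * sum_list (map (fun f => int_f d f (fun x => dot3 (F x) (F x))) l) <=
  36 * sigma * (INR k + 2) ^ 2 * int_simplex d d a (fun x => dot3 (F x) (F x)).
Proof.
  intros Hl Hd.
  set (P := fun j f => 0 < jac d (d - 1) (fverts f) /\
      forall i, (i < d)%nat -> in_simplex false d (d - 1) (facet a j) (fverts f i)).
  assert (HP : List.Forall (fun f => exists j, (j < S d)%nat /\ P j f) l).
  { eapply Forall_impl; [|exact Hl]; intros f (H1 & j & Hj & H2); exists j; split; [lia|split; auto]. }
  destruct (sum_partition P _ (fun f => int_f d f (fun x => dot3 (F x) (F x))) (S d) l HP Hd)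
    as (Ls & H1 & ->).
  set (N := int_simplex d d a (fun x => dot3 (F x) (F x))).
  set (C := 9 * sigma * (INR k + 2) ^ 2 * N).
  assert (h0 : 0 <= h) by apply maxR_ge0.
  assert (Hj : forall j, (j <= d)%nat ->
    h * sum_list (map (fun f => int_f d f (fun x => dot3 (F x) (F x))) (Ls j)) <= C).
  { intros j Hj; destruct (H1 j) as (_ & I2 & I3).
    eapply Rle_trans; [|apply (facet_inverse_field j Hj)].
    apply Rmult_le_compat_l; [exact h0|].
    apply (packing d fverts (Ls j) (facet a j) (k + k) (fun x => dot3 (F x) (F x)) d_23); auto.
    - apply pol_dot3; exact F_pol.
    - intros; apply dot3_ge0. }
  assert (N0 : 0 <= N).
  { apply (int_simplex_ge0 d d a (k + k)); [apply pol_dot3; exact F_pol|intros; apply dot3_ge0]. }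
  assert (s0 : 0 <= sigma).
  { destruct (Rle_or_lt 0 sigma) as [|Hs]; [assumption|exfalso].
    assert (0 <= diam d d a ^ d) by (apply pow_le, maxR_ge0).
    assert (sigma * jac d d a < 0 * jac d d a) by (apply Rmult_lt_compat_r; assumption).
    lra. }
  assert (C0 : 0 <= C).
  { unfold C; apply Rmult_le_pos; [|exact N0]; apply Rmult_le_pos; [lra|apply pow2_ge_0]. }
  rewrite <- sumR_scal; apply Rle_trans with (sumR (S d) (fun _ => C)).
  - apply sumR_le; intros j Hj'; apply Hj; lia.
  - rewrite sumR_cst; apply Rle_trans with (4 * C); [|unfold C; lra].
    apply Rmult_le_compat_r; [exact C0|].
    destruct d_23 as [-> | ->]; simpl; lra.
Qed.
End ElementFields.

Lemma diam_gt0 d a : (d = 2 \/ d = 3)%nat -> 0 < jac d d a -> 0 < diam d d a.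
Proof.
  intros Hd HJ; assert (h0 : 0 <= diam d d a) by apply maxR_ge0.
  destruct (Rle_lt_or_eq_dec _ _ h0) as [|Z]; [assumption|exfalso].
  assert (E : forall i l, (i <= d)%nat -> (l < d)%nat -> edge a i 0 l = 0).
  { intros i l Hi Hl; assert (B := edge_le_diam d d a i 0 l Hi ltac:(lia) Hl).
    rewrite <- Z in B; destruct (Req_dec (edge a i 0 l) 0) as [|H]; [assumption|].
    apply Rabs_pos_lt in H; lra. }
  destruct Hd as [-> | ->].
  - rewrite jac22 in HJ; unfold det_edges2 in HJ; rewrite !E in HJ by lia.
    replace (0 * 0 - 0 * 0) with 0 in HJ by ring; rewrite Rabs_R0 in HJ; lra.
  - rewrite jac33 in HJ; unfold det_edges3 in HJ; rewrite !E in HJ by lia.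
    match type of HJ with 0 < Rabs ?e => replace e with 0 in HJ by ring end.
    rewrite Rabs_R0 in HJ; lra.
Qed.

Definition adjb (k : nat) (f : face) : bool :=
  (fplus f =? k)%nat || match fminus f with Some m => (m =? k)%nat | None => false end.

Lemma adjb_spec k f : adjb k f = true -> adjacent f k.
Proof.
  unfold adjb, adjacent; intros H; apply Bool.orb_true_iff in H.
  destruct H as [H|H]; [left; apply Nat.eqb_eq, H|right].
  destruct (fminus f) as [m|]; [|discriminate]; apply Nat.eqb_eq in H; congruence.
Qed.

Definition adj_sum (U : nat -> face -> R) (f : face) : R :=
  U (fplus f) f + match fminus f with Some m => U m f | None => 0 end.

(** Double counting of incidences between faces and elements. The two neighbours must differ:
    [filter] sees a face once per element, while [adj_sum] adds both sides. *)
Lemma adj_sum_exchange N U Eh : (forall f, In f Eh -> (fplus f < N)%nat /\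
    forall m, fminus f = Some m -> (m < N)%nat /\ m <> fplus f) ->
  sum_list (map (adj_sum U) Eh) =
  sumR N (fun k => sum_list (map (U k) (filter (adjb k) Eh))).
Proof.
  induction Eh as [|f Eh IH]; intros H; simpl.
  { symmetry; apply sumR_zero; reflexivity. }
  rewrite IH by (intros; apply H; right; assumption).
  destruct (H f (or_introl eq_refl)) as [H1 H2].
  transitivity (sumR N (fun k => ((if (k =? fplus f)%nat then U k f else 0) +
     match fminus f with Some m => if (k =? m)%nat then U k f else 0 | None => 0 end) +
     sum_list (map (U k) (filter (adjb k) Eh)))).
  - rewrite sumR_plus, sumR_plus; f_equal; unfold adj_sum; f_equal; symmetry.
    + rewrite (sumR_single N (fplus f)); [rewrite Nat.eqb_refl; reflexivity|exact H1|].
      intros j _ Hj; destruct (Nat.eqb_spec j (fplus f)); [congruence|reflexivity].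
    + destruct (fminus f) as [m|]; [|apply sumR_zero; reflexivity].
      rewrite (sumR_single N m); [rewrite Nat.eqb_refl; reflexivity|apply H2; reflexivity|].
      intros j _ Hj; destruct (Nat.eqb_spec j m); [congruence|reflexivity].
  - apply sumR_ext; intros k _; unfold adjb at 2; rewrite (Nat.eqb_sym (fplus f) k).
    destruct (fminus f) as [m|].
    + destruct (H2 m eq_refl) as [_ H3]; rewrite (Nat.eqb_sym m k).
      destruct (Nat.eqb_spec k (fplus f)), (Nat.eqb_spec k m); simpl; try ring; congruence.
    + destruct (Nat.eqb_spec k (fplus f)); simpl; ring.
Qed.

Lemma ForallOrdPairs_nth {A : Type} (P : A -> A -> Prop) (x0 : A) l :
  (forall i i', (i < length l)%nat -> (i' < length l)%nat -> i <> i' -> P (nth i l x0) (nth i' l x0)) ->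
  ForallOrdPairs P l.
Proof.
  induction l as [|x l IH]; intros H; constructor.
  - apply Forall_forall; intros y Hy; destruct (In_nth l y x0 Hy) as (n & Hn & <-).
    apply (H 0%nat (S n)); simpl; lia.
  - apply IH; intros i i' Hi Hi' Hne; apply (H (S i) (S i')); simpl; lia.
Qed.

Lemma ForallOrdPairs_filter {A : Type} (P : A -> A -> Prop) b l :
  ForallOrdPairs P l -> ForallOrdPairs P (filter b l).
Proof.
  induction 1 as [|x l H1 H2 IH]; simpl; [constructor|].
  destruct (b x); [|exact IH]; constructor; [|exact IH].
  apply Forall_forall; intros y Hy; apply filter_In in Hy; rewrite Forall_forall in H1; apply H1, Hy.
Qed.

(** * Estimates on a regular mesh *)

Section Mesh.
Variables (d : nat) (s : R) (Th : list element) (Eh : list face).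
Hypothesis d_23 : (d = 2 \/ d = 3)%nat.
Hypothesis s_ge1 : 1 <= s.
Hypothesis Th_ok : mesh_ok d Th Eh.
Hypothesis Th_regular : mesh_regular d s Th Eh.
Hypothesis degree_ge2 : forall k, (k < length Th)%nat -> (2 <= edeg (elt Th k))%nat.

Let h k := hK d (elt Th k).
Let p k := INR (edeg (elt Th k)).

Lemma h_gt0 k : (k < length Th)%nat -> 0 < h k.
Proof. intros Hk; apply diam_gt0; [exact d_23|]; apply Th_ok, Hk. Qed.

Lemma p_ge2 k : (k < length Th)%nat -> 2 <= p k.
Proof. intros Hk; change 2 with (INR 2); apply le_INR, degree_ge2, Hk. Qed.

Lemma face_elements f : In f Eh -> (fplus f < length Th)%nat /\
  forall m, fminus f = Some m -> (m < length Th)%nat /\ m <> fplus f.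
Proof.
  intros Hf; destruct Th_ok as (_ & _ & H & _); destruct (H f Hf) as (_ & H1 & H2 & _); auto.
Qed.

Lemma adjacent_lt f k : In f Eh -> adjacent f k -> (k < length Th)%nat.
Proof.
  intros Hf Hk; destruct (face_elements f Hf) as [H1 H2]; destruct Hk as [<-|Hk]; [exact H1|].
  apply (H2 k Hk).
Qed.

(** The two upper bounds are the directions needed to replace the weights [h_f ^ n / p_f ^ m] by
    those of either neighbour. [1 <= s] covers the case where the maximum or minimum is attained at
    [k] itself. *)
Lemma face_scales f k : In f Eh -> adjacent f k ->
  0 < h_f d Th f /\ h_f d Th f <= s * h k /\ 0 < p_f Th f /\ p k <= s * p_f Th f.
Proof.
  intros Hf Hk; destruct (face_elements f Hf) as [H1 H2].
  assert (hp := h_gt0 _ H1); assert (pp := p_ge2 _ H1).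
  destruct Th_regular as [_ Hreg]; specialize (Hreg f).
  unfold h_f, p_f, adjacent in *; destruct (fminus f) as [m|].
  - destruct (H2 m eq_refl) as [Hm _]; assert (hm := h_gt0 _ Hm); assert (pm := p_ge2 _ Hm).
    destruct (Hreg m Hf eq_refl) as (R1 & R2 & R3 & R4).
    fold (h (fplus f)) (h m) in *; fold (p (fplus f)) (p m) in *.
    assert (hp' : h (fplus f) <= s * h (fplus f)) by nra.
    assert (hm' : h m <= s * h m) by nra.
    assert (pp' : p (fplus f) <= s * p (fplus f)) by nra.
    assert (pm' : p m <= s * p m) by nra.
    assert (Hmin : INR (Nat.min (edeg (elt Th (fplus f))) (edeg (elt Th m))) = p (fplus f) \/
      INR (Nat.min (edeg (elt Th (fplus f))) (edeg (elt Th m))) = p m).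
    { destruct (Nat.min_spec (edeg (elt Th (fplus f))) (edeg (elt Th m))) as [[_ ->]|[_ ->]]; auto. }
    assert (Hmax : h (fplus f) <= Rmax (h (fplus f)) (h m)) by apply Rmax_l.
    split; [lra|].
    assert (Hk' : k = fplus f \/ k = m) by (destruct Hk as [Hk|Hk]; [left|right]; congruence).
    split; [apply Rmax_lub; destruct Hk' as [->| ->]; lra|].
    split; [destruct Hmin as [-> | ->]; lra|].
    destruct Hmin as [-> | ->], Hk' as [-> | ->]; lra.
  - destruct Hk as [<-|Hk]; [|discriminate].
    fold (h (fplus f)) in *; fold (p (fplus f)) in *.
    repeat split; try lra; nra.
Qed.

Lemma weight_le (hf hk pf pk : R) n m : 0 < hf -> hf <= s * hk -> 0 < pf -> 0 < pk -> pk <= s * pf ->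
  hf ^ n / pf ^ m <= s ^ (n + m) * (hk ^ n / pk ^ m).
Proof.
  intros Hhf Hh Hpf Hpk Hp.
  assert (E : / pf <= s * / pk).
  { apply (Rmult_le_reg_r (pf * pk)); [apply Rmult_lt_0_compat; assumption|].
    replace (/ pf * (pf * pk)) with pk by (field; lra).
    replace (s * / pk * (pf * pk)) with (s * pf) by (field; lra); exact Hp. }
  replace (hf ^ n / pf ^ m) with (hf ^ n * (/ pf) ^ m) by (unfold Rdiv; rewrite pow_inv; reflexivity).
  replace (s ^ (n + m) * (hk ^ n / pk ^ m)) with ((s * hk) ^ n * (s * / pk) ^ m).
  2:{ unfold Rdiv; rewrite !Rpow_mult_distr, pow_inv, pow_add; ring. }
  assert (0 < / pf) by (apply Rinv_0_lt_compat; assumption).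
  apply Rmult_le_compat; try (apply pow_le; lra); apply pow_incr; lra.
Qed.

Variable v : dgfun.
Hypothesis v_Vh : in_Vh d Th v.

Lemma Vh_pol_field k n : (k < length Th)%nat -> pol_field d (edeg (elt Th k)) (curlk n (v k)).
Proof.
  intros Hk; apply pol_field_curlk; intros c; destruct (v_Vh k Hk) as [H1 H2].
  destruct (le_lt_dec d c) as [Hc|Hc].
  - apply (pol_ext _ _ (fun _ => 0)); [intros x; symmetry; apply H2, Hc|apply pol_cst].
  - apply is_poly_pol, (H1 c Hc).
Qed.

Let W n k f := int_f d f (fun x => dot3 (curlk n (v k) x) (curlk n (v k) x)).
Let N2 k := int_K d Th k (fun x => dot3 (curlk 2 (v k) x) (curlk 2 (v k) x)).

Lemma N2_ge0 k : (k < length Th)%nat -> 0 <= N2 k.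
Proof.
  intros Hk; assert (P := Vh_pol_field k 2 Hk).
  eapply int_simplex_ge0; [apply pol_dot3; exact P|intros; apply dot3_ge0].
Qed.

Lemma element_boundary_sum n k : (k < length Th)%nat ->
  h k * sum_list (map (W n k) (filter (adjb k) Eh)) <=
  36 * s * (p k + 2) ^ 2 * int_K d Th k (fun x => dot3 (curlk n (v k) x) (curlk n (v k) x)).
Proof.
  intros Hk; destruct Th_ok as (J & _ & HF & HD & _); destruct Th_regular as [SR _].
  apply (boundary_inverse_field d (everts (elt Th k)) s (edeg (elt Th k)) (curlk n (v k)) d_23
    (J k Hk) (SR k Hk) (Vh_pol_field k n Hk)).
  - apply Forall_forall; intros f Hf; apply filter_In in Hf; destruct Hf as [Hf Ha].
    destruct (HF f Hf) as (Jf & _ & _ & HA & _); split; [exact Jf|apply HA, adjb_spec, Ha].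
  - apply ForallOrdPairs_filter.
    apply (ForallOrdPairs_nth _ (mkFace (fun _ _ => 0) 0 None (fun _ => 0))); exact HD.
Qed.

(** Degree at least two gives [p + 2 <= 2 p], which turns the shifted degrees of the inverse
    inequalities into pure powers of [p]. *)
Lemma p_shift k n : (k < length Th)%nat -> (p k + 2) ^ n / p k ^ n <= 2 ^ n.
Proof.
  intros Hk; assert (P := p_ge2 k Hk).
  apply (Rmult_le_reg_r (p k ^ n)); [apply pow_lt; lra|].
  unfold Rdiv; rewrite Rmult_assoc, Rinv_l, Rmult_1_r by (apply pow_nonzero; lra).
  rewrite <- Rpow_mult_distr; apply pow_incr; lra.
Qed.

Lemma curl2_boundary_sum k : (k < length Th)%nat ->
  h k / p k ^ 2 * sum_list (map (W 2 k) (filter (adjb k) Eh)) <= 144 * s * N2 k.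
Proof.
  intros Hk; assert (P := p_ge2 k Hk); assert (E := element_boundary_sum 2 k Hk).
  assert (T := p_shift k 2 Hk); fold (N2 k) in E.
  assert (I0 : 0 <= / p k ^ 2) by (left; apply Rinv_0_lt_compat, pow_lt; lra).
  apply Rle_trans with (/ p k ^ 2 * (36 * s * (p k + 2) ^ 2 * N2 k)).
  - unfold Rdiv; rewrite (Rmult_comm (h k)), Rmult_assoc; apply Rmult_le_compat_l; assumption.
  - replace (/ p k ^ 2 * (36 * s * (p k + 2) ^ 2 * N2 k)) with
      ((p k + 2) ^ 2 / p k ^ 2 * (36 * s * N2 k)) by (unfold Rdiv; ring).
    replace (144 * s * N2 k) with (2 ^ 2 * (36 * s * N2 k)) by ring.
    apply Rmult_le_compat_r; [|exact T].
    apply Rmult_le_pos; [lra|apply N2_ge0, Hk].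
Qed.

(** The weight factors as [h / p ^ 2] for the trace of [curl^3 v] and [h ^ 2 / p ^ 4] for the
    inverse inequality that bounds it by [curl^2 v] on the element. The constant is
    [36 * 600000 * 2 ^ 6]. *)
Lemma curl3_boundary_sum k : (k < length Th)%nat ->
  h k ^ 3 / p k ^ 6 * sum_list (map (W 3 k) (filter (adjb k) Eh)) <= 1382400000 * s ^ 3 * N2 k.
Proof.
  intros Hk; assert (P := p_ge2 k Hk); assert (E := element_boundary_sum 3 k Hk).
  assert (hk := h_gt0 k Hk).
  assert (T := p_shift k 6 Hk).
  destruct Th_ok as (J & _); destruct Th_regular as [SR _].
  assert (C := curl_inverse_field d (everts (elt Th k)) s (edeg (elt Th k)) (curlk 2 (v k)) d_23
    (J k Hk) (SR k Hk) (Vh_pol_field k 2 Hk)).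
  change (h k ^ 2 * int_K d Th k (fun x => dot3 (curlk 3 (v k) x) (curlk 3 (v k) x)) <=
    600000 * s ^ 2 * (p k + 2) ^ 4 * N2 k) in C.
  set (N3 := int_K d Th k (fun x => dot3 (curlk 3 (v k) x) (curlk 3 (v k) x))) in *.
  set (Z := sum_list (map (W 3 k) (filter (adjb k) Eh))) in *.
  assert (I0 : 0 <= / p k ^ 6) by (left; apply Rinv_0_lt_compat, pow_lt; lra).
  apply Rle_trans with (/ p k ^ 6 * (h k ^ 2 * (36 * s * (p k + 2) ^ 2 * N3))).
  { replace (h k ^ 3 / p k ^ 6 * Z) with (/ p k ^ 6 * (h k ^ 2 * (h k * Z))) by (unfold Rdiv; ring).
    apply Rmult_le_compat_l; [exact I0|]; apply Rmult_le_compat_l; [apply pow2_ge_0|exact E]. }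
  apply Rle_trans with (/ p k ^ 6 * (36 * s * (p k + 2) ^ 2 * (600000 * s ^ 2 * (p k + 2) ^ 4 * N2 k))).
  { apply Rmult_le_compat_l; [exact I0|].
    replace (h k ^ 2 * (36 * s * (p k + 2) ^ 2 * N3)) with (36 * s * (p k + 2) ^ 2 * (h k ^ 2 * N3)) by ring.
    apply Rmult_le_compat_l; [|exact C]; apply Rmult_le_pos; [lra|apply pow2_ge_0]. }
  replace (/ p k ^ 6 * (36 * s * (p k + 2) ^ 2 * (600000 * s ^ 2 * (p k + 2) ^ 4 * N2 k))) with
    ((p k + 2) ^ 6 / p k ^ 6 * (21600000 * s ^ 3 * N2 k)) by (unfold Rdiv; ring).
  replace (1382400000 * s ^ 3 * N2 k) with (2 ^ 6 * (21600000 * s ^ 3 * N2 k)) by ring.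
  apply Rmult_le_compat_r; [|exact T].
  apply Rmult_le_pos; [|apply N2_ge0, Hk].
  apply Rmult_le_pos; [lra|apply pow_le; lra].
Qed.

Let C2 f := h_f d Th f / p_f Th f ^ 2 *
  int_f d f (fun x => dot3 (avg (curlh 2 v) f x) (avg (curlh 2 v) f x)).
Let C3 f := h_f d Th f ^ 3 / p_f Th f ^ 6 *
  int_f d f (fun x => dot3 (avg (curlh 3 v) f x) (avg (curlh 3 v) f x)).

(** The neighbours may have different degrees; the sum of the degrees is a common bound. It never
    enters a constant and only makes the integrals over the face linear and monotone. *)
Lemma face_pol_fields f : In f Eh -> exists N,
  (forall n k, adjacent f k -> pol_field d N (curlk n (v k))) /\
  (forall n, pol_field d N (avg (curlh n v) f)) /\ (forall n, pol_field d N (jump (curlh n v) f)).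
Proof.
  intros Hf; destruct (face_elements f Hf) as [H1 H2].
  set (N := (edeg (elt Th (fplus f)) + match fminus f with Some m => edeg (elt Th m) | None => 0 end)%nat).
  exists N.
  assert (A : forall n k, adjacent f k -> pol_field d N (curlk n (v k))).
  { intros n k Hk; apply pol_field_le with (edeg (elt Th k)).
    - destruct Hk as [<-|Hk]; unfold N; [lia|rewrite Hk; lia].
    - apply Vh_pol_field, (adjacent_lt f); assumption. }
  assert (Cr : forall F w, pol_field d N F -> pol_field d N (fun x => cross (F x) w)).
  { intros F w HF; intros [|[|[|c]]]; unfold cross; [..|apply pol_cst];
    eapply pol_ext; try (apply (pol_minus d N); apply (pol_scal d N); apply HF);
    intros x; cbv beta; [rewrite (Rmult_comm (w 2%nat)), (Rmult_comm (w 1%nat)); reflexivity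
    |rewrite (Rmult_comm (w 0%nat)), (Rmult_comm (w 2%nat)); reflexivity
    |rewrite (Rmult_comm (w 1%nat)), (Rmult_comm (w 0%nat)); reflexivity]. }
  split; [exact A|split]; intros n.
  - assert (Ap := A n _ (or_introl eq_refl)); unfold avg.
    destruct (fminus f) as [m|] eqn:Em; [|exact Ap].
    assert (Am := A n m (or_intror Em)); intros c; unfold vscal, vadd, curlh.
    apply (pol_scal d N (1 / 2)), pol_add; [apply Ap|apply Am].
  - assert (Ap := A n _ (or_introl eq_refl)); unfold jump.
    destruct (fminus f) as [m|] eqn:Em; [|apply (Cr _ _ Ap)].
    assert (Am := A n m (or_intror Em)); intros c; unfold vadd, curlh.
    apply (pol_add d N); [apply (Cr _ _ Ap)|apply (Cr _ _ Am)].
Qed.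

Lemma avg_le f n : In f Eh ->
  int_f d f (fun x => dot3 (avg (curlh n v) f x) (avg (curlh n v) f x)) <= adj_sum (W n) f.
Proof.
  intros Hf; destruct (face_pol_fields f Hf) as (N & A & B & _); specialize (B n).
  assert (Ap := A n _ (or_introl eq_refl)); revert B; unfold adj_sum, avg, W.
  destruct (fminus f) as [m|] eqn:Em; intros B; [|rewrite Rplus_0_r; apply Rle_refl].
  assert (Am := A n m (or_intror Em)).
  unfold int_f; rewrite <- (int_simplex_plus d _ _ (N + N) (N + N)); [|apply pol_dot3; assumption..].
  apply (int_simplex_le d _ _ (N + N) (N + N)).
  - apply pol_dot3; exact B.
  - apply pol_add; apply pol_dot3; assumption.
  - intros x; rewrite !dot3_self; unfold vscal, vadd, curlh.
    assert (M : forall u w : R, (1 / 2 * (u + w)) ^ 2 <= u ^ 2 + w ^ 2).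
    { intros u w; assert (0 <= (u - w) ^ 2) by apply pow2_ge_0.
      assert (0 <= u ^ 2) by apply pow2_ge_0; assert (0 <= w ^ 2) by apply pow2_ge_0; lra. }
    assert (M0 := M (curlk n (v (fplus f)) x 0%nat) (curlk n (v m) x 0%nat)).
    assert (M1 := M (curlk n (v (fplus f)) x 1%nat) (curlk n (v m) x 1%nat)).
    assert (M2 := M (curlk n (v (fplus f)) x 2%nat) (curlk n (v m) x 2%nat)).
    lra.
Qed.

Lemma W_ge0 n k f : In f Eh -> adjacent f k -> 0 <= W n k f.
Proof.
  intros Hf Hk; destruct (face_pol_fields f Hf) as (N & A & _).
  apply (int_simplex_ge0 d _ _ (N + N)); [apply pol_dot3; apply A, Hk|intros; apply dot3_ge0].
Qed.

Lemma weighted_avg_le f n i j : In f Eh ->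
  h_f d Th f ^ i / p_f Th f ^ j *
    int_f d f (fun x => dot3 (avg (curlh n v) f x) (avg (curlh n v) f x)) <=
  s ^ (i + j) * adj_sum (fun k f => h k ^ i / p k ^ j * W n k f) f.
Proof.
  intros Hf.
  assert (Sc := fun k => face_scales f k Hf).
  destruct (Sc (fplus f) (or_introl eq_refl)) as (hf0 & _ & pf0 & _).
  assert (w0 : 0 <= h_f d Th f ^ i / p_f Th f ^ j).
  { apply Rdiv_le_0_compat; [apply pow_le; lra|apply pow_lt; exact pf0]. }
  eapply Rle_trans; [apply Rmult_le_compat_l; [exact w0|apply avg_le, Hf]|].
  assert (K : forall k, adjacent f k -> h_f d Th f ^ i / p_f Th f ^ j * W n k f <=
     s ^ (i + j) * (h k ^ i / p k ^ j * W n k f)).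
  { intros k Hk; destruct (Sc k Hk) as (_ & H1 & _ & H2).
    rewrite <- Rmult_assoc; apply Rmult_le_compat_r; [apply W_ge0; assumption|].
    apply weight_le; auto.
    assert (P := p_ge2 k (adjacent_lt f k Hf Hk)); lra. }
  unfold adj_sum; assert (Kp := K _ (or_introl eq_refl)).
  destruct (fminus f) as [m|] eqn:Em; [|lra].
  assert (Km := K m (or_intror Em)); lra.
Qed.

(** The term with [curl^3] brings [s ^ 9] from replacing face weights by element weights and [s ^ 3]
    from the inverse inequalities; the other brings only [s ^ 4]. The numerical factor rounds up
    [1382400000 + 144]. *)
Lemma averages_bound : sum_list (map (fun f => C3 f + C2 f) Eh) <=
  1400000000 * s ^ 12 * sumR (length Th) N2.
Proof.
  assert (P : forall i j, (i <= j)%nat -> s ^ i <= s ^ j) by (intros; apply Rle_pow; assumption).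
  apply Rle_trans with (sum_list (map (adj_sum (fun k f =>
    s ^ 9 * (h k ^ 3 / p k ^ 6 * W 3 k f) + s ^ 3 * (h k / p k ^ 2 * W 2 k f))) Eh)).
  - apply sum_list_le; intros f Hf.
    assert (A3 := weighted_avg_le f 3 3 6 Hf); assert (A2 := weighted_avg_le f 2 1 2 Hf).
    unfold C2, C3; change (3 + 6)%nat with 9%nat in A3; change (1 + 2)%nat with 3%nat in A2.
    rewrite pow_1 in A2; unfold adj_sum in *; rewrite pow_1 in A2.
    destruct (fminus f) as [m|]; [rewrite pow_1 in A2|]; lra.
  - rewrite (adj_sum_exchange (length Th)) by apply face_elements.
    rewrite <- sumR_scal; apply sumR_le; intros k Hk.
    assert (B2 := curl2_boundary_sum k Hk); assert (B3 := curl3_boundary_sum k Hk).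
    assert (N0 := N2_ge0 k Hk).
    apply Rle_trans with (s ^ 9 * (h k ^ 3 / p k ^ 6 * sum_list (map (W 3 k) (filter (adjb k) Eh)))
      + s ^ 3 * (h k / p k ^ 2 * sum_list (map (W 2 k) (filter (adjb k) Eh)))).
    { right; rewrite <- !Rmult_assoc, <- sum_list_lincomb; f_equal; apply map_ext; intros f; ring. }
    assert (s9 : 0 <= s ^ 9) by (apply pow_le; lra); assert (s3 : 0 <= s ^ 3) by (apply pow_le; lra).
    apply (Rmult_le_compat_l _ _ _ s9) in B3; apply (Rmult_le_compat_l _ _ _ s3) in B2.
    assert (Q4 : s ^ 4 * N2 k <= s ^ 12 * N2 k).
    { apply Rmult_le_compat_r; [exact N0|apply P; lia]. }
    replace (s ^ 9 * (1382400000 * s ^ 3 * N2 k)) with (1382400000 * (s ^ 12 * N2 k)) in B3 by ring.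
    replace (s ^ 3 * (144 * s * N2 k)) with (144 * (s ^ 4 * N2 k)) in B2 by ring.
    assert (0 <= s ^ 12 * N2 k) by (apply Rmult_le_pos; [apply pow_le; lra|exact N0]).
    lra.
Qed.

Lemma dot3_young u w e : 0 < e -> - e * dot3 u u - / e * dot3 w w <= 2 * dot3 u w.
Proof.
  intros He; assert (ie : 0 < / e) by (apply Rinv_0_lt_compat, He).
  assert (K : forall x y : R, - e * x ^ 2 - / e * y ^ 2 <= 2 * (x * y)).
  { intros x y; assert (0 <= / e * (e * x + y) ^ 2) by (apply Rmult_le_pos; [lra|apply pow2_ge_0]).
    replace (/ e * (e * x + y) ^ 2) with (e * x ^ 2 + 2 * (x * y) + / e * y ^ 2) in H by (field; lra).
    lra. }
  rewrite !dot3_self; unfold dot3; simpl sumR.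
  assert (K0 := K (u 0%nat) (w 0%nat)); assert (K1 := K (u 1%nat) (w 1%nat));
    assert (K2 := K (u 2%nat) (w 2%nat)); lra.
Qed.

Ltac pols D := repeat first [apply D; assumption | apply pol_scal | apply pol_add].

(** Young's inequality is used pointwise with parameters [e / w3] and [e / w2]. The averages then
    carry exactly [e] times their weights in the norm and the jumps [/ e] times theirs, so penalties
    of at least [/ e + 1] leave the jumps with coefficient one. *)
Lemma face_lower_bound f e eta1 eta2 : In f Eh -> 0 < e -> / e + 1 <= eta1 -> / e + 1 <= eta2 ->
  - e * (C3 f + C2 f)
  + p_f Th f ^ 6 / h_f d Th f ^ 3 * int_f d f (fun x => dot3 (jump v f x) (jump v f x))
  + p_f Th f ^ 2 / h_f d Th f *
      int_f d f (fun x => dot3 (jump (curlh 1 v) f x) (jump (curlh 1 v) f x)) <=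
  int_f d f (fun x =>
      dot3 (avg (curlh 3 v) f x) (jump v f x)
    + dot3 (avg (curlh 2 v) f x) (jump (curlh 1 v) f x)
    + dot3 (avg (curlh 3 v) f x) (jump v f x)
    + dot3 (avg (curlh 2 v) f x) (jump (curlh 1 v) f x)
    + eta1 * p_f Th f ^ 2 / h_f d Th f * dot3 (jump (curlh 1 v) f x) (jump (curlh 1 v) f x)
    + eta2 * p_f Th f ^ 6 / h_f d Th f ^ 3 * dot3 (jump v f x) (jump v f x)).
Proof.
  intros Hf He H1 H2.
  destruct (face_scales f (fplus f) Hf (or_introl eq_refl)) as (hf0 & _ & pf0 & _).
  destruct (face_pol_fields f Hf) as (N & _ & A & B).
  assert (A3 := A 3%nat); assert (A2 := A 2%nat); assert (J1 := B 1%nat).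
  assert (J0 : pol_field d N (jump v f)) by exact (B 0%nat).
  clear A B; unfold C2, C3.
  set (u3 := avg (curlh 3 v) f) in *; set (u2 := avg (curlh 2 v) f) in *.
  set (j1 := jump (curlh 1 v) f) in *; set (j0 := jump v f) in *.
  set (w2 := p_f Th f ^ 2 / h_f d Th f); set (w3 := p_f Th f ^ 6 / h_f d Th f ^ 3).
  assert (w20 : 0 < w2) by (apply Rdiv_lt_0_compat; [apply pow_lt|]; assumption).
  assert (w30 : 0 < w3) by (apply Rdiv_lt_0_compat; apply pow_lt; assumption).
  replace (h_f d Th f ^ 3 / p_f Th f ^ 6) with (/ w3) by (unfold w3; field; split; lra).
  replace (h_f d Th f / p_f Th f ^ 2) with (/ w2) by (unfold w2; field; split; lra).
  replace (eta1 * p_f Th f ^ 2 / h_f d Th f) with (eta1 * w2) by (unfold w2, Rdiv; ring).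
  replace (eta2 * p_f Th f ^ 6 / h_f d Th f ^ 3) with (eta2 * w3) by (unfold w3, Rdiv; ring).
  assert (D : forall F G, pol_field d N F -> pol_field d N G -> pol d (N + N) (fun x => dot3 (F x) (G x)))
    by (intros; apply pol_dot3; assumption).
  apply Rle_trans with (int_f d f (fun x => - (e * / w3) * dot3 (u3 x) (u3 x) + - (e * / w2) * dot3 (u2 x) (u2 x)
     + w3 * dot3 (j0 x) (j0 x) + w2 * dot3 (j1 x) (j1 x))).
  - right; unfold int_f.
    rewrite !(int_simplex_plus d _ _ (N + N) (N + N)); try pols D.
    rewrite !(int_simplex_scal d _ _ (N + N)); try pols D; ring.
  - apply (int_simplex_le d _ _ (N + N) (N + N)); [pols D..|].
    intros x.
    assert (Y3 := dot3_young (u3 x) (j0 x) (e * / w3) ltac:(apply Rmult_lt_0_compat; [exact He|apply Rinv_0_lt_compat, w30])).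
    assert (Y2 := dot3_young (u2 x) (j1 x) (e * / w2) ltac:(apply Rmult_lt_0_compat; [exact He|apply Rinv_0_lt_compat, w20])).
    replace (/ (e * / w3)) with (/ e * w3) in Y3 by (field; split; lra).
    replace (/ (e * / w2)) with (/ e * w2) in Y2 by (field; split; lra).
    assert (Q0 : (/ e + 1) * (w3 * dot3 (j0 x) (j0 x)) <= eta2 * (w3 * dot3 (j0 x) (j0 x))).
    { apply Rmult_le_compat_r; [|exact H2]; apply Rmult_le_pos; [lra|apply dot3_ge0]. }
    assert (Q1 : (/ e + 1) * (w2 * dot3 (j1 x) (j1 x)) <= eta1 * (w2 * dot3 (j1 x) (j1 x))).
    { apply Rmult_le_compat_r; [|exact H1]; apply Rmult_le_pos; [lra|apply dot3_ge0]. }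
    lra.
Qed.

(** The volume term [M] has to pay [e * M] for its own part of the norm and at most [2 * e * C * M]
    for the averages. The choice [e = / (2 * (C + 1))] makes the total at most [M]. *)
Lemma coercivity C e eta1 eta2 : C = 1400000000 * s ^ 12 -> e = / (2 * (C + 1)) ->
  / e + 1 <= eta1 -> / e + 1 <= eta2 ->
  e * dgnorm2 d Th Eh v <= a_h d Th Eh eta1 eta2 v v.
Proof.
  intros HC He H1 H2; unfold dgnorm2, a_h; rewrite !sum_list_seq.
  assert (C0 : 0 <= C).
  { rewrite HC; apply Rmult_le_pos; [lra|apply pow_le; lra]. }
  assert (e0 : 0 < e) by (rewrite He; apply Rinv_0_lt_compat; lra).
  assert (e1 : e * (2 * (C + 1)) = 1) by (rewrite He; field; lra).
  set (M := sumR (length Th) _).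
  set (N := sumR (length Th) N2).
  assert (N0 : 0 <= N).
  { unfold N; rewrite <- (sumR_zero (length Th) (fun _ => 0)) by reflexivity.
    apply sumR_le; intros; apply N2_ge0; assumption. }
  assert (NM : N <= M).
  { apply sumR_le; intros k Hk; assert (P2 := Vh_pol_field k 2 Hk); assert (P0 := Vh_pol_field k 0 Hk).
    unfold N2, int_K; eapply int_simplex_le.
    - apply pol_dot3; exact P2.
    - apply pol_add; apply pol_dot3; [exact P2|exact P2|exact P0|exact P0].
    - intros x; change (curlk 0 (v k)) with (v k) in *; assert (D := dot3_ge0 (v k x)); lra. }
  assert (AB : sum_list (map (fun f => C3 f + C2 f) Eh) <= C * N) by (rewrite HC; apply averages_bound).
  (* Facewise, the lower bound contains the averages with factor [-e] while the norm requires [+e];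
     the difference is the term with [-2 * e]. The jumps only need [e <= 1]. *)
  assert (K : e * sum_list (map (fun f =>
      p_f Th f ^ 6 / h_f d Th f ^ 3 * int_f d f (fun x => dot3 (jump v f x) (jump v f x))
    + C3 f + C2 f + p_f Th f ^ 2 / h_f d Th f *
        int_f d f (fun x => dot3 (jump (curlh 1 v) f x) (jump (curlh 1 v) f x))) Eh)
    + -2 * e * sum_list (map (fun f => C3 f + C2 f) Eh) <=
    sum_list (map (fun f => int_f d f (fun x =>
      dot3 (avg (curlh 3 v) f x) (jump v f x)
    + dot3 (avg (curlh 2 v) f x) (jump (curlh 1 v) f x)
    + dot3 (avg (curlh 3 v) f x) (jump v f x)
    + dot3 (avg (curlh 2 v) f x) (jump (curlh 1 v) f x)
    + eta1 * p_f Th f ^ 2 / h_f d Th f * dot3 (jump (curlh 1 v) f x) (jump (curlh 1 v) f x)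
    + eta2 * p_f Th f ^ 6 / h_f d Th f ^ 3 * dot3 (jump v f x) (jump v f x))) Eh)).
  { rewrite <- sum_list_lincomb; apply sum_list_le; intros f Hf.
    assert (L := face_lower_bound f e eta1 eta2 Hf e0 H1 H2).
    destruct (face_scales f (fplus f) Hf (or_introl eq_refl)) as (hf0 & _ & pf0 & _).
    destruct (face_pol_fields f Hf) as (n & _ & _ & B).
    assert (X0 : 0 <= p_f Th f ^ 6 / h_f d Th f ^ 3 * int_f d f (fun x => dot3 (jump v f x) (jump v f x))).
    { apply Rmult_le_pos; [apply Rdiv_le_0_compat; [apply pow_le|apply pow_lt]; lra|].
      apply (int_simplex_ge0 d _ _ (n + n)); [apply pol_dot3; exact (B 0%nat)|intros; apply dot3_ge0]. }
    assert (Y0 : 0 <= p_f Th f ^ 2 / h_f d Th f *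
        int_f d f (fun x => dot3 (jump (curlh 1 v) f x) (jump (curlh 1 v) f x))).
    { apply Rmult_le_pos; [apply Rdiv_le_0_compat; [apply pow_le|]; lra|].
      apply (int_simplex_ge0 d _ _ (n + n)); [apply pol_dot3; exact (B 1%nat)|intros; apply dot3_ge0]. }
    assert (e2 : e <= 1).
    { assert (0 <= e * C) by (apply Rmult_le_pos; lra); lra. }
    set (X := p_f Th f ^ 6 / h_f d Th f ^ 3 * _) in *; set (Y := p_f Th f ^ 2 / h_f d Th f * _) in *.
    assert (0 <= (1 - e) * X) by (apply Rmult_le_pos; lra).
    assert (0 <= (1 - e) * Y) by (apply Rmult_le_pos; lra).
    lra. }
  unfold C2 at 1, C3 at 1 in K.
  assert (2 * e * sum_list (map (fun f => C3 f + C2 f) Eh) <= 2 * e * (C * N)).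
  { apply Rmult_le_compat_l; lra. }
  assert (2 * e * C * N <= 2 * e * C * M).
  { apply Rmult_le_compat_l; [|exact NM]; apply Rmult_le_pos; lra. }
  assert (e * M * (2 * (C + 1)) = M) by (transitivity (e * (2 * (C + 1)) * M); [ring|rewrite e1; ring]).
  assert (0 <= e * M) by (apply Rmult_le_pos; lra).
  lra.
Qed.
End Mesh.

Theorem theorem3p1 :
  forall d : nat, (d = 2 \/ d = 3)%nat ->
  forall sigma : R,
  exists eta1s eta2s c : R, 0 < eta1s /\ 0 < eta2s /\ 0 < c /\
  forall (Th : list element) (Eh : list face),
    mesh_ok d Th Eh -> mesh_regular d sigma Th Eh ->
    (forall k, (k < length Th)%nat -> (2 <= edeg (elt Th k))%nat) ->
    forall eta1 eta2 : R, eta1s < eta1 -> eta2s < eta2 ->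
    forall v : dgfun, in_Vh d Th v ->
      c * dgnorm2 d Th Eh v <= a_h d Th Eh eta1 eta2 v v.
Proof.
  (* Raising [sigma] to at least one weakens the regularity assumption, makes the powers of [s]
     monotone, and lets an element be compared with itself. *)
  intros d Hd sigma; set (s := Rmax sigma 1).
  assert (s1 : 1 <= s) by apply Rmax_r; assert (ss : sigma <= s) by apply Rmax_l.
  set (C := 1400000000 * s ^ 12).
  assert (C0 : 0 <= C) by (apply Rmult_le_pos; [lra|apply pow_le; lra]).
  assert (e0 : 0 < / (2 * (C + 1))) by (apply Rinv_0_lt_compat; lra).
  (* With [e = / (2 * (C + 1))] the thresholds are [/ e + 1] and the coercivity constant is [e]. *)
  exists (2 * (C + 1) + 1), (2 * (C + 1) + 1), (/ (2 * (C + 1))).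
  split; [lra|split; [lra|split; [exact e0|]]].
  intros Th Eh Hok Hreg Hdeg eta1 eta2 H1 H2 v Hv.
  apply (coercivity d s Th Eh Hd s1 Hok) with (C := C); auto; try (rewrite Rinv_inv; lra).
  destruct Hreg as [R1 R2]; split.
  - intros k Hk; eapply Rle_trans; [apply R1, Hk|].
    apply Rmult_le_compat_r; [apply sqrt_pos|exact ss].
  - intros f m Hf Hm; destruct (R2 f m Hf Hm) as (Q1 & Q2 & Q3 & Q4).
    assert (M : forall x y, 0 <= y -> x <= sigma * y -> x <= s * y).
    { intros x y Hy Hx; eapply Rle_trans; [exact Hx|apply Rmult_le_compat_r; assumption]. }
    repeat split; apply M; auto; try apply pos_INR; apply maxR_ge0.
Qed.
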